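(* For $c\in(0,\infty]$, the subalgebra $C(S^2_{qc}/\mathbb{Z}_2):=\{a\in C(S^2_{qc})\mid\bar r_1^c(a)=a\}$ of $\mathbb{Z}_2$-invariants of $C(S^2_{qc})$ is isomorphic to the $C^*$-algebra $C(D_{q^4})$ of the quantum disc.
   Context: Fix $q\in\mathbb{R}$ with $0<|q|<1$. All algebras are unital and over $\mathbb{C}$. The $C^*$-closure of a $*$-algebra means the completion with respect to the supremum norm over all $*$-representations in bounded operators. $C(S^2_{q\infty})$ is the $C^*$-closure of $P(S^2_{q\infty})$, the quotient of the free $*$-algebra $\mathbb{C}\langle A,B\rangle$ by the two-sided $*$-ideal generated by $A^*=A$, $BA=q^2AB$, $B^*B=-A^2+I$, $BB^*=-q^4A^2+I$. For $c\in(0,\infty)$, $C(S^2_{qc})$ is the $C^*$-closure of $P(S^2_{qc})$, the quotient of $\mathbb{C}\langle A_c,B_c\rangle$ by the two-sided $*$-ideal generated by $A_c^*=A_c$, $B_cA_c=q^2A_cB_c$, $B_c^*B_c=A_c-A_c^2+cI$, $B_cB_c^*=q^2A_c-q^4A_c^2+cI$. For $0<s<1$, $C(D_s)$ is the $C^*$-closure of the $*$-algebra $P(D_s)=\mathbb{C}\langle x,x^*\rangle/J_s$, where $J_s$ is the two-sided ideal generated by $x^*x-s\,xx^*=1-s$. Here $s=q^4$. Let $\{e_k\}_{k\in\mathbb{N}}$ ($k\ge 0$) be an orthonormal basis of a Hilbert space. The representations $\pi_\pm=\pi^\infty_\pm$ of $C(S^2_{q\infty})$ are given by $\pi_\pm(A)e_k=\pm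 q^{2k}e_k$, $\pi_\pm(B)e_k=(1-q^{4k})^{1/2}e_{k-1}$ for $k\ge1$, $\pi_\pm(B)e_0=0$. For $c\in(0,\infty)$ the representations $\pi^c_\pm$ of $C(S^2_{qc})$ are given by $\pi^c_\pm(A_c)e_k=\lambda_\pm q^{2k}e_k$, $\pi^c_\pm(B_c)e_k=c_\pm(k)^{1/2}e_{k-1}$ for $k\ge1$, $\pi^c_\pm(B_c)e_0=0$, where $\lambda_\pm=\frac12\pm(c+\frac14)^{1/2}$ and $c_\pm(k)=\lambda_\pm q^{2k}-(\lambda_\pm q^{2k})^2+c$. Let $C^*(\mathfrak{S})$ be the $C^*$-algebra generated by the one-sided shift $\mathfrak{S}e_i=e_{i+1}$, $\sigma:C^*(\mathfrak{S})\to C(S^1)$ the symbol map ($\mathfrak{S}\mapsto u$, the unitary generator of $C(S^1)$), and $C^*(\mathfrak{S})\oplus_\sigma C^*(\mathfrak{S}):=\{(a_1,a_2)\mid\sigma(a_1)=\sigma(a_2)\}$. It is known that for all $c\in(0,\infty]$, $\pi_+^c\oplus\pi_-^c:C(S^2_{qc})\to C^*(\mathfrak{S})\oplus_\sigma C^*(\mathfrak{S})$ is a $C^*$-isomorphism. Let $\tau(a,b)=(b,a)$ be the flip on $C^*(\mathfrak{S})\oplus_\sigma C^*(\mathfrak{S})$. Put $\bar r_1:=(\pi_+\oplus\pi_-)^{-1}\circ\tau\circ(\pi_+\oplus\pi_-)$, $\chi_c:=(\pi_+\oplus\pi_-)^{-1}\circ(\pi^c_+\oplus\pi^c_-):C(S^2_{qc})\to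 C(S^2_{q\infty})$, and $\bar r_1^c:=\chi_c^{-1}\circ\bar r_1\circ\chi_c$ (so $\bar r_1^\infty=\bar r_1$). *)

(* Defs.v *)
From HB Require Import structures.
From mathcomp Require Import all_boot all_order all_algebra.
From mathcomp Require Import finmap.
From mathcomp Require Import complex.
From mathcomp Require Import all_classical all_reals all_analysis.
From mathcomp Require Import -(notations) monalg.

Set Implicit Arguments.
Unset Strict Implicit.
Unset Printing Implicit Defensive.

Import Order.TTheory GRing.Theory Num.Theory.
Import numFieldNormedType.Exports.

Local Open Scope classical_set_scope.
Local Open Scope complex_scope.
Local Open Scope ring_scope.

HB.mixin Record isStarAlgebra (R : realType) A of GRing.Algebra R[i] A := {
  star : A -> A;
  starK : involutive star;
  starD : {morph star : x y / x + y};
  starZ : forall (k : R[i]) (x : A), star (k *: x) = k^* *: star x;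
  starM : forall x y : A, star (x * y) = star y * star x }.

#[short(type="starAlgType")]
HB.structure Definition StarAlgebra (R : realType) :=
  {A of isStarAlgebra R A & GRing.Algebra R[i] A}.

(* The hierarchy admits no join of algType and normedModType (numDomainType
   is already below the underlying ring and normed structures), hence the
   separate real-valued norm and the explicit completeness axiom. *)
HB.mixin Record isCStarAlgebra (R : realType) A of StarAlgebra R A := {
  cnorm : A -> R;
  cnorm_ge0 : forall x : A, 0 <= cnorm x;
  cnorm_eq0 : forall x : A, cnorm x = 0 -> x = 0;
  cnormD : forall x y : A, cnorm (x + y) <= cnorm x + cnorm y;
  cnormZ : forall (k : R[i]) (x : A), cnorm (k *: x) = complex.Re `|k| * cnorm x;
  cnormM : forall x y : A, cnorm (x * y) <= cnorm x * cnorm y;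
  cnorm_cstar : forall x : A, cnorm (star x * x) = cnorm x ^+ 2;
  cnorm_complete : forall u : nat -> A,
    (forall eps : R, 0 < eps -> exists N : nat, forall m n : nat,
       (N <= m)%N -> (N <= n)%N -> cnorm (u m - u n) < eps) ->
    exists l : A, forall eps : R, 0 < eps -> exists N : nat, forall n : nat,
       (N <= n)%N -> cnorm (u n - l) < eps }.

#[short(type="cstarAlgType")]
HB.structure Definition CStarAlgebra (R : realType) :=
  {A of isCStarAlgebra R A & StarAlgebra R A}.

HB.mixin Record isHilbert (R : realType) H of CompleteNormedModule R[i] H := {
  inner : H -> H -> R[i];
  inner_linear : forall y : H, linear_for *%R (inner^~ y);
  inner_conj : forall x y : H, inner y x = (inner x y)^*;
  inner_norm : forall x : H, inner x x = `|x| ^+ 2 }.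

#[short(type="hilbertType")]
HB.structure Definition Hilbert (R : realType) :=
  {H of isHilbert R H & CompleteNormedModule R[i] H}.

Section StarMorphisms.
Variable R : realType.

Record is_star_hom (A B : starAlgType R) (f : A -> B) : Prop := IsStarHom {
  star_hom_linear : linear f;
  star_hom_monoid : monoid_morphism f;
  star_hom_star : forall x, f (star x) = star (f x) }.

(* A unital *-homomorphism into the bounded operators on H; the adjoint of
   rho a is described through the inner product. *)
Record is_star_rep (A : starAlgType R) (H : hilbertType R)
    (rho : A -> H -> H) : Prop := IsStarRep {
  star_rep_op_linear : forall a, linear (rho a);
  star_rep_op_bounded : forall a, exists M : R[i],
    forall x, `|rho a x| <= M * `|x|;
  star_rep_linear : forall x, linear (rho^~ x);
  star_rep1 : forall x, rho 1 x = x;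
  star_repM : forall a b x, rho (a * b) x = rho a (rho b x);
  star_rep_adj : forall a x y, inner (rho a x) y = inner x (rho (star a) y) }.

Definition opnorm (H : hilbertType R) (T : H -> H) : \bar R :=
  ereal_sup [set (complex.Re `|T x|)%:E | x in [set x : H | `|x| <= 1]].

Definition univ_norm (A : starAlgType R) (a : A) : \bar R :=
  ereal_sup [set r | exists (H : hilbertType R) (rho : A -> H -> H),
                       is_star_rep rho /\ r = opnorm (rho a)].

(* A, together with iota, is the completion of the *-algebra P with respect to
   univ_norm; iota need not be injective, since univ_norm may be a seminorm. *)
Record is_cstar_closure (P : starAlgType R) (A : cstarAlgType R)
    (iota : P -> A) : Prop := IsCstarClosure {
  closure_hom : is_star_hom iota;
  closure_norm : forall p, (cnorm (iota p))%:E = univ_norm p;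
  closure_dense : forall (a : A) (eps : R), 0 < eps ->
    exists p, cnorm (a - iota p) < eps }.

Definition orthonormal_basis (H : hilbertType R) (e : nat -> H) : Prop :=
  (forall i j, inner (e i) (e j) = (i == j)%:R) /\
  dense [set x : H | exists (n : nat) (k : nat -> R[i]),
                       x = \sum_(i < n) k i *: e i].

End StarMorphisms.

Section StarIdeals.
Variables (R : realType) (A : starAlgType R).

Definition is_star_ideal (J : set A) : Prop :=
  [/\ J 0,
      forall x y, J x -> J y -> J (x + y),
      forall a x, J x -> J (a * x) /\ J (x * a) &
      forall x, J x -> J (star x)].

Definition star_ideal (S : set A) : set A := smallest is_star_ideal S.

Lemma star_idealP (S : set A) : is_star_ideal (star_ideal S).
Proof.
split.
- by move=> J [[J0 _ _ _] _].
- by move=> x y Jx Jy J JS; case: (JS) => -[_ JD _ _] _; apply: JD; [apply: Jx|apply: Jy].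
- move=> a x Jx; split=> J JS; case: (JS) => -[_ _ JM _] _.
    by have [] := JM a x (Jx J JS).
  by have [] := JM a x (Jx J JS).
- by move=> x Jx J JS; case: (JS) => -[_ _ _ JV] _; apply: JV; apply: Jx.
Qed.

Lemma sub_star_ideal (S : set A) : S `<=` star_ideal S.
Proof. exact: sub_gen_smallest. Qed.

End StarIdeals.

(* The quotient of A by the two-sided *-ideal generated by S; A is required to
   stay nonzero because algType excludes the zero algebra. *)
Section StarQuotient.
Variables (R : realType) (A : starAlgType R) (S : set A).
Hypothesis S1 : ~ star_ideal S 1.

Definition star_ideal_pred : {pred A} := fun x => `[< star_ideal S x >].

Lemma star_ideal_predP x : reflect (star_ideal S x) (x \in star_ideal_pred).
Proof. exact: asboolP. Qed.

Let J := star_idealP S.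

Lemma star_idealN x : star_ideal S x -> star_ideal S (- x).
Proof. by case: J => _ _ JM _ /(JM (-1))[]; rewrite mulN1r. Qed.

Lemma star_ideal_zmod_closed : zmod_closed star_ideal_pred.
Proof.
case: J => J0 JD _ _; split; first exact/star_ideal_predP.
move=> x y /star_ideal_predP Jx /star_ideal_predP Jy.
apply/star_ideal_predP; apply: JD Jx _; exact: star_idealN.
Qed.

HB.instance Definition _ :=
  GRing.isZmodClosed.Build A star_ideal_pred star_ideal_zmod_closed.

Definition star_quot of ~ star_ideal S 1 := Quotient.quot star_ideal_pred.

Local Notation Q := (star_quot S1).

HB.instance Definition _ := GRing.Zmodule.on Q.

Definition star_quot_pi (x : A) : Q := \pi_(Quotient.quot star_ideal_pred)%qT x.

Lemma star_quot_piP x y : star_quot_pi x = star_quot_pi y <-> star_ideal S (x - y).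
Proof.
split=> [/eqP|Jxy]; last apply/eqP.
  by rewrite -Quotient.idealrBE => /star_ideal_predP.
by rewrite -Quotient.idealrBE; apply/star_ideal_predP.
Qed.

Lemma star_quot_pi_surj (x : Q) : exists y, x = star_quot_pi y.
Proof. by exists (repr (x : Quotient.quot star_ideal_pred)); rewrite /star_quot_pi reprK. Qed.

Definition star_quot_lift (x : Q) : A := repr (x : Quotient.quot star_ideal_pred).

Lemma star_quot_liftK : cancel star_quot_lift star_quot_pi.
Proof. by move=> x; rewrite /star_quot_pi reprK. Qed.

Lemma star_quot_lift_pi x : star_ideal S (star_quot_lift (star_quot_pi x) - x).
Proof. by apply/star_quot_piP; rewrite star_quot_liftK. Qed.

Lemma star_quot_piD x y : star_quot_pi (x + y) = star_quot_pi x + star_quot_pi y.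
Proof. by rewrite /star_quot_pi Quotient.pi_add. Qed.

Definition star_quot_one : Q := star_quot_pi 1.
Definition star_quot_mul (x y : Q) : Q :=
  star_quot_pi (star_quot_lift x * star_quot_lift y).
Definition star_quot_scale (k : R[i]) (x : Q) : Q :=
  star_quot_pi (k *: star_quot_lift x).
Definition star_quot_star (x : Q) : Q := star_quot_pi (star (star_quot_lift x)).

Lemma star_quot_piM x y :
  star_quot_mul (star_quot_pi x) (star_quot_pi y) = star_quot_pi (x * y).
Proof.
apply/star_quot_piP; case: J => _ JD JM _.
set x' := star_quot_lift _; set y' := star_quot_lift _.
rewrite (_ : _ - _ = (x' - x) * y' + x * (y' - y)); last first.
  by rewrite mulrBl mulrBr addrA subrK.
by apply: JD; [case: (JM y' _ (star_quot_lift_pi x))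
              |case: (JM x _ (star_quot_lift_pi y))].
Qed.

Lemma star_quot_piZ k x : star_quot_scale k (star_quot_pi x) = star_quot_pi (k *: x).
Proof.
apply/star_quot_piP; case: J => _ _ JM _.
rewrite -scalerBr -[X in k *: X]mul1r scalerAl.
by case: (JM (k *: 1) _ (star_quot_lift_pi x)).
Qed.

Lemma star_quot_piS x : star_quot_star (star_quot_pi x) = star_quot_pi (star x).
Proof.
apply/star_quot_piP; case: J => _ _ _ JV.
have -> : star (star_quot_lift (star_quot_pi x)) - star x =
          star (star_quot_lift (star_quot_pi x) - x).
  by rewrite starD -(scaleN1r x) starZ rmorphN rmorph1 scaleN1r.
by apply: JV; apply: star_quot_lift_pi.
Qed.

Let piE := (star_quot_piM, star_quot_piZ, star_quot_piS).
Let repr_ := star_quot_pi_surj.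

Lemma star_quot_mulA : associative star_quot_mul.
Proof.
move=> x y z; have [[x' ->] [y' ->] [z' ->]] := And3 (repr_ x) (repr_ y) (repr_ z).
by rewrite !piE mulrA.
Qed.
Lemma star_quot_mul1 : left_id star_quot_one star_quot_mul.
Proof. by move=> x; have [x' ->] := repr_ x; rewrite !piE mul1r. Qed.
Lemma star_quot_1mul : right_id star_quot_one star_quot_mul.
Proof. by move=> x; have [x' ->] := repr_ x; rewrite !piE mulr1. Qed.
Lemma star_quot_mulDl : left_distributive star_quot_mul +%R.
Proof.
move=> x y z; have [[x' ->] [y' ->] [z' ->]] := And3 (repr_ x) (repr_ y) (repr_ z).
by rewrite -star_quot_piD !piE -star_quot_piD mulrDl.
Qed.
Lemma star_quot_mulDr : right_distributive star_quot_mul +%R.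
Proof.
move=> x y z; have [[x' ->] [y' ->] [z' ->]] := And3 (repr_ x) (repr_ y) (repr_ z).
by rewrite -star_quot_piD !piE -star_quot_piD mulrDr.
Qed.
Lemma star_quot_pi0 : star_quot_pi 0 = 0.
Proof. by apply: (addrI (star_quot_pi 0)); rewrite -star_quot_piD !addr0. Qed.
Lemma star_quot_nz : star_quot_one != 0.
Proof.
apply/eqP; rewrite /star_quot_one -star_quot_pi0 => /star_quot_piP.
by rewrite subr0.
Qed.

HB.instance Definition _ := GRing.Zmodule_isNzRing.Build Q
  star_quot_mulA star_quot_mul1 star_quot_1mul star_quot_mulDl star_quot_mulDr
  star_quot_nz.

Lemma star_quot_scaleA a b v :
  star_quot_scale a (star_quot_scale b v) = star_quot_scale (a * b) v.
Proof. by have [v' ->] := repr_ v; rewrite !piE scalerA. Qed.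
Lemma star_quot_scale1 : left_id 1 star_quot_scale.
Proof. by move=> x; have [x' ->] := repr_ x; rewrite !piE scale1r. Qed.
Lemma star_quot_scaleDr : right_distributive star_quot_scale +%R.
Proof.
move=> k x y; have [[x' ->] [y' ->]] := conj (repr_ x) (repr_ y).
by rewrite -star_quot_piD !piE -star_quot_piD scalerDr.
Qed.
Lemma star_quot_scaleDl v : {morph star_quot_scale^~ v : a b / a + b}.
Proof.
move=> a b; have [v' ->] := repr_ v.
by rewrite /= !piE -star_quot_piD scalerDl.
Qed.

HB.instance Definition _ := GRing.Zmodule_isLmodule.Build R[i] Q
  star_quot_scaleA star_quot_scale1 star_quot_scaleDr star_quot_scaleDl.

Lemma star_quot_scaleAl (k : R[i]) (x y : Q) : k *: (x * y) = (k *: x) * y.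
Proof.
have [[x' ->] [y' ->]] := conj (repr_ x) (repr_ y).
rewrite -[LHS]/(star_quot_scale k (star_quot_mul _ _)).
by rewrite -[RHS]/(star_quot_mul (star_quot_scale k _) _) !piE scalerAl.
Qed.

HB.instance Definition _ := GRing.Lmodule_isLalgebra.Build R[i] Q star_quot_scaleAl.

Lemma star_quot_scaleAr (k : R[i]) (x y : Q) : k *: (x * y) = x * (k *: y).
Proof.
have [[x' ->] [y' ->]] := conj (repr_ x) (repr_ y).
rewrite -[LHS]/(star_quot_scale k (star_quot_mul _ _)).
by rewrite -[RHS]/(star_quot_mul _ (star_quot_scale k _)) !piE scalerAr.
Qed.

HB.instance Definition _ := GRing.Lalgebra_isAlgebra.Build R[i] Q star_quot_scaleAr.

Lemma star_quot_starK : involutive star_quot_star.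
Proof. by move=> x; have [x' ->] := repr_ x; rewrite !piE starK. Qed.
Lemma star_quot_starD : {morph star_quot_star : x y / x + y}.
Proof.
move=> x y; have [[x' ->] [y' ->]] := conj (repr_ x) (repr_ y).
by rewrite -star_quot_piD !piE -star_quot_piD starD.
Qed.
Lemma star_quot_starZ (k : R[i]) (x : Q) :
  star_quot_star (k *: x) = k^* *: star_quot_star x.
Proof.
have [x' ->] := repr_ x.
rewrite -[k *: _]/(star_quot_scale k _).
by rewrite -[RHS]/(star_quot_scale _ _) !piE starZ.
Qed.
Lemma star_quot_starM (x y : Q) :
  star_quot_star (x * y) = star_quot_star y * star_quot_star x.
Proof.
have [[x' ->] [y' ->]] := conj (repr_ x) (repr_ y).
rewrite -[_ * _ in LHS]/(star_quot_mul _ _).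
by rewrite -[RHS]/(star_quot_mul _ _) !piE starM.
Qed.

HB.instance Definition _ := isStarAlgebra.Build R Q
  star_quot_starK star_quot_starD star_quot_starZ star_quot_starM.

Lemma star_quot_pi_is_star_hom : is_star_hom star_quot_pi.
Proof.
split=> [k x y|//|x]; last by rewrite -star_quot_piS.
- by rewrite star_quot_piD -star_quot_piZ.
- by split=> // x y; rewrite -star_quot_piM.
Qed.

Lemma star_quot_pi_eq0 x : S x -> star_quot_pi x = 0.
Proof.
by move=> Sx; rewrite -star_quot_pi0; apply/star_quot_piP; rewrite subr0; apply: sub_star_ideal.
Qed.

End StarQuotient.

Lemma malg_scaleAr (K : monomType) (C : comNzRingType) (k : C) (x y : malg K C) :
  k *: (x * y) = x * (k *: y).
Proof.
rewrite -[k *: (x * y)]mul_malgC -[k *: y]mul_malgC !mulrA; congr (_ * _).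
rewrite [x]monalgE mulr_sumr mulr_suml; apply: eq_bigr => w _.
by rewrite !malgM_def !fgmulUU mul1m mulm1 mulrC.
Qed.

(* Words in the letters (i, false), standing for x_i, and (i, true), standing
   for x_i^*. *)
Section FreeStar.
Variables (C : numClosedFieldType) (I : choiceType).

Local Notation word := (fmonom (I * bool)%type).
Local Notation F := (malg word C).

Definition word_star (w : word) : word :=
  FMonom (rev [seq (a.1, ~~ a.2) | a <- w]).

Definition malg_star (p : F) : F :=
  \sum_(w <- enum_fset (msupp p)) mkmalgU (word_star w) (mcoeff w p)^*.

Lemma word_starK : involutive word_star.
Proof.
case=> w; rewrite /word_star /= map_rev revK -map_comp.
by congr FMonom; rewrite -[RHS]map_id; apply: eq_map => -[a b] /=; rewrite negbK.
Qed.

Lemma word_starM v w : word_star (mmul v w) = mmul (word_star w) (word_star v).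
Proof. by rewrite /word_star /mmul /= !fmmulE /= map_cat rev_cat. Qed.

Lemma mcoeff_star (p : F) w : mcoeff w (malg_star p) = (mcoeff (word_star w) p)^*.
Proof.
rewrite /malg_star raddf_sum /=.
under eq_bigr do rewrite mcoeffU -(inj_eq (can_inj word_starK)) word_starK.
case: (msuppP p (word_star w)) => [pw|pw].
  rewrite (big_fsetD1 _ pw) /= eqxx mulr1n big1_fset ?addr0 // => v.
  by rewrite in_fsetD1 => /andP[/negbTE -> _].
rewrite big1_fset ?rmorph0 // => v pv _; case: eqP => // vw.
by rewrite -vw pv in pw.
Qed.

Lemma malg_starK : involutive malg_star.
Proof. by move=> p; apply/malgP => w; rewrite !mcoeff_star word_starK conjCK. Qed.

Lemma malg_starD : {morph malg_star : x y / x + y}.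
Proof. by move=> p r; apply/malgP => w; rewrite mcoeff_star [mcoeff _ (p + r)]mcoeffD rmorphD
  [RHS]mcoeffD !mcoeff_star. Qed.

Lemma malg_starZ (k : C) (p : F) : malg_star (k *: p) = k^* *: malg_star p.
Proof. by apply/malgP => w; rewrite mcoeff_star [mcoeff _ (k *: p)]mcoeffZ rmorphM
  [RHS]mcoeffZ mcoeff_star. Qed.

Lemma malg_star0 : malg_star 0 = 0.
Proof. by apply/malgP => w; rewrite mcoeff_star !mcoeff0 rmorph0. Qed.

Lemma malg_starU k w : malg_star (mkmalgU w k) = mkmalgU (word_star w) k^*.
Proof.
apply/malgP => v; rewrite mcoeff_star !mcoeffU.
rewrite -[w == _](inj_eq (can_inj word_starK)) word_starK.
by case: (_ == _); rewrite ?mulr1n ?mulr0n ?rmorph0.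
Qed.

Lemma malg_starM (x y : F) : malg_star (x * y) = malg_star y * malg_star x.
Proof.
have sumS (J : Type) (r : seq J) (f : J -> F) :
    malg_star (\sum_(j <- r) f j) = \sum_(j <- r) malg_star (f j).
  exact: (big_morph _ malg_starD malg_star0).
rewrite [x]monalgE [y]monalgE mulr_suml !sumS mulr_sumr.
apply: eq_bigr => v _; rewrite mulr_sumr sumS mulr_suml; apply: eq_bigr => w _.
by rewrite malgM_def fgmulUU !malg_starU malgM_def fgmulUU word_starM rmorphM mulrC.
Qed.

Definition word_char (t : I -> C) (w : word) : C := \prod_(a <- fmonom_val w) t a.1.

Lemma word_charM t : mmorphism (word_char t).
Proof.
split=> [v w|]; rewrite /word_char.
  by rewrite /mmul /= fmmulE /= big_cat.
by rewrite fm1 big_nil.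
Qed.

HB.instance Definition _ t := isMultiplicative.Build _ _ (word_char t) (word_charM t).

(* The unital algebra homomorphism sending both x_i and x_i^* to t i. *)
Definition malg_char (t : I -> C) (p : F) : C := mmap (idfun : C -> C) (word_char t) p.

Lemma malg_charU t k w : malg_char t (mkmalgU w k) = k * word_char t w.
Proof. exact: mmapU. Qed.
Lemma malg_charD t x y : malg_char t (x + y) = malg_char t x + malg_char t y.
Proof. exact: mmapD. Qed.
Lemma malg_charM t x y : malg_char t (x * y) = malg_char t x * malg_char t y.
Proof. exact: rmorphM. Qed.
Lemma malg_charZ t k x : malg_char t (k *: x) = k * malg_char t x.
Proof. exact: mmapZ. Qed.
Lemma malg_char0 t : malg_char t 0 = 0.
Proof. exact: mmap0. Qed.
Lemma malg_char1 t : malg_char t 1 = 1.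
Proof. exact: mmap1. Qed.

Lemma malg_char_star t x :
  (forall i, (t i)^* = t i) -> malg_char t (malg_star x) = (malg_char t x)^*.
Proof.
move=> tR; rewrite /malg_star (big_morph _ (malg_charD t) (malg_char0 t)).
rewrite [in RHS]/malg_char mmapE rmorph_sum; apply: eq_bigr => w _.
rewrite malg_charU rmorphM /=; congr (_ * _).
rewrite /word_char /= rmorph_prod /= (perm_big _ (permEl (perm_rev _))) big_map /=.
by apply: eq_bigr => a _; rewrite tR.
Qed.

End FreeStar.

Definition free_star (R : realType) (I : choiceType) : Type :=
  malg (fmonom (I * bool)%type) R[i].

HB.instance Definition _ (R : realType) (I : choiceType) :=
  GRing.Lalgebra.on (free_star R I).

HB.instance Definition _ (R : realType) (I : choiceType) :=
  GRing.Lalgebra_isAlgebra.Build R[i] (free_star R I) (@malg_scaleAr _ _).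

HB.instance Definition _ (R : realType) (I : choiceType) :=
  isStarAlgebra.Build R (free_star R I) (@malg_starK _ I) (@malg_starD _ I)
    (@malg_starZ _ I) (@malg_starM _ I).

Definition free_gen (R : realType) (I : choiceType) (i : I) : free_star R I :=
  mkmalgU (FMonom [:: (i, false)]) 1.

Definition free_char (R : realType) (I : choiceType) (t : I -> R) :
  free_star R I -> R[i] := malg_char (fun i => (t i)%:C).

Section FreeChar.
Variables (R : realType) (I : choiceType) (t : I -> R).
Implicit Types x y : free_star R I.

Lemma free_charD x y : free_char t (x + y) = free_char t x + free_char t y.
Proof. exact: malg_charD. Qed.
Lemma free_charM x y : free_char t (x * y) = free_char t x * free_char t y.
Proof. exact: malg_charM. Qed.
Lemma free_charZ k x : free_char t (k *: x) = k * free_char t x.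
Proof. exact: malg_charZ. Qed.
Lemma free_char0 : free_char t 0 = 0.
Proof. exact: malg_char0. Qed.
Lemma free_char1 : free_char t 1 = 1.
Proof. exact: malg_char1. Qed.
Lemma free_char_star x : free_char t (star x) = (free_char t x)^*.
Proof.
by apply: malg_char_star => i; apply/CrealP; rewrite complex_real.
Qed.
Lemma free_char_gen i : free_char t (free_gen R i) = (t i)%:C.
Proof. by rewrite /free_char malg_charU mul1r /word_char big_seq1. Qed.

Lemma free_star_ideal_proper (S : set (free_star R I)) :
  (forall x, S x -> free_char t x = 0) -> ~ star_ideal S 1.
Proof.
move=> S0 S1; suff : free_char t 1 = 0 by rewrite free_char1; apply/eqP/oner_neq0.
apply: (S1 [set x | free_char t x = 0]); split=> //; split=> [|x y|a x|x] /=.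
- exact: free_char0.
- by move=> hx hy; rewrite free_charD hx hy addr0.
- move=> hx; have aJ : free_char t a * free_char t x = 0 by rewrite hx mulr0.
  by split; [apply: etrans (free_charM _ _) aJ|apply: etrans (free_charM _ _) _; rewrite mulrC].
- by move=> hx; rewrite free_char_star hx rmorph0.
Qed.

End FreeChar.

(* The values of a character on the relators below, over an abstract ring. *)
Lemma alg_char_podles (C : comNzRingType) (F : algType C) (f : F -> C)
    (fD : forall x y, f (x + y) = f x + f y)
    (fM : forall x y, f (x * y) = f x * f y)
    (fZ : forall k x, f (k *: x) = k * f x) (f1 : f 1 = 1)
    (A A' B B' : F) (b : C) (fA : f A = 0) (fA' : f A' = 0) (fB : f B = b)
    (fB' : f B' = b) (k m c : C) (bb : b * b = c) :
  [/\ f (A' - A) = 0,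
      f (B * A - k *: (A * B)) = 0,
      f (B' * B - (A - A ^+ 2 + c *: 1)) = 0,
      f (B * B' - (k *: A - m *: A ^+ 2 + c *: 1)) = 0 &
      c = 1 -> f (B' * B - (- A ^+ 2 + 1)) = 0 /\
               f (B * B' - (- (m *: A ^+ 2) + 1)) = 0].
Proof.
have fN x : f (- x) = - f x by rewrite -scaleN1r fZ mulN1r.
split=> [||||c1]; last split; rewrite ?expr2 !(fD, fN, fM, fZ, f1);
  rewrite ?fA ?fA' ?fB ?fB' ?bb ?c1;
  by rewrite ?(mul0r, mulr0, mulr1, oppr0, addr0, add0r) ?subrr.
Qed.

Lemma alg_char_disc (C : comNzRingType) (F : algType C) (f : F -> C)
    (fD : forall x y, f (x + y) = f x + f y)
    (fM : forall x y, f (x * y) = f x * f y)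
    (fZ : forall k x, f (k *: x) = k * f x) (f1 : f 1 = 1)
    (x x' : F) (fx : f x = 1) (fx' : f x' = 1) (s r : C) (sr : s + r = 1) :
  f (x' * x - s *: (x * x') - r *: 1) = 0.
Proof.
have fN y : f (- y) = - f y by rewrite -scaleN1r fZ mulN1r.
rewrite !(fD, fN, fM, fZ, f1) fx fx' !mulr1 -addrA -opprD sr.
exact: subrr.
Qed.

(* P(S^2_{qc}) for c in (0, +oo]; the generators A and B are indexed by false
   and true. *)
Section Podles.
Variables (R : realType) (q : R).

Local Notation A := (free_gen R false).
Local Notation B := (free_gen R true).

Definition podles_relators (c : \bar R) : set (free_star R bool) :=
  if c is c'%:E then
    [set star A - A;
         B * A - (q ^+ 2)%:C *: (A * B);
         star B * B - (A - A ^+ 2 + c'%:C *: 1);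
         B * star B - ((q ^+ 2)%:C *: A - (q ^+ 4)%:C *: A ^+ 2 + c'%:C *: 1)]
  else
    [set star A - A;
         B * A - (q ^+ 2)%:C *: (A * B);
         star B * B - (- A ^+ 2 + 1);
         B * star B - (- ((q ^+ 4)%:C *: A ^+ 2) + 1)].

(* A and B are sent to 0 and to the square root of c (to 1 if c = +oo). *)
Lemma podles_proper (c : \bar R) : (0 < c)%E -> ~ star_ideal (podles_relators c) 1.
Proof.
move=> c0; pose b := if c is c'%:E then Num.sqrt c' else 1.
pose t (i : bool) := if i then b else 0.
have tA : free_char t A = 0 by rewrite free_char_gen.
have tB : free_char t B = b%:C by rewrite free_char_gen.
have tsA : free_char t (star A) = 0 by rewrite free_char_star tA rmorph0.
have tsB : free_char t (star B) = b%:C.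
  by rewrite free_char_star tB; apply/CrealP; rewrite complex_real.
have tBB : b%:C * b%:C = (if c is c'%:E then c' else 1)%:C :> R[i].
  rewrite -rmorphM /= -expr2 /b; case: (c) c0 => [c' /=|_|//].
    by rewrite lte_fin => c0; rewrite sqr_sqrtr // ltW.
  by rewrite expr1n.
apply: (@free_star_ideal_proper _ _ t) => x.
have [H1 H2 H3 H4 H5] := alg_char_podles (free_charD t) (free_charM t)
  (free_charZ t) (free_char1 t) tA tsA tB tsB (q ^+ 2)%:C (q ^+ 4)%:C tBB.
rewrite /podles_relators; case: c {c0 tBB} @b @t tA tB tsA tsB H1 H2 H3 H4 H5.
- by move=> c' b t _ _ _ _ H1 H2 H3 H4 _ [[[->|->]|->]|->].
- by move=> b t _ _ _ _ H1 H2 _ _ /(_ erefl)[H3 H4] [[[->|->]|->]|->].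
- by move=> b t _ _ _ _ H1 H2 _ _ /(_ erefl)[H3 H4] [[[->|->]|->]|->].
Qed.

Definition podles (c : \bar R) (hc : (0 < c)%E) : starAlgType R :=
  star_quot (podles_proper hc).

Definition podlesA (c : \bar R) (hc : (0 < c)%E) : podles hc :=
  star_quot_pi (podles_proper hc) A.
Definition podlesB (c : \bar R) (hc : (0 < c)%E) : podles hc :=
  star_quot_pi (podles_proper hc) B.

End Podles.

Section QuantumDisc.
Variables (R : realType) (s : R).

Local Notation x := (free_gen R tt).

Definition disc_relators : set (free_star R unit) :=
  [set star x * x - s%:C *: (x * star x) - (1 - s)%:C *: 1].

Lemma disc_proper : ~ star_ideal disc_relators 1.
Proof.
pose t (_ : unit) : R := 1.
have tx : free_char t x = 1 by rewrite free_char_gen rmorph1.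
have tsx : free_char t (star x) = 1 by rewrite free_char_star tx rmorph1.
apply: (@free_star_ideal_proper _ _ t) => _ ->.
apply: (alg_char_disc (free_charD t) (free_charM t) (free_charZ t) (free_char1 t)) => //.
by rewrite -rmorphD /= addrC subrK.
Qed.

Definition qdisc : starAlgType R := star_quot disc_proper.

End QuantumDisc.

Section PodlesReps.
Variables (R : realType) (q : R) (c : \bar R).

(* sg = false stands for the sign +, and sg = true for the sign -. *)
Definition podles_lambda (sg : bool) : R :=
  if c is c'%:E then 2^-1 + (-1) ^+ sg * Num.sqrt (c' + 4^-1) else (-1) ^+ sg.

Definition podles_weight (sg : bool) (k : nat) : R :=
  let l := podles_lambda sg * q ^+ (2 * k) in
  if c is c'%:E then l - l ^+ 2 + c' else 1 - q ^+ (4 * k).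

Record is_podles_rep (hc : (0 < c)%E) (S : cstarAlgType R)
    (iota : podles q hc -> S) (H : hilbertType R) (e : nat -> H) (sg : bool)
    (pi : S -> H -> H) : Prop := IsPodlesRep {
  podles_rep_star : is_star_rep pi;
  podles_repA : forall k,
    pi (iota (podlesA q hc)) (e k) = (podles_lambda sg * q ^+ (2 * k))%:C *: e k;
  podles_repB0 : pi (iota (podlesB q hc)) (e 0%N) = 0;
  podles_repBS : forall k,
    pi (iota (podlesB q hc)) (e k.+1) =
      (Num.sqrt (podles_weight sg k.+1))%:C *: e k }.

End PodlesReps.

Section Involution.
Variables (R : realType) (H : hilbertType R) (Sinf Sc : cstarAlgType R).
Variables (pp pm : Sinf -> H -> H) (ppc pmc : Sc -> H -> H).

Definition rep_sum (S : cstarAlgType R) (p m : S -> H -> H) (a : S) :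
  (H -> H) * (H -> H) := (p a, m a).

Definition flip (T : Type) (x : T * T) : T * T := (x.2, x.1).

(* Inverses are taken on the range of the map: the known isomorphism onto the
   fibre product of Toeplitz algebras is not assumed. *)
Definition inverse (S : cstarAlgType R) (T : Type) (f : S -> T) : T -> S :=
  'pinv_(fun=> 0) setT f.

Definition rbar1 : Sinf -> Sinf :=
  inverse (rep_sum pp pm) \o @flip (H -> H) \o rep_sum pp pm.

Definition chi : Sc -> Sinf := inverse (rep_sum pp pm) \o rep_sum ppc pmc.

Definition rbar1c : Sc -> Sc := inverse chi \o rbar1 \o chi.

End Involution.

Definition isomorphic_onto (R : realType) (D S : cstarAlgType R) (E : set S) : Prop :=
  exists phi : D -> S, [/\ is_star_hom phi, injective phi & range phi = E].

(* Main.v *)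
Require Import Defs.
From HB Require Import structures.
From mathcomp Require Import all_boot all_order all_algebra.
From mathcomp Require Import complex.
From mathcomp Require Import all_classical all_reals all_analysis.
From mathcomp Require Import ring lra zify.
From mathcomp Require Import -(notations) monalg.

(** The invariants of the flip are the elements a on which the two
representations pi^c_+ and pi^c_- agree, so the claim is that such an a is the
image of a unique element of the disc algebra.

Spheres and disc are treated together: each is generated by a self-adjoint a and
an operator b with b a = Q a b, star b b = (1 - mu_+ a)(1 - mu_- a) and the same
with Q mu for b star b. For a sphere 1/mu_+ and 1/mu_- are the eigenvalues
lambda_+ and lambda_- of A; for the disc, a = 1 - x x^*, b = x^*, mu_+ = 1 and
mu_- = 0. Whenever mu_s is nonzero there is a representation pi_s in which a has
the eigenvalues Q^k/mu_s and b is a weighted backward shift. Two facts about any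
C*-algebra generated in this way carry the proof.

Faithfulness ([qd_injective]): the representations pi_s are jointly injective. A
vector of the form u with a u = u/mu_s and b u = 0 sees a polynomial p only
through its vacuum expectation value, hence it vanishes if all pi_s kill it
([vacuum_eq0]). On the ideal killed by all pi_s this makes the n-th powers of a
decay faster than any geometric sequence, since b a^n = Q^n a^n b, and so a
annihilates the ideal ([null_annihilated]). On the kernel of a, finally, b is
unitary and polynomials act as Laurent polynomials in b, whose coefficients can
be read off from pi_s far out on the basis; comparing high powers of p^* p gives
|p w| <= |pi_s p| |w| there ([kernel_bound]), which ends the argument.

Diagonal elements ([diagonal_element]): the spectral projections of a belong to
the algebra, as limits of polynomials in a, and therefore so does every diagonal
operator whose eigenvalues for both signs tend geometrically to one limit.

Universal properties follow from the definition of the C*-closure by extending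
representations and homomorphisms by continuity ([closure_hom_extension]), given
that representations of a C*-algebra are contractive ([rep_contractive]). To map
a sphere to another algebra it is thus enough to exhibit diagonal modifications
of a and b having the right matrix elements ([podles_transfer]). This yields
mutually inverse maps between the spheres for c and for infinity, the flip
A |-> -A, and maps phi from the disc to the sphere, x |-> B^*, and psi back,
B |-> x^*, A |-> |A|, with psi phi = 1 and pi_+ phi psi = pi_+
([disc_sphere_homs]). If pi_+ a = pi_- a, then a and phi (psi a) have the same
images under pi_+ and pi_-, so that a = phi (psi a). *)

Set Implicit Arguments.
Unset Strict Implicit.
Unset Printing Implicit Defensive.

Import Order.TTheory GRing.Theory Num.Theory.
Import numFieldNormedType.Exports.

Local Open Scope classical_set_scope.
Local Open Scope complex_scope.
Local Open Scope ring_scope.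

(** * Complete norms *)

Section Moduli.
Variable R : realType.
Implicit Types k l : R[i].

Definition modulus k : R := complex.Re `|k|.

Lemma modulusE k : `|k| = (modulus k)%:C.
Proof. by rewrite RRe_real // normr_real. Qed.

Lemma modulus_ge0 k : 0 <= modulus k.
Proof. by rewrite -ler0c -modulusE. Qed.

Lemma modulusD k l : modulus (k + l) <= modulus k + modulus l.
Proof. by rewrite -lecR rmorphD /= -!modulusE ler_normD. Qed.

Lemma modulusM k l : modulus (k * l) = modulus k * modulus l.
Proof. by apply: complexI; rewrite rmorphM /= -!modulusE normrM. Qed.

Lemma modulusN k : modulus (- k) = modulus k.
Proof. by rewrite /modulus normrN. Qed.

Lemma modulus_eq0 k : modulus k = 0 -> k = 0.
Proof. by move=> k0; apply/eqP; rewrite -normr_eq0 modulusE k0. Qed.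

Lemma modulus0 : modulus (0 : R[i]) = 0.
Proof. by rewrite /modulus normr0. Qed.

Lemma modulus1 : modulus (1 : R[i]) = 1.
Proof. by rewrite /modulus normr1. Qed.

Lemma conj_realC (x : R) : (x%:C)^* = x%:C.
Proof. by apply/CrealP; rewrite complex_real. Qed.

Lemma modulusC (x : R) : modulus x%:C = `|x|.
Proof.
apply: complexI; rewrite -modulusE normc_def /= expr0n addr0.
by rewrite sqrtr_sqr.
Qed.

Lemma modulus_sqr k : k * k^* = (modulus k ^+ 2)%:C.
Proof. by rewrite rmorphXn /= -modulusE normCK. Qed.

End Moduli.

(** Complete norms are handled through a real-valued function, so that the norm
of a C*-algebra and the norm of a Hilbert space are treated alike. *)
Record complete_norm (R : realType) (V : lmodType R[i]) (N : V -> R) : Prop :=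
  CompleteNorm {
    cn_ge0 : forall x, 0 <= N x;
    cn_eq0 : forall x, N x = 0 -> x = 0;
    cn_triangle : forall x y, N (x + y) <= N x + N y;
    cn_scale : forall k x, N (k *: x) = modulus k * N x;
    cn_complete : forall u : nat -> V,
      (forall eps : R, 0 < eps -> exists n0 : nat, forall m n : nat,
         (n0 <= m)%N -> (n0 <= n)%N -> N (u m - u n) < eps) ->
      exists l : V, forall eps : R, 0 < eps -> exists n0 : nat, forall n : nat,
         (n0 <= n)%N -> N (u n - l) < eps }.

Section RealLimits.
Variable R : realType.

Lemma ler_addeps (x y C : R) : 0 <= C ->
  (forall eps, 0 < eps -> x <= y + C * eps) -> x <= y.
Proof.
move=> C0 h; apply/ler_addgt0Pr => e e0.
have C1 : 0 < C + 1 by rewrite ltr_wpDl.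
apply: le_trans (h (e / (C + 1)) _) _; first by rewrite divr_gt0.
by rewrite lerD2l mulrCA ger_pMr // ler_pdivrMr // mul1r lerDl.
Qed.

Lemma exp_small (t e : R) : 0 <= t -> t < 1 -> 0 < e ->
  exists n0, forall n, (n0 <= n)%N -> t ^+ n < e.
Proof.
move=> t0 t1 e0.
have := @cvg_expr R t; rewrite ger0_norm // => /(_ t1) /cvgrPdistC_lt /(_ _ e0).
case=> n0 _ h; exists n0 => n /h /=; rewrite subr0 ger0_norm //.
exact: exprn_ge0.
Qed.

Lemma geom_le0 (x C t : R) : 0 <= t -> t < 1 -> 0 <= C ->
  (forall n, x <= C * t ^+ n) -> x <= 0.
Proof.
move=> t0 t1 C0 h; apply: (@ler_addeps _ _ C) => // e e0.
have [n0 /(_ n0 (leqnn _)) te] := exp_small t0 t1 e0.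
by rewrite add0r; apply: le_trans (h n0) _; rewrite ler_wpM2l // ltW.
Qed.

End RealLimits.

Section CompleteNorms.
Variables (R : realType) (V : lmodType R[i]) (N : V -> R).
Hypothesis cN : complete_norm N.
Implicit Types (x y z : V) (u : nat -> V).

Lemma cn0 : N 0 = 0.
Proof. by rewrite -(scale0r 0) (cn_scale cN) modulus0 mul0r. Qed.

Lemma cnN x : N (- x) = N x.
Proof. by rewrite -scaleN1r (cn_scale cN) modulusN modulus1 mul1r. Qed.

Lemma cnB x y : N (x - y) <= N x + N y.
Proof. by rewrite -(cnN y) (cn_triangle cN). Qed.

Lemma cnC x y : N (x - y) = N (y - x).
Proof. by rewrite -cnN opprB. Qed.

Lemma cn_dist y x z : N (x - z) <= N (x - y) + N (y - z).
Proof. by rewrite -[x - z](subrKA y) (cn_triangle cN). Qed.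

Lemma cn_sum (I : Type) (r : seq I) (F : I -> V) :
  N (\sum_(i <- r) F i) <= \sum_(i <- r) N (F i).
Proof.
elim/big_rec2: _ => [|i y x _ h]; first by rewrite cn0.
by apply: le_trans (cn_triangle cN _ _) _; rewrite lerD2l.
Qed.

Lemma cn_small C x : 0 <= C -> (forall eps, 0 < eps -> N x <= C * eps) -> x = 0.
Proof.
move=> C0 h; apply: (cn_eq0 cN); apply/le_anti; rewrite (cn_ge0 cN) andbT.
by apply: (ler_addeps C0) => e e0; rewrite add0r h.
Qed.

(** Every limit below is taken along such a sequence; the explicit rate is what
[geom_le0] needs to carry identities over to the limit. *)
Lemma cn_geometric (C t : R) u : 0 <= t -> t < 1 -> 0 <= C ->
  (forall n, N (u n.+1 - u n) <= C * t ^+ n) ->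
  exists l, forall n, N (u n - l) <= C / (1 - t) * t ^+ n.
Proof.
move=> t0 t1 C0 h; have t1' : 0 < 1 - t by rewrite subr_gt0.
have K0 : 0 <= C / (1 - t) by rewrite divr_ge0 // ltW.
have far n k : N (u (n + k)%N - u n) <= C / (1 - t) * t ^+ n * (1 - t ^+ k).
  elim: k => [|k IH]; first by rewrite addn0 !subrr cn0 mulr0.
  rewrite addnS; apply: le_trans (cn_dist (u (n + k)%N) _ _) _.
  apply: le_trans (lerD (h _) IH) _.
  rewrite le_eqVlt; apply/orP; left; apply/eqP.
  rewrite exprD exprS; field; exact: lt0r_neq0.
have far' n m : (n <= m)%N -> N (u m - u n) <= C / (1 - t) * t ^+ n.
  move=> /subnKC <-; apply: le_trans (far _ _) _.
  apply: ler_piMr; first by rewrite mulr_ge0 ?exprn_ge0.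
  by rewrite gerBl exprn_ge0.
have [l ul] : exists l : V, forall eps : R, 0 < eps -> exists n0 : nat, forall n : nat,
         (n0 <= n)%N -> N (u n - l) < eps.
  apply: (cn_complete cN) => e e0.
  have [n0 ht] := exp_small t0 t1 (divr_gt0 e0 (ltr_wpDl K0 (@ltr01 R))).
  have hn n : (n0 <= n)%N -> C / (1 - t) * t ^+ n < e.
    move=> /ht; rewrite ltr_pdivlMr ?ltr_wpDl // => /(le_lt_trans _); apply.
    by rewrite mulrC ler_wpM2l ?exprn_ge0 // lerDl.
  exists n0 => m n hm hh; wlog mn : m n hm hh / (m <= n)%N.
    by move=> W; case: (leqP m n) => [|/ltnW] mn; [|rewrite cnC]; apply: W.
  by rewrite cnC; apply: le_lt_trans (far' _ _ mn) _; exact: hn.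
exists l => n; apply: (@ler_addeps _ _ _ 1) => // e e0; rewrite mul1r.
have [n0 hn0] := ul e e0.
apply: le_trans (cn_dist (u (maxn n0 n)) _ _) _; apply: lerD.
  by rewrite cnC far' // leq_maxr.
by rewrite ltW // hn0 // leq_maxl.
Qed.

End CompleteNorms.

(** * Star algebras and Hilbert spaces *)

Section StarAlgebras.
Variables (R : realType) (A : starAlgType R).
Implicit Types x y : A.

Lemma star0 : star (0 : A) = 0.
Proof. by apply: (addrI (star 0)); rewrite -starD !addr0. Qed.

Lemma starN x : star (- x) = - star x.
Proof. by rewrite -scaleN1r starZ rmorphN rmorph1 scaleN1r. Qed.

Lemma starB x y : star (x - y) = star x - star y.
Proof. by rewrite starD starN. Qed.

Lemma star1 : star (1 : A) = 1.
Proof. by rewrite -[LHS]mul1r -[X in X * _ = _](starK 1) -starM mul1r starK. Qed.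

Lemma star_sum (I : Type) (r : seq I) (F : I -> A) :
  star (\sum_(i <- r) F i) = \sum_(i <- r) star (F i).
Proof. exact: (big_morph _ starD star0). Qed.

Lemma starX x n : star (x ^+ n) = star x ^+ n.
Proof. by elim: n => [|n IH]; rewrite ?expr0 ?star1 // exprS starM IH -exprSr. Qed.

Lemma starZr (k : R) x : star (k%:C *: x) = k%:C *: star x.
Proof. by rewrite starZ conj_realC. Qed.

End StarAlgebras.

Section StarHomTheory.
Variables (R : realType) (A B : starAlgType R) (f : A -> B).
Hypothesis fH : is_star_hom f.
Implicit Types x y : A.

Lemma hom_linear k x y : f (k *: x + y) = k *: f x + f y.
Proof. by case: fH => [h _ _]; rewrite h. Qed.

Lemma homD x y : f (x + y) = f x + f y.
Proof. by rewrite -[x]scale1r hom_linear !scale1r. Qed.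

Lemma hom0 : f 0 = 0.
Proof. by apply: (addrI (f 0)); rewrite -homD !addr0. Qed.

Lemma homZ k x : f (k *: x) = k *: f x.
Proof. by rewrite -[k *: x]addr0 hom_linear hom0 addr0. Qed.

Lemma homN x : f (- x) = - f x.
Proof. by rewrite -scaleN1r homZ scaleN1r. Qed.

Lemma homB x y : f (x - y) = f x - f y.
Proof. by rewrite homD homN. Qed.

Lemma homM x y : f (x * y) = f x * f y.
Proof. by case: fH => [_ [_ h] _]; rewrite h. Qed.

Lemma hom1 : f 1 = 1.
Proof. by case: fH => [_ [h _] _]; rewrite h. Qed.

Lemma homX x n : f (x ^+ n) = f x ^+ n.
Proof. by elim: n => [|n IH]; rewrite ?expr0 ?hom1 // !exprS homM IH. Qed.

Lemma hom_star x : f (star x) = star (f x).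
Proof. by case: fH. Qed.

End StarHomTheory.

Lemma hom_comp (R : realType) (A B C : starAlgType R) (g : B -> C) (f : A -> B) :
  is_star_hom g -> is_star_hom f -> is_star_hom (g \o f).
Proof.
move=> gH fH; split=> [k x y|| x] /=; rewrite ?(hom_linear fH) ?(hom_linear gH) //.
  by split=> [|x y] /=; rewrite ?(hom1 fH) ?(hom1 gH) // (homM fH) (homM gH).
by rewrite (hom_star fH) (hom_star gH).
Qed.

Section CStarNorm.
Variables (R : realType) (S : cstarAlgType R).
Implicit Types x y : S.

Lemma cnorm_is_complete : complete_norm (@cnorm R S).
Proof.
split; [exact: cnorm_ge0|exact: cnorm_eq0|exact: cnormD|exact: cnormZ|].
exact: cnorm_complete.
Qed.

Lemma cnorm_star x : cnorm (star x) = cnorm x.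
Proof.
have le y : cnorm y <= cnorm (star y).
  have [->|y0] := eqVneq (cnorm y) 0; first exact: cnorm_ge0.
  have yp : 0 < cnorm y by rewrite lt_neqAle eq_sym y0 cnorm_ge0.
  by rewrite -(ler_pM2r yp) -expr2 -cnorm_cstar cnormM.
by apply/le_anti; rewrite le andbT -[X in _ <= cnorm X]starK le.
Qed.

Lemma cnorm0 : cnorm (0 : S) = 0. Proof. exact: (cn0 cnorm_is_complete). Qed.

Lemma cnormX x n : cnorm (x ^+ n) <= cnorm (1 : S) * cnorm x ^+ n.
Proof.
elim: n => [|n IH]; first by rewrite !expr0 mulr1.
rewrite !exprS; apply: le_trans (cnormM _ _) _.
by rewrite mulrCA ler_wpM2l // cnorm_ge0.
Qed.

Lemma neumann_left_inverse x : cnorm x < 1 -> exists g : S, g * (1 - x) = 1.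
Proof.
move=> x1; have x0 := cnorm_ge0 x; have o0 := cnorm_ge0 (1 : S).
pose u n := \sum_(i < n) x ^+ i.
have [n|g ug] := @cn_geometric R S _ cnorm_is_complete _ _ u x0 x1 o0.
  by rewrite /u big_ord_recr /= addrAC subrr add0r cnormX.
have uE n : u n * (1 - x) = 1 - x ^+ n.
  elim: n => [|n IH]; first by rewrite /u big_ord0 mul0r expr0 subrr.
  rewrite /u big_ord_recr /= -/(u n) mulrDl IH mulrBr mulr1 -exprSr.
  by rewrite addrA subrK.
exists g; apply/eqP; rewrite -subr_eq0; apply/eqP/(cnorm_eq0).
apply/le_anti; rewrite cnorm_ge0 andbT.
set K := cnorm (1 : S) / (1 - cnorm x) in ug *.
have K0 : 0 <= K by rewrite divr_ge0 // subr_ge0 ltW.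
apply: (@geom_le0 _ _ (K * cnorm (1 - x) + cnorm (1 : S)) _ x0 x1).
  by rewrite addr_ge0 // mulr_ge0 // cnorm_ge0.
move=> n; have -> : g * (1 - x) - 1 = - ((u n - g) * (1 - x)) - x ^+ n.
  rewrite mulrBl uE opprB -addrA; congr (_ + _).
  by rewrite opprB addrAC subrr add0r.
apply: le_trans (cnB cnorm_is_complete _ _) _; rewrite [leRHS]mulrDl lerD ?cnormX //.
rewrite (cnN cnorm_is_complete); apply: le_trans (cnormM _ _) _.
by rewrite [leRHS]mulrAC ler_wpM2r // cnorm_ge0.
Qed.

End CStarNorm.

Section HilbertNorm.
Variables (R : realType) (H : hilbertType R).
Implicit Types x y z : H.

Definition vnorm x : R := complex.Re `|x|.

Lemma vnormE x : `|x| = (vnorm x)%:C.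
Proof. by rewrite RRe_real // normr_real. Qed.

Lemma vnorm_is_complete : complete_norm vnorm.
Proof.
split.
- by move=> x; rewrite -ler0c -vnormE normr_ge0.
- by move=> x x0; apply/eqP; rewrite -normr_eq0 vnormE x0.
- by move=> x y; rewrite -lecR rmorphD /= -!vnormE ler_normD.
- by move=> k x; apply: complexI; rewrite rmorphM /= -!vnormE -modulusE normrZ.
move=> u uC.
have [l ul] : exists l : H, u @ \oo --> l.
  have : cvgn u.
    apply/cauchy_cvgP; apply: cauchy_exP => e e0.
    have [e' ee] : exists e' : R, e = e'%:C.
      by apply/complex_realP; apply: ger0_real; apply: ltW.
    move: e0; rewrite ee ltcR => e0; have [n0 hn] := uC _ e0.
    exists (u n0); exists n0 => // n /= hh.
    by rewrite -ball_normE /= vnormE ltcR hn.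
  by move=> uc; exists (lim (u @ \oo)).
exists l => e e0; have := ul; move/cvgrPdistC_lt => /(_ e%:C).
rewrite ltcR e0 => /(_ isT)[n0 _ h]; exists n0 => n hn.
by have := h n hn; rewrite /= vnormE ltcR.
Qed.

Lemma vnorm_ge0 x : 0 <= vnorm x. Proof. exact: (cn_ge0 vnorm_is_complete). Qed.

Lemma innerDl x y z : inner (x + y) z = inner x z + inner y z.
Proof. by have := inner_linear z 1 x y; rewrite scale1r mul1r. Qed.

Lemma inner0l z : inner 0 z = 0.
Proof. by apply: (addrI (inner 0 z)); rewrite -innerDl !addr0. Qed.

Lemma innerZl k x z : inner (k *: x) z = k * inner x z.
Proof. by have := inner_linear z k x 0; rewrite inner0l !addr0. Qed.

Lemma innerDr x y z : inner x (y + z) = inner x y + inner x z.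
Proof. by rewrite inner_conj innerDl rmorphD /= -!inner_conj. Qed.

Lemma inner0r x : inner x 0 = 0.
Proof. by rewrite inner_conj inner0l rmorph0. Qed.

Lemma innerZr k x y : inner x (k *: y) = k^* * inner x y.
Proof. by rewrite inner_conj innerZl rmorphM /= -inner_conj. Qed.

Lemma innerNl x y : inner (- x) y = - inner x y.
Proof. by rewrite -scaleN1r innerZl mulN1r. Qed.

Lemma innerNr x y : inner x (- y) = - inner x y.
Proof. by rewrite -scaleN1r innerZr rmorphN rmorph1 mulN1r. Qed.

Lemma innerBl x y z : inner (x - y) z = inner x z - inner y z.
Proof. by rewrite innerDl innerNl. Qed.

Lemma innerBr x y z : inner x (y - z) = inner x y - inner x z.
Proof. by rewrite innerDr innerNr. Qed.

Lemma inner_suml (I : Type) (r : seq I) (F : I -> H) z :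
  inner (\sum_(i <- r) F i) z = \sum_(i <- r) inner (F i) z.
Proof. by apply: (big_morph (inner^~ z)); [move=> x y; exact: innerDl|exact: inner0l]. Qed.

Lemma inner_vnorm x : inner x x = (vnorm x ^+ 2)%:C.
Proof. by rewrite inner_norm vnormE -rmorphXn. Qed.

Lemma inner_self_eq0 x : inner x x = 0 -> x = 0.
Proof.
rewrite inner_vnorm => /(@complexI _ _ 0) /eqP; rewrite sqrf_eq0 => /eqP.
exact: (cn_eq0 vnorm_is_complete).
Qed.

Lemma cauchy_schwarz x y : modulus (inner x y) <= vnorm x * vnorm y.
Proof.
have [y0|yn0] := eqVneq (vnorm y) 0.
  by rewrite (cn_eq0 vnorm_is_complete y0) inner0r modulus0 mulr_ge0 // vnorm_ge0.
have yp : 0 < vnorm y by rewrite lt_neqAle eq_sym yn0 vnorm_ge0.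
set k := inner x y; pose n := (vnorm y ^+ 2)%:C.
(* The vector |y|^2 x - <x,y> y avoids a division by the norm of y. *)
have zz : (vnorm (n *: x - k *: y) ^+ 2) =
    vnorm y ^+ 2 * (vnorm y ^+ 2 * vnorm x ^+ 2 - modulus k ^+ 2).
  apply: complexI; rewrite -inner_vnorm !(innerBl, innerBr, innerZl, innerZr).
  rewrite [inner y x]inner_conj -/k !inner_vnorm conj_realC -/n.
  rewrite [RHS]rmorphM [X in _ = _ * X]rmorphB [X in _ = _ * (X - _)]rmorphM /=.
  rewrite -modulus_sqr -/n; ring.
have := sqr_ge0 (vnorm (n *: x - k *: y)).
rewrite zz pmulr_rge0 ?exprn_gt0 // subr_ge0 -exprMn mulrC.
by rewrite ler_pXn2r // nnegrE ?modulus_ge0 // mulr_ge0 // vnorm_ge0.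
Qed.

End HilbertNorm.

(** * Representations are contractive *)

Section Representations.
Variables (R : realType) (A : starAlgType R) (H : hilbertType R).
Variable rho : A -> H -> H.
Hypothesis rhoR : is_star_rep rho.
Implicit Types (a b : A) (v w : H).

Lemma rep_vlinear a k v w : rho a (k *: v + w) = k *: rho a v + rho a w.
Proof. by case: rhoR => h *; rewrite h. Qed.

Lemma rep_alinear k a b v : rho (k *: a + b) v = k *: rho a v + rho b v.
Proof. by case: rhoR => _ _ h *; rewrite h. Qed.

Lemma repDv a v w : rho a (v + w) = rho a v + rho a w.
Proof. by rewrite -[v]scale1r rep_vlinear !scale1r. Qed.

Lemma rep0v a : rho a 0 = 0.
Proof. by apply: (addrI (rho a 0)); rewrite -repDv !addr0. Qed.

Lemma repZv a k v : rho a (k *: v) = k *: rho a v.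
Proof. by rewrite -[k *: v]addr0 rep_vlinear rep0v addr0. Qed.

Lemma repBv a v w : rho a (v - w) = rho a v - rho a w.
Proof. by rewrite repDv -[- w]scaleN1r repZv scaleN1r. Qed.

Lemma rep_vsum a (I : Type) (r : seq I) (F : I -> H) :
  rho a (\sum_(i <- r) F i) = \sum_(i <- r) rho a (F i).
Proof. by apply: big_morph; [move=> v w; rewrite repDv|exact: rep0v]. Qed.

Lemma repD a b v : rho (a + b) v = rho a v + rho b v.
Proof. by rewrite -[a]scale1r rep_alinear !scale1r. Qed.

Lemma rep0 v : rho 0 v = 0.
Proof. by apply: (addrI (rho 0 v)); rewrite -repD !addr0. Qed.

Lemma repZ a k v : rho (k *: a) v = k *: rho a v.
Proof. by rewrite -[k *: a]addr0 rep_alinear rep0 addr0. Qed.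

Lemma repN a v : rho (- a) v = - rho a v.
Proof. by rewrite -[- a]scaleN1r repZ scaleN1r. Qed.

Lemma repB a b v : rho (a - b) v = rho a v - rho b v.
Proof. by rewrite repD repN. Qed.

Lemma rep_asum (I : Type) (r : seq I) (F : I -> A) v :
  rho (\sum_(i <- r) F i) v = \sum_(i <- r) rho (F i) v.
Proof. by apply: (big_morph (rho^~ v)); [move=> a b; rewrite repD|exact: rep0]. Qed.

Lemma rep1 v : rho 1 v = v.
Proof. by case: rhoR. Qed.

Lemma repM a b v : rho (a * b) v = rho a (rho b v).
Proof. by case: rhoR => _ _ _ _ h _; rewrite h. Qed.

Lemma rep_adj a v w : inner (rho a v) w = inner v (rho (star a) w).
Proof. by case: rhoR => _ _ _ _ _ h; rewrite h. Qed.

Lemma rep_bounded a : exists2 M : R, 0 <= M & forall v, vnorm (rho a v) <= M * vnorm v.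
Proof.
case: rhoR => _ /(_ a)[M h] _ _ _ _; exists (modulus M); first exact: modulus_ge0.
move=> v; rewrite -lecR rmorphM /= -!vnormE -modulusE.
have [->|v0] := eqVneq v 0; first by rewrite rep0v !normr0 !mulr0.
have le := h v; have v1 : 0 < `|v| by rewrite normr_gt0.
have Mr : 0 <= M by rewrite -(pmulr_lge0 _ v1); apply: le_trans le.
by rewrite (ger0_norm Mr).
Qed.

Lemma rep_vnorm_sqr a v : (vnorm (rho a v) ^+ 2)%:C = inner (rho (star a * a) v) v.
Proof. by rewrite -inner_vnorm repM (rep_adj (star a)) starK. Qed.

End Representations.

Lemma rep_hom (R : realType) (A B : starAlgType R) (f : A -> B) (H : hilbertType R)
    (rho : B -> H -> H) :
  is_star_hom f -> is_star_rep rho -> is_star_rep (rho \o f).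
Proof.
move=> fH rR; split=> [a k v w|a|v k a b|v|a b v|a v w] /=.
- exact: rep_vlinear.
- exact: star_rep_op_bounded.
- by rewrite (hom_linear fH) rep_alinear.
- by rewrite (hom1 fH) rep1.
- by rewrite (homM fH) repM.
- by rewrite (hom_star fH) rep_adj.
Qed.

Section Contractive.
Variables (R : realType) (S : cstarAlgType R) (H : hilbertType R).
Variable rho : S -> H -> H.
Hypothesis rhoR : is_star_rep rho.
Implicit Types (a h : S) (v w : H).

(** If the norm M of rho h exceeded 1, then 1 - h^2/M^2 would be invertible in
S because norm h < 1, whereas vectors on which rho h nearly attains its norm are
nearly annihilated by rho (1 - h^2/M^2). *)
Lemma rep_contractive_sa h : star h = h -> cnorm h < 1 ->
  forall v, vnorm (rho h v) <= vnorm v.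
Proof.
move=> hs h1.
pose bound := [set m : R | 0 <= m /\ forall v, vnorm (rho h v) <= m * vnorm v].
have bound0 : bound !=set0 by have [M M0 hM] := rep_bounded rhoR h; exists M.
have lb0 : has_lbound bound by exists 0 => m [].
have M0 : 0 <= inf bound by apply: lb_le_inf => // m [].
have hM v : vnorm (rho h v) <= inf bound * vnorm v.
  have [v0|vn0] := eqVneq (vnorm v) 0.
    rewrite (cn_eq0 (vnorm_is_complete H) v0) (rep0v rhoR).
    by rewrite (cn0 (vnorm_is_complete H)) mulr0.
  have vp : 0 < vnorm v by rewrite lt_neqAle eq_sym vn0 vnorm_ge0.
  rewrite -ler_pdivrMr //; apply: lb_le_inf => // m [_ hm].
  by rewrite ler_pdivrMr.
set M := inf bound in M0 hM.
suff M1 : M <= 1 by move=> v; apply: le_trans (hM v) _; rewrite ler_piMl ?vnorm_ge0.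
rewrite leNgt; apply/negP => Mgt.
have Mp : 0 < M by apply: lt_trans Mgt.
pose k := (M ^- 2)%:C *: h ^+ 2.
have [|g gk] := @neumann_left_inverse R S k.
  have Mi0 : 0 <= M ^- 2 by rewrite invr_ge0 exprn_ge0.
  rewrite /k cnormZ -/(modulus _) modulusC ger0_norm //.
  rewrite mulrC ltr_pdivrMr ?exprn_gt0 // mul1r expr2.
  apply: le_lt_trans (cnormM _ _) _; rewrite -expr2.
  by rewrite ltr_pXn2r ?nnegrE ?cnorm_ge0 //; apply: lt_trans Mgt.
have [C C0 hC] := rep_bounded rhoR g.
have vk v : vnorm v <= C * vnorm (v - rho k v).
  by have := hC (v - rho k v); rewrite -{1}(rep1 rhoR v) -(repB rhoR) -(repM rhoR) gk (rep1 rhoR).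
have hh v : inner v (rho (h ^+ 2) v) = (vnorm (rho h v) ^+ 2)%:C.
  by rewrite (rep_vnorm_sqr rhoR) hs (rep_adj rhoR) starM hs -expr2.
have vk2 v : vnorm (v - rho k v) ^+ 2 <= vnorm v ^+ 2 - vnorm (rho h v) ^+ 2 / M ^+ 2.
  have -> : vnorm (v - rho k v) ^+ 2 = vnorm v ^+ 2
      - (vnorm (rho h v) ^+ 2 / M ^+ 2) *+ 2 + vnorm (rho (h ^+ 2) v) ^+ 2 / M ^+ 4.
    apply: complexI; rewrite -inner_vnorm /k (repZ rhoR).
    rewrite !(innerBl, innerBr, innerZl, innerZr) hh conj_realC.
    rewrite [inner (rho _ _) v]inner_conj hh conj_realC !inner_vnorm.
    rewrite -!rmorphM -!rmorphB; congr (_%:C); field; exact: lt0r_neq0.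
  have := hM (rho h v); rewrite -(repM rhoR) -expr2 => le.
  rewrite mulr2n opprD -!addrA lerD2l gerDl addrC subr_le0.
  rewrite (_ : M ^+ 4 = M ^+ 2 * M ^+ 2); last by rewrite -exprD.
  rewrite invfM mulrA ler_wpM2r ?invr_ge0 ?exprn_ge0 //.
  rewrite ler_pdivrMr ?exprn_gt0 // -exprMn ler_pXn2r ?nnegrE ?vnorm_ge0 //.
    by rewrite mulrC.
  by rewrite mulr_ge0 ?vnorm_ge0.
(* C + 1 instead of C ensures that 1 - D^-2 is nonnegative. *)
pose D := C + 1; have Dp : 0 < D by rewrite ltr_wpDl.
have D1 : 0 <= 1 - D ^- 2.
  rewrite subr_ge0 invf_le1 ?exprn_gt0 // exprn_ege1 // lerDr; exact: C0.
pose m := M * Num.sqrt (1 - D ^- 2).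
have : M <= m.
  apply: (ge_inf lb0); split=> [|v]; first by rewrite mulr_ge0 ?sqrtr_ge0.
  have m0 : 0 <= m * vnorm v by rewrite !mulr_ge0 ?sqrtr_ge0 ?vnorm_ge0.
  rewrite -(@ler_pXn2r _ 2) ?nnegrE ?vnorm_ge0 // !exprMn sqr_sqrtr //.
  have vD : vnorm v ^+ 2 <= D ^+ 2 * vnorm (v - rho k v) ^+ 2.
    rewrite -exprMn ler_pXn2r ?nnegrE ?vnorm_ge0 //; last first.
      by rewrite mulr_ge0 ?vnorm_ge0 // ltW.
    apply: le_trans (vk v) _; rewrite ler_wpM2r ?vnorm_ge0 // lerDl ler01 //.
  move: vD; rewrite mulrC -ler_pdivrMr ?exprn_gt0 // => vD.
  have := le_trans vD (vk2 v); rewrite lerBrDr -lerBrDl ler_pdivrMr ?exprn_gt0 //.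
  by move=> le; apply: le_trans le _; rewrite le_eqVlt; apply/orP; left; apply/eqP; ring.
apply/negP; rewrite -ltNge gtr_pMr // -[ltRHS]sqrtr1 ltr_sqrt //.
by rewrite gtrBl invr_gt0 exprn_gt0.
Qed.

(** The self-adjoint case applies to star a a / l for each l > |a|^2. *)
Lemma rep_contractive a v : vnorm (rho a v) <= cnorm a * vnorm v.
Proof.
have a0 := cnorm_ge0 a; have v0 := vnorm_ge0 v.
rewrite -(@ler_pXn2r _ 2) ?nnegrE ?vnorm_ge0 ?mulr_ge0 // exprMn.
apply: (@ler_addeps _ _ _ (vnorm v ^+ 2)); first exact: exprn_ge0.
move=> e e0; pose l := cnorm a ^+ 2 + e.
have lp : 0 < l by rewrite ltr_wpDl ?exprn_ge0.
pose h := (l^-1)%:C *: (star a * a).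
have hs : star h = h by rewrite /h starZr starM starK.
have h1 : cnorm h < 1.
  rewrite cnormZ -/(modulus _) modulusC ger0_norm ?invr_ge0 1?ltW //.
  by rewrite mulrC ltr_pdivrMr // mul1r cnorm_cstar ltrDl.
have -> : cnorm a ^+ 2 * vnorm v ^+ 2 + vnorm v ^+ 2 * e = l * (vnorm v * vnorm v).
  by rewrite /l; ring.
have -> : vnorm (rho a v) ^+ 2 = l * modulus (inner (rho h v) v).
  rewrite /h (repZ rhoR) innerZl -(rep_vnorm_sqr rhoR) -rmorphM modulusC.
  by rewrite ger0_norm ?mulr_ge0 ?exprn_ge0 ?invr_ge0 ?vnorm_ge0 1?ltW // mulVKf ?lt0r_neq0.
rewrite ler_pM2l //; apply: le_trans (cauchy_schwarz _ _) _.
by rewrite ler_wpM2r // rep_contractive_sa.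
Qed.

End Contractive.

(** * Extension by density and C*-closures *)

Lemma subBB (V : zmodType) (a b c d : V) : (a - b) - (c - d) = (a - c) - (b - d).
Proof. by rewrite !opprB addrACA [RHS]addrACA [- b + _]addrC; congr (_ + _); rewrite addrC. Qed.

Lemma dense_eq0 (R : realType) (S V : zmodType) (NS : S -> R) (NV : V -> R)
    (F : S -> V) (K : R) :
  (forall v, 0 <= NV v) -> (forall v, NV v = 0 -> v = 0) -> 0 <= K ->
  (forall x y, F (x - y) = F x - F y) -> (forall x, NV (F x) <= K * NS x) ->
  (forall x e, 0 < e -> exists y, F y = 0 /\ NS (x - y) < e) ->
  forall x, F x = 0.
Proof.
move=> NV0 NVeq K0 FB Fle Fd x; apply/NVeq/le_anti; rewrite NV0 andbT.
apply: (ler_addeps K0) => e e0; rewrite add0r.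
have [y [Fy xy]] := Fd x e e0; rewrite -[F x]subr0 -Fy -FB.
by apply: le_trans (Fle _) _; rewrite ler_wpM2l // ltW.
Qed.

Section Density.
Variables (R : realType) (S V : lmodType R[i]) (NS : S -> R) (NV : V -> R).
Hypotheses (cS : complete_norm NS) (cV : complete_norm NV).

(** The value G x is characterised by NV (G x - g p) <= K NS (x - i p) for all p,
which gives linearity without comparing approximating sequences. *)
Lemma dense_extension (P : lmodType R[i]) (i : P -> S) (g : P -> V) (K : R) :
  linear i -> linear g -> 0 <= K -> (forall p, NV (g p) <= K * NS (i p)) ->
  (forall x e, 0 < e -> exists p, NS (x - i p) < e) ->
  exists G : S -> V, [/\ linear G, forall p, G (i p) = g p &
                        forall x, NV (G x) <= K * NS x].
Proof.
move=> iL gL K0 gle iD.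
have iB p p' : i (p - p') = i p - i p'.
  by rewrite addrC -scaleN1r iL scaleN1r addrC.
have gB p p' : g (p - p') = g p - g p'.
  by rewrite addrC -scaleN1r gL scaleN1r addrC.
have ext x : exists l, forall p, NV (l - g p) <= K * NS (x - i p).
  have /choice[u ux] : forall n, exists p, NS (x - i p) < 2^-1 ^+ n.
    by move=> n; apply: iD; rewrite exprn_gt0 // invr_gt0.
  have h1 : 2^-1 < 1 :> R by rewrite invf_lt1 // ltr1n.
  have [||n|l hl] := @cn_geometric R V NV cV (K * 2) 2^-1 (g \o u) _ h1.
  - by rewrite invr_ge0.
  - by rewrite mulr_ge0.
  - rewrite /= -gB; apply: le_trans (gle _) _; rewrite -mulrA ler_wpM2l // iB.
    apply: le_trans (cn_dist cS x _ _) _; rewrite mulr2n mulrDl mul1r.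
    rewrite lerD ?(ltW (ux n)) // (cnC cS).
    apply: le_trans (ltW (ux _)) _; rewrite exprS ler_piMl ?exprn_ge0 ?invr_ge0 //.
    exact: ltW.
  exists l => p; set C := K * 2 / _ in hl.
  have C0 : 0 <= C by rewrite !mulr_ge0 // invr_ge0 subr_ge0 ltW.
  rewrite -subr_le0; apply: (@geom_le0 _ _ (C + K) 2^-1) => //.
    by rewrite addr_ge0.
  move=> n; rewrite lerBlDr; apply: le_trans (cn_dist cV (g (u n)) _ _) _.
  rewrite mulrDl -addrA; apply: lerD; first by rewrite (cnC cV); exact: hl.
  rewrite -gB; apply: le_trans (gle _) _; rewrite iB -mulrDr ler_wpM2l //.
  apply: le_trans (cn_dist cS x _ _) _; apply: lerD => //; rewrite (cnC cS).
  exact: (ltW (ux n)).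
have [G hG] := choice ext.
have i0 : i 0 = 0 by rewrite -[X in i X](subrr 0) iB subrr.
have g0 : g 0 = 0 by rewrite -[X in g X](subrr 0) gB subrr.
exists G; split.
- move=> k x y; apply/eqP; rewrite -subr_eq0; apply/eqP.
  apply: (@cn_small _ _ _ cV (K * (2 * modulus k + 2))) => [|e e0].
    by rewrite mulr_ge0 // addr_ge0 // mulr_ge0 // modulus_ge0.
  have [[p hp] [r hr]] := (iD x e e0, iD y e e0).
  have -> : G (k *: x + y) - (k *: G x + G y) =
     (G (k *: x + y) - g (k *: p + r)) - (k *: (G x - g p) + (G y - g r)).
    by rewrite gL scalerBr addrACA -opprD opprB addrA subrK.
  apply: le_trans (cnB cV _ _) _.
  have kM : modulus k * e + e >= NS (k *: x + y - i (k *: p + r)).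
    rewrite iL opprD addrACA -scalerBr; apply: le_trans (cn_triangle cS _ _) _.
    by rewrite (cn_scale cS) lerD ?(ltW hr) // ler_wpM2l ?modulus_ge0 // ltW.
  have A : NV (k *: (G x - g p) + (G y - g r)) <= K * (modulus k * e + e).
    apply: le_trans (cn_triangle cV _ _) _; rewrite (cn_scale cV) mulrDr.
    apply: lerD.
      rewrite mulrCA ler_wpM2l ?modulus_ge0 //; apply: le_trans (hG _ _) _.
      by rewrite ler_wpM2l // ltW.
    by apply: le_trans (hG _ _) _; rewrite ler_wpM2l // ltW.
  have B := le_trans (hG (k *: x + y) (k *: p + r)) (ler_wpM2l K0 kM).
  apply: le_trans (lerD B A) _; rewrite le_eqVlt; apply/orP; left; apply/eqP; ring.
- move=> p; apply/eqP; rewrite -subr_eq0; apply/eqP; apply: (cn_eq0 cV).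
  apply/le_anti; rewrite (cn_ge0 cV) andbT; apply: le_trans (hG _ _) _.
  by rewrite subrr (cn0 cS) mulr0.
- by move=> x; have := hG x 0; rewrite i0 g0 !subr0.
Qed.

End Density.

(** What is used of a C*-algebra as target of a universal property: its norm is a
supremum of operator norms. *)
Definition normed_by_reps (R : realType) (T : cstarAlgType R) : Prop :=
  forall (t : T) (e : R), 0 < e -> exists (H : hilbertType R) (rho : T -> H -> H) (v : H),
    [/\ is_star_rep rho, vnorm v <= 1 & cnorm t - e <= vnorm (rho t v)].

Section Closures.
Variables (R : realType) (P : starAlgType R) (S : cstarAlgType R) (iota : P -> S).
Hypothesis iC : is_cstar_closure iota.

Let iH : is_star_hom iota := closure_hom iC.
Let cS := @cnorm_is_complete R S.

Lemma closure_eq0 (V : zmodType) (N : V -> R) (F : S -> V) (K : R) :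
  (forall v, 0 <= N v) -> (forall v, N v = 0 -> v = 0) -> 0 <= K ->
  (forall x y, F (x - y) = F x - F y) -> (forall x, N (F x) <= K * cnorm x) ->
  (forall p, F (iota p) = 0) -> forall x, F x = 0.
Proof.
move=> N0 Neq K0 FB Fle Fi; apply: (dense_eq0 N0 Neq K0 FB Fle) => x e e0.
by have [p hp] := closure_dense iC x e0; exists (iota p).
Qed.

Lemma closure_opnorm_le (H : hilbertType R) (rho : P -> H -> H) p v :
  is_star_rep rho -> vnorm (rho p v) <= cnorm (iota p) * vnorm v.
Proof.
move=> rR; have [v0|vn0] := eqVneq (vnorm v) 0.
  rewrite (cn_eq0 (vnorm_is_complete H) v0) (rep0v rR).
  by rewrite (cn0 (vnorm_is_complete H)) mulr0.
have vp : 0 < vnorm v by rewrite lt_neqAle eq_sym vn0 vnorm_ge0.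
pose w := ((vnorm v)^-1)%:C *: v.
have nw (x : H) : vnorm (((vnorm v)^-1)%:C *: x) = vnorm x / vnorm v.
  rewrite (cn_scale (vnorm_is_complete H)) modulusC ger0_norm ?invr_ge0 1?ltW //.
  by rewrite mulrC.
have : ((vnorm (rho p w))%:E <= univ_norm p)%E.
  apply: (@le_trans _ _ (opnorm (rho p))).
    apply: ereal_sup_ubound; exists w => //=.
    by rewrite vnormE nw divff.
  by apply: ereal_sup_ubound; exists H, rho.
rewrite -(closure_norm iC) lee_fin /w (repZv rR).
by rewrite nw ler_pdivrMr.
Qed.

(** For each vector v the map p |-> rho p v is extended separately; the algebraic
identities hold on the image of P and persist by continuity. *)
Lemma closure_rep_extension (H : hilbertType R) (rho : P -> H -> H) :
  is_star_rep rho ->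
  exists rho' : S -> H -> H, is_star_rep rho' /\ forall p v, rho' (iota p) v = rho p v.
Proof.
move=> rR; have cH := vnorm_is_complete H.
have iL : linear iota by move=> k x y; exact: (hom_linear iH).
have iD := closure_dense iC.
have /choice[G hG] : forall v, exists G : S -> H, [/\ linear G,
    forall p, G (iota p) = rho p v & forall x, vnorm (G x) <= vnorm v * cnorm x].
  move=> v; apply: (dense_extension cS cH iL _ (vnorm_ge0 v) _ iD).
    by move=> k x y; exact: rep_alinear.
  by move=> p; rewrite mulrC; exact: closure_opnorm_le.
have GL v : linear (G v) by case: (hG v).
have GB v x y : G v (x - y) = G v x - G v y.
  by rewrite addrC -scaleN1r GL scaleN1r addrC.
have Gi v p : G v (iota p) = rho p v by case: (hG v).
have Gle v x : vnorm (G v x) <= vnorm v * cnorm x by case: (hG v).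
have GvL x k v w : G (k *: v + w) x = k *: G v x + G w x.
  apply/eqP; rewrite -subr_eq0; apply/eqP.
  apply: (closure_eq0 (F := fun x => G (k *: v + w) x - (k *: G v x + G w x))
    (K := vnorm (k *: v + w) + (modulus k * vnorm v + vnorm w))
    (cn_ge0 cH) (cn_eq0 cH)).
  - by rewrite !addr_ge0 ?mulr_ge0 ?vnorm_ge0 ?modulus_ge0.
  - by move=> y z; rewrite !GB scalerBr [_ - _ + (_ - _)]addrACA -opprD subBB.
  - move=> y; apply: le_trans (cnB cH _ _) _; rewrite mulrDl lerD //.
    apply: le_trans (cn_triangle cH _ _) _; rewrite mulrDl lerD //.
    by rewrite (cn_scale cH) -mulrA ler_wpM2l ?modulus_ge0.
  - by move=> p; rewrite !Gi (rep_vlinear rR) subrr.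
exists (fun x v => G v x); split; last by move=> p v; rewrite Gi.
split=> [x k v w|x|v k x y|v|x y v|x v w].
- exact: GvL.
- exists (cnorm x)%:C => v; rewrite !vnormE -rmorphM lecR mulrC; exact: Gle.
- exact: GL.
- by rewrite -(hom1 iH) Gi (rep1 rR).
- apply/eqP; rewrite -subr_eq0; apply/eqP.
  pose E x y := G v (x * y) - G (G v y) x.
  have Gv0 z : G 0 z = 0.
    apply: (cn_eq0 cH); apply/le_anti; rewrite vnorm_ge0 andbT.
    by apply: le_trans (Gle _ _) _; rewrite (cn0 cH) mul0r.
  have GvB u w z : G (u - w) z = G u z - G w z.
    by rewrite addrC -scaleN1r GvL scaleN1r addrC.
  have Ele x' y' : vnorm (E x' y') <= vnorm v * 2 * cnorm x' * cnorm y'.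
    apply: le_trans (cnB cH _ _) _.
    have A := le_trans (Gle v (x' * y')) (ler_wpM2l (vnorm_ge0 v) (cnormM x' y')).
    have B := le_trans (Gle (G v y') x') (ler_wpM2r (cnorm_ge0 x') (Gle v y')).
    apply: le_trans (lerD A B) _; rewrite le_eqVlt; apply/orP; left; apply/eqP; ring.
  have Ep p y' : E (iota p) y' = 0.
    apply: (closure_eq0 (F := E (iota p)) (K := vnorm v * 2 * cnorm (iota p))
      (cn_ge0 cH) (cn_eq0 cH)).
    + by rewrite !mulr_ge0 ?vnorm_ge0 ?cnorm_ge0.
    + by move=> a b; rewrite /E mulrBr !GB GvB subBB.
    + by move=> z; exact: Ele.
    + by move=> r; rewrite /E -(homM iH) !Gi (repM rR) subrr.
  apply: (closure_eq0 (F := E^~ y) (K := vnorm v * 2 * cnorm y)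
    (cn_ge0 cH) (cn_eq0 cH)).
  + by rewrite !mulr_ge0 ?vnorm_ge0 ?cnorm_ge0.
  + by move=> a b; rewrite /E mulrBl !GB subBB.
  + by move=> z; rewrite mulrAC; exact: Ele.
  + by move=> p; exact: Ep.
- apply/eqP; rewrite -subr_eq0; apply/eqP.
  apply: (closure_eq0 (F := fun x => inner (G v x) w - inner v (G w (star x)))
    (K := vnorm v * vnorm w * 2) (@modulus_ge0 R) (@modulus_eq0 R)).
  + by rewrite !mulr_ge0 ?vnorm_ge0.
  + by move=> y z; rewrite starB !GB innerBl innerBr subBB.
  + move=> y; apply: le_trans (modulusD _ _) _; rewrite modulusN.
    have A := le_trans (cauchy_schwarz (G v y) w) (ler_wpM2r (vnorm_ge0 w) (Gle v y)).
    have B := le_trans (cauchy_schwarz v (G w (star y)))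
      (ler_wpM2l (vnorm_ge0 v) (Gle w (star y))).
    rewrite cnorm_star in B; apply: le_trans (lerD A B) _.
    by rewrite le_eqVlt; apply/orP; left; apply/eqP; ring.
  + by move=> p; rewrite -(hom_star iH) !Gi (rep_adj rR) subrr.
Qed.

(** The universal norm is defined by representations of P, and these extend to S;
this is what makes S a possible target of [closure_hom_extension]. *)
Lemma closure_normed_by_reps : normed_by_reps S.
Proof.
move=> t e e0; have e3 : 0 < e / 3 by rewrite divr_gt0.
have [p hp] := closure_dense iC t e3.
have : ((cnorm (iota p) - e / 3)%:E < univ_norm p)%E.
  by rewrite -(closure_norm iC) lte_fin gtrBl.
move=> /ereal_sup_gt[_ [H [rho [rR ->]]]] /ereal_sup_gt[_ [v /= v1 <-]].
rewrite lte_fin -/(vnorm _) => lt.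
have [rho' [rR' rE]] := closure_rep_extension rR.
have vv : vnorm v <= 1 by rewrite -lecR -vnormE.
exists H, rho', v; split=> //.
have A : vnorm (rho' (iota p) v) <= vnorm (rho' t v) + e / 3.
  rewrite -[iota p](subrK t) (repD rR') addrC.
  apply: le_trans (cn_triangle (vnorm_is_complete H) _ _) _.
  rewrite lerD2l; apply: le_trans (rep_contractive rR' _ _) _.
  rewrite (cnC cS) (le_trans _ (ltW hp)) // ler_piMr ?cnorm_ge0 //.
have B := le_lt_trans (cn_dist cS (iota p) t 0) (ltr_leD hp (lexx _)).
rewrite !subr0 in B; rewrite rE in A; lra.
Qed.

(** Representations of T pull back along f to representations of P, so that f is
bounded by the universal norm. *)
Lemma closure_hom_extension (T : cstarAlgType R) (f : P -> T) :
  normed_by_reps T -> is_star_hom f ->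
  exists F : S -> T, is_star_hom F /\ forall p, F (iota p) = f p.
Proof.
move=> Tn fH; have cT := @cnorm_is_complete R T.
have iD := closure_dense iC.
have fle p : cnorm (f p) <= 1 * cnorm (iota p).
  rewrite mul1r; apply/ler_addgt0Pr => e e0.
  have [H [rho [v [rR v1 hv]]]] := Tn (f p) e e0; rewrite -lerBlDr.
  apply: le_trans hv _; apply: le_trans (closure_opnorm_le p v (rep_hom fH rR)) _.
  by rewrite ler_piMr ?cnorm_ge0.
have [F [FL Fi Fle]] := dense_extension cS cT (@hom_linear _ _ _ _ iH)
  (@hom_linear _ _ _ _ fH) ler01 fle iD.
have FB x y : F (x - y) = F x - F y.
  by rewrite addrC -scaleN1r FL scaleN1r addrC.
exists F; split=> //; split=> //.
- split; first by rewrite -(hom1 iH) Fi (hom1 fH).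
  move=> x y; apply/eqP; rewrite -subr_eq0; apply/eqP.
  pose E x y := F (x * y) - F x * F y.
  have Ele x' y' : cnorm (E x' y') <= 2 * cnorm x' * cnorm y'.
    have [X Y] := (Fle x', Fle y'); rewrite !mul1r in X Y.
    apply: le_trans (cnB cT _ _) _.
    have A := le_trans (Fle (x' * y')) (ler_wpM2l ler01 (cnormM x' y')).
    have B := le_trans (cnormM (F x') (F y')) (ler_pM (cnorm_ge0 _) (cnorm_ge0 _) X Y).
    by apply: le_trans (lerD A B) _; rewrite le_eqVlt; apply/orP; left; apply/eqP; ring.
  have Ep p y' : E (iota p) y' = 0.
    apply: (closure_eq0 (F := E (iota p)) (K := 2 * cnorm (iota p))
      (cn_ge0 cT) (cn_eq0 cT)).
    + by rewrite mulr_ge0 ?cnorm_ge0.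
    + by move=> a b; rewrite /E mulrBr !FB mulrBr subBB.
    + by move=> z; exact: Ele.
    + by move=> r; rewrite /E -(homM iH) !Fi (homM fH) subrr.
  apply: (closure_eq0 (F := E^~ y) (K := 2 * cnorm y) (cn_ge0 cT) (cn_eq0 cT)).
  + by rewrite mulr_ge0 ?cnorm_ge0.
  + by move=> a b; rewrite /E mulrBl !FB mulrBl subBB.
  + by move=> z; rewrite mulrAC; exact: Ele.
  + by move=> p; exact: Ep.
- move=> x; apply/eqP; rewrite -subr_eq0; apply/eqP.
  apply: (closure_eq0 (F := fun x => F (star x) - star (F x)) (K := 2)
    (cn_ge0 cT) (cn_eq0 cT)) => //.
  + by move=> a b; rewrite starB !FB starB subBB.
  + move=> z; apply: le_trans (cnB cT _ _) _; rewrite cnorm_star.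
    have := Fle (star z); have := Fle z; rewrite cnorm_star; lra.
  + by move=> p; rewrite -(hom_star iH) !Fi (hom_star fH) subrr.
Qed.

End Closures.

(** * Algebras given by generators and relators *)

Section FreeEvaluation.
Variables (R : realType) (I : choiceType).
Local Notation F := (free_star R I).
Local Notation word := (fmonom (I * bool)%type).
Local Notation U w := (mkmalgU w 1 : F).

Lemma free_starM_word (v w : word) : (U v : F) * U w = U (mmul v w).
Proof. by rewrite [LHS]malgM_def fgmulUU mulr1. Qed.

Lemma free_gen_star i : star (free_gen R i : F) = U (FMonom [:: (i, true)]).
Proof. by rewrite [LHS]malg_starU rmorph1. Qed.

(** Elements are combinations of words, from which letters are split off on the
left. *)
Lemma free_star_ind (P : F -> Prop) :
  P 1 -> (forall x y, P x -> P y -> P (x + y)) -> (forall k x, P x -> P (k *: x)) ->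
  (forall i x, P x -> P (free_gen R i * x)) ->
  (forall i x, P x -> P (star (free_gen R i) * x)) -> forall x, P x.
Proof.
move=> P1 PD PZ Pg Ps x.
have P0 : P 0 by rewrite -(scale0r (1 : F)); apply: PZ.
have PU (w : word) : P (U w).
  case: w => s; elim: s => [|[i b] s IH].
    by rewrite (_ : FMonom [::] = mone) //; rewrite /mone /= fmoneE.
  have -> : FMonom ((i, b) :: s) = mmul (FMonom [:: (i, b)]) (FMonom s).
    by rewrite /mmul /= fmmulE.
  rewrite -free_starM_word; case: b; last exact: Pg.
  by rewrite -free_gen_star; apply: Ps.
rewrite [x]monalgE; elim/big_rec: _ => [//|w y _ Py]; apply: (PD _ _ _ Py).
rewrite (_ : mkmalgU w _ = mcoeff w x *: U w); first exact: PZ.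
by apply/malgP => v; rewrite mcoeffZ !mcoeffU mulrnAr mulr1.
Qed.

Variables (T : starAlgType R) (t : I -> T).

Definition word_eval (w : word) : T :=
  \prod_(a <- fmonom_val w) (if a.2 then star (t a.1) else t a.1).

Lemma word_evalM : mmorphism word_eval.
Proof.
split=> [v w|]; rewrite /word_eval; first by rewrite /mmul /= fmmulE /= big_cat.
by rewrite fm1 big_nil.
Qed.

HB.instance Definition _ := isMultiplicative.Build _ _ word_eval word_evalM.

Definition free_eval (p : F) : T := mmap (in_alg T) word_eval p.

Lemma free_evalU k w : free_eval (mkmalgU w k) = k *: word_eval w.
Proof. by rewrite /free_eval mmapU /= -scalerAl mul1r. Qed.

Lemma free_eval_gen i : free_eval (free_gen R i) = t i.
Proof. by rewrite /free_gen free_evalU scale1r /word_eval big_seq1. Qed.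

Lemma free_eval_hom : is_star_hom free_eval.
Proof.
have evD x y : free_eval (x + y) = free_eval x + free_eval y by exact: mmapD.
have evZ k x : free_eval (k *: x) = k *: free_eval x.
  by rewrite /free_eval mmapZ /= -scalerAl mul1r.
split=> [k x y||x]; first by rewrite evD evZ.
  have := @commr_mmap_is_multiplicative word R[i] T (in_alg T) word_eval.
  case=> [g m m'|hM h1].
    by rewrite /GRing.comm /= -scalerAl mul1r -scalerAr mulr1.
  by split.
have ev0 : free_eval 0 = 0 by exact: mmap0.
have wS w : word_eval (word_star w) = star (word_eval w).
  rewrite /word_eval /word_star /=; case: w => s /=.
  elim: s => [|a s IH] /=; first by rewrite !big_nil star1.
  rewrite rev_cons -cats1 big_cat big_seq1 big_cons starM IH /=.
  by case: (a.2); rewrite /= ?starK.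
rewrite [x]monalgE.
have sD : {morph (star : F -> F) : u v / u + v} by exact: starD.
rewrite (big_morph _ sD (star0 _)) !(big_morph _ evD ev0) star_sum.
apply: eq_bigr => w _; rewrite [star _]malg_starU !free_evalU starZ.
by rewrite wS.
Qed.

(** The kernel of the evaluation at t is a *-ideal, so that it contains the one
generated by the relators. *)
Lemma presented_hom (S : set F) (S1 : ~ star_ideal S 1) :
  (forall x, S x -> free_eval x = 0) ->
  exists f : star_quot S1 -> T, is_star_hom f /\
    forall x, f (star_quot_pi S1 x) = free_eval x.
Proof.
move=> Sev; have eH := free_eval_hom.
have ker x : star_ideal S x -> free_eval x = 0.
  move=> Sx; apply: (Sx [set x | free_eval x = 0]); split=> //; split=> /=.
  - exact: (hom0 eH).
  - by move=> y z hy hz; rewrite (homD eH) hy hz addr0.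
  - move=> a y hy; split.
      exact: (etrans (homM eH a y) (etrans (congr1 _ hy) (mulr0 _))).
    exact: (etrans (homM eH y a) (etrans (congr1 ( *%R^~ _) hy) (mul0r _))).
  - by move=> y hy; rewrite (hom_star eH) hy star0.
pose f (x : star_quot S1) := free_eval (star_quot_lift x).
have fpi x : f (star_quot_pi S1 x) = free_eval x.
  apply/eqP; rewrite -subr_eq0 -(homB eH); apply/eqP/ker.
  exact: star_quot_lift_pi.
exists f; split=> //; have pH := star_quot_pi_is_star_hom S1.
split=> [k x y||x].
- have [[x' ->] [y' ->]] := conj (star_quot_pi_surj x) (star_quot_pi_surj y).
  by rewrite -(hom_linear pH) !fpi (hom_linear eH).
- split=> [|x y]; first by rewrite -(hom1 pH) fpi (hom1 eH).
  have [[x' ->] [y' ->]] := conj (star_quot_pi_surj x) (star_quot_pi_surj y).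
  by rewrite -(homM pH) !fpi (homM eH).
- have [x' ->] := star_quot_pi_surj x.
  by rewrite -(hom_star pH) !fpi (hom_star eH).
Qed.

End FreeEvaluation.

(** * The common form of spheres and disc *)

Section RealPowers.
Variable R : realType.

(** Taking 2^k-th roots removes any factor that grows linearly in the exponent. *)
Lemma le_of_doubling_powers (y z C : R) : 0 <= y -> 0 <= z -> 0 <= C ->
  (forall k, y ^+ (2 ^ k) <= C * (2 ^ k)%:R * z ^+ (2 ^ k)) -> y <= z.
Proof.
move=> y0 z0 C0 h; rewrite leNgt; apply/negP => zy.
have [z00|zn0] := eqVneq z 0.
  have := h 0%N; rewrite expn0 !expr1 z00 mulr0 leNgt; move: zy; rewrite z00.
  by move=> ->.
have zp : 0 < z by rewrite lt_neqAle eq_sym zn0.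
pose d := y / z - 1.
have dp : 0 < d by rewrite subr_gt0 ltr_pdivlMr // mul1r.
have bern n : 1 + n%:R * d <= (y / z) ^+ n.
  elim: n => [|n IH]; first by rewrite mul0r addr0 expr0.
  rewrite exprS -[X in _ <= X * _](subrK 1) -/d.
  have n0 : 0 <= n%:R * d :> R by rewrite mulr_ge0 // ltW.
  apply: le_trans (ler_wpM2l _ IH); last by rewrite addr_ge0 // ltW.
  rewrite -natr1; have := mulr_ge0 (ltW dp) n0; lra.
have key k : (2 ^ k)%:R ^+ 2 * d ^+ 2 <= C * 2 * (2 ^ k)%:R.
  have le1 : (1 + (2 ^ k)%:R * d) ^+ 2 <= C * (2 ^ k.+1)%:R.
    apply: le_trans (_ : (y / z) ^+ (2 ^ k.+1) <= _).
      rewrite expnS mulnC exprM ler_pXn2r ?nnegrE ?exprn_ge0 ?divr_ge0 //.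
      by rewrite addr_ge0 // mulr_ge0 // ltW.
    by rewrite expr_div_n ler_pdivrMr ?exprn_gt0.
  rewrite expnS natrM mulrA in le1; apply: le_trans le1.
  have n0 : 0 <= (2 ^ k)%:R * d by rewrite mulr_ge0 // ltW.
  by rewrite -exprMn ler_pXn2r ?nnegrE ?addr_ge0 // lerDr.
have key' j : (2 ^ j)%:R * d ^+ 2 <= C * 2.
  by have := key j; rewrite expr2 -mulrA [C * 2 * _]mulrC ler_pM2l //.
have [n hn] : exists n : nat, C * 2 / d ^+ 2 < n%:R.
  by exists (Num.truncn (C * 2 / d ^+ 2)).+1; rewrite truncnS_gt.
have := key' n; rewrite -ler_pdivlMr ?exprn_gt0 // leNgt => /negP; apply.
by apply: lt_le_trans hn _; rewrite ler_nat ltnW // ltn_expl.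
Qed.

(** Of three candidates each exclusion removes at most one. *)
Lemma between_avoiding (lo hi u v : R) : lo < hi ->
  exists r, [/\ lo < r, r <= hi, r * u != 1 & r * v != 1].
Proof.
move=> lh; pose d := (hi - lo) / 3.
have dp : 0 < d by rewrite divr_gt0 // subr_gt0.
have avoid (x r s : R) : r != s -> r * x = 1 -> s * x != 1.
  move=> rs rx; apply: contra rs => /eqP sx; apply/eqP.
  have x0 : x != 0.
    by apply/eqP => x0; move/eqP: rx; rewrite x0 mulr0 eq_sym oner_eq0.
  by apply: (mulIf x0); rewrite rx.
have d3 : hi = lo + d *+ 3 by rewrite /d -mulr_natr mulfVK ?pnatr_eq0 // addrC subrK.
have n12 : lo + d != lo + d *+ 2 by rewrite lt_eqF // ltrD2l; lra.
have n13 : lo + d != lo + d *+ 3 by rewrite lt_eqF // ltrD2l; lra.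
have n23 : lo + d *+ 2 != lo + d *+ 3 by rewrite lt_eqF // ltrD2l; lra.
have [/eqP u1|u1] := boolP ((lo + d) * u == 1).
  have [u2 u3] := (avoid _ _ _ n12 u1, avoid _ _ _ n13 u1).
  have [/eqP v2|v2] := boolP ((lo + d *+ 2) * v == 1).
    exists (lo + d *+ 3); split=> //; [lra|lra|exact: avoid v2].
  by exists (lo + d *+ 2); split=> //; lra.
have [/eqP v1|v1] := boolP ((lo + d) * v == 1); last first.
  by exists (lo + d); split=> //; lra.
have [v2 v3] := (avoid _ _ _ n12 v1, avoid _ _ _ n13 v1).
have [/eqP u2|u2] := boolP ((lo + d *+ 2) * u == 1).
  by exists (lo + d *+ 3); split=> //; [lra|lra|exact: avoid u2].
by exists (lo + d *+ 2); split=> //; lra.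
Qed.

End RealPowers.

Section Polynomials.
Variables (R : realType) (A : starAlgType R) (a b : A).

(** Left multiplication by generators is the only multiplicative step, which
keeps inductions short; for a self-adjoint this is still the *-algebra generated
by a and b. *)
Inductive poly_in : A -> Prop :=
| poly_in1 : poly_in 1
| poly_inD x y : poly_in x -> poly_in y -> poly_in (x + y)
| poly_inZ k x : poly_in x -> poly_in (k *: x)
| poly_ina x : poly_in x -> poly_in (a * x)
| poly_inb x : poly_in x -> poly_in (b * x)
| poly_inbs x : poly_in x -> poly_in (star b * x).

Lemma poly_inM x y : poly_in x -> poly_in y -> poly_in (x * y).
Proof.
move=> px py; elim: px => [|z t _ hz _ ht|k z _ hz|z _ hz|z _ hz|z _ hz].
- by rewrite mul1r.
- by rewrite mulrDl; apply: poly_inD.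
- by rewrite -scalerAl; apply: poly_inZ.
- by rewrite -mulrA; apply: poly_ina.
- by rewrite -mulrA; apply: poly_inb.
- by rewrite -mulrA; apply: poly_inbs.
Qed.

Lemma poly_in_star x : star a = a -> poly_in x -> poly_in (star x).
Proof.
move=> as_; elim=> [|z t _ hz _ ht|k z _ hz|z _ hz|z _ hz|z _ hz].
- by rewrite star1; apply: poly_in1.
- by rewrite starD; apply: poly_inD.
- by rewrite starZ; apply: poly_inZ.
- rewrite starM as_; apply: poly_inM => //; rewrite -[a]mulr1; apply: poly_ina; exact: poly_in1.
- rewrite starM; apply: poly_inM => //; rewrite -[star b]mulr1; apply: poly_inbs; exact: poly_in1.
- rewrite starM starK; apply: poly_inM => //; rewrite -[b]mulr1; apply: poly_inb; exact: poly_in1.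
Qed.

Lemma poly_inX x n : poly_in x -> poly_in (x ^+ n).
Proof.
move=> px; elim: n => [|n IH]; first by rewrite expr0; apply: poly_in1.
by rewrite exprS; apply: poly_inM.
Qed.

End Polynomials.

(** The common form of the spheres, where 1 / mu s are the eigenvalues of A of
largest absolute value for each sign, and of the quantum disc, with
a = 1 - x x^*, b = x^* and mu = (1, 0). A parameter mu s = 0 drops one factor and
with it the representation of that sign. *)
Record qdisc_algebra (R : realType) (S : cstarAlgType R) (Q : R) (mu : bool -> R)
    (a b : S) : Prop := QDiscAlgebra {
  qd_gt0 : 0 < Q;
  qd_lt1 : Q < 1;
  qd_mu : mu false * mu true <= 0;
  qd_sa : star a = a;
  qd_ba : b * a = Q%:C *: (a * b);
  qd_bsb : star b * b = (1 - (mu false)%:C *: a) * (1 - (mu true)%:C *: a);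
  qd_bbs : b * star b =
    (1 - (Q * mu false)%:C *: a) * (1 - (Q * mu true)%:C *: a);
  qd_dense : forall (x : S) (eps : R), 0 < eps ->
    exists p, poly_in a b p /\ cnorm (x - p) < eps }.

Definition qd_weight (R : realType) (Q nu : R) (k : nat) : R :=
  Num.sqrt ((1 - Q ^+ k) * (1 - nu * Q ^+ k)).

Record qdisc_rep (R : realType) (S : cstarAlgType R) (Q : R) (mu : bool -> R)
    (a b : S) (H : hilbertType R) (e : nat -> H) (s : bool) (pi : S -> H -> H) : Prop :=
  QDiscRep {
  qr_rep : is_star_rep pi;
  qr_a : forall k, pi a (e k) = (Q ^+ k / mu s)%:C *: e k;
  qr_b0 : pi b (e 0%N) = 0;
  qr_bS : forall k, pi b (e k.+1) = (qd_weight Q (mu (~~ s) / mu s) k.+1)%:C *: e k }.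

Section OrthonormalBasis.
Variables (R : realType) (H : hilbertType R) (e : nat -> H).
Hypothesis eB : orthonormal_basis e.

Lemma onb_inner i j : inner (e i) (e j) = (i == j)%:R.
Proof. by case: eB. Qed.

Lemma onb_vnorm i : vnorm (e i) = 1.
Proof.
have := inner_vnorm (e i); rewrite onb_inner eqxx => /(@complexI _ 1) /esym /eqP.
by rewrite -[X in _ == X](expr1n _ 2) eqrXn2 ?vnorm_ge0 // => /eqP.
Qed.

Lemma onb_approx v (d : R) : 0 < d -> exists (n : nat) (k : nat -> R[i]),
  vnorm (v - \sum_(i < n) k i *: e i) < d.
Proof.
move=> d0; have [_ dn] := eB.
have [||y [/= vb [n [k yE]]]] := dn (ball v d%:C).
- by exists v; apply: ballxx; rewrite ltcR.
- exact: ball_open.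
by exists n, k; rewrite -yE; move: vb; rewrite -ball_normE /= vnormE ltcR.
Qed.

(** A vector orthogonal to the basis is orthogonal to its own approximations. *)
Lemma onb_eq0 v : (forall i, inner v (e i) = 0) -> v = 0.
Proof.
move=> ve; have cH := vnorm_is_complete H.
apply: (@cn_small _ _ _ cH 1) => // d d0; rewrite mul1r.
have [n [k hk]] := onb_approx v d0; set s := \sum_(i < n) _ in hk.
have vs : inner v s = 0.
  rewrite /s inner_conj inner_suml rmorph_sum big1 //= => i _.
  by rewrite -inner_conj innerZr ve mulr0.
have [->|v0] := eqVneq (vnorm v) 0; first exact: ltW.
have vp : 0 < vnorm v by rewrite lt_neqAle eq_sym v0 vnorm_ge0.
rewrite -(ler_pM2l vp); have := cauchy_schwarz v (v - s).
rewrite innerBr vs subr0 inner_vnorm modulusC ger0_norm ?exprn_ge0 ?vnorm_ge0 //.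
rewrite expr2 => le; apply: le_trans le _; rewrite ler_wpM2l ?vnorm_ge0 //; exact: ltW.
Qed.

Lemma onb_ext (S : cstarAlgType R) (pi rho : S -> H -> H) x y :
  is_star_rep pi -> is_star_rep rho ->
  (forall i, pi x (e i) = rho y (e i)) -> forall v, pi x v = rho y v.
Proof.
move=> pR rR h v; apply/eqP; rewrite -subr_eq0; apply/eqP.
have cH := vnorm_is_complete H.
apply: (dense_eq0 (K := cnorm x + cnorm y) (F := fun v => pi x v - rho y v)
  (cn_ge0 cH) (cn_eq0 cH)).
- by rewrite addr_ge0 ?cnorm_ge0.
- by move=> u w; rewrite (repBv pR) (repBv rR) subBB.
- move=> u; apply: le_trans (cnB cH _ _) _; rewrite mulrDl.
  by apply: lerD; exact: rep_contractive.
- move=> u d d0; have [n [k hk]] := onb_approx u d0.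
  exists (\sum_(i < n) k i *: e i); split=> //.
  rewrite (rep_vsum pR) (rep_vsum rR); apply/eqP; rewrite subr_eq0; apply/eqP.
  by apply: eq_bigr => i _; rewrite (repZv pR) (repZv rR) h.
Qed.

Lemma onb_adjoint_shift (S : cstarAlgType R) (rho : S -> H -> H) x (w : nat -> R) :
  is_star_rep rho -> rho x (e 0%N) = 0 ->
  (forall n, rho x (e n.+1) = (w n)%:C *: e n) ->
  forall n, rho (star x) (e n) = (w n)%:C *: e n.+1.
Proof.
move=> rR x0 xS n; apply/eqP; rewrite -subr_eq0; apply/eqP; apply: onb_eq0 => -[|j].
  by rewrite innerBl innerZl (rep_adj rR) starK x0 inner0r onb_inner mulr0 subrr.
rewrite innerBl innerZl (rep_adj rR) starK xS innerZr conj_realC !onb_inner.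
by rewrite eqSS; case: eqVneq => [->|_]; rewrite ?subrr // !mulr0 subrr.
Qed.

End OrthonormalBasis.

(** * Vacuum vectors *)

Lemma one_subM (R : realType) (A : starAlgType R) (k l : R[i]) (x : A) :
  (1 - k *: x) * (1 - l *: x) = 1 - (k + l) *: x + (k * l) *: x ^+ 2.
Proof.
rewrite mulrBl mul1r mulrBr mulr1 -scalerAl -scalerAr scalerA -expr2 opprB addrA.
by rewrite scalerDl opprD addrA addrAC; congr (_ + _); rewrite addrAC.
Qed.

Lemma horner_algZ (C : comNzRingType) (A : algType C) (x : A) k g :
  horner_alg x (k *: g) = k *: horner_alg x g.
Proof. by rewrite -mul_polyC rmorphM /= horner_algC -scalerAl mul1r. Qed.

Section QDiscTheory.
Variables (R : realType) (S : cstarAlgType R) (Q : R) (mu : bool -> R) (a b : S).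
Hypothesis QD : qdisc_algebra Q mu a b.
Variables (H : hilbertType R) (e : nat -> H) (pi : bool -> S -> H -> H).
Hypothesis eB : orthonormal_basis e.
Hypothesis piR : forall s, mu s != 0 -> qdisc_rep Q mu a b e s (pi s).

Let sa := qd_sa QD.

Local Notation bs := (star b).

Lemma qd_abs : a * bs = Q%:C *: (bs * a).
Proof. by rewrite -[a * bs]starK starM starK sa (qd_ba QD) starZr starM sa. Qed.

Lemma qd_bsbE s : bs * b = (1 - (mu s)%:C *: a) * (1 - (mu (~~ s))%:C *: a).
Proof.
case: s => //=; rewrite (qd_bsb QD) // !one_subM.
by rewrite [(mu true)%:C + _]addrC [(mu true)%:C * _]mulrC.
Qed.

Lemma qd_baX n : b * a ^+ n = (Q ^+ n)%:C *: (a ^+ n * b).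
Proof.
elim: n => [|n IH]; first by rewrite !expr0 mulr1 mul1r scale1r.
rewrite [a ^+ n.+1]exprSr mulrA IH -scalerAl -[_ * b * a]mulrA (qd_ba QD).
by rewrite -scalerAr scalerA mulrA -rmorphM /= [in RHS]exprSr.
Qed.

Section Vacuum.
Variable s : bool.
Hypothesis s0 : mu s != 0.
Let t := ((mu s)^-1)%:C.

(** Normal (Wick) ordering: modulo the left ideal generated by b and a - t every
polynomial is one in star b. *)
Let wick p := exists (g : {poly R[i]}) y1 y2,
  p = horner_alg bs g + y1 * b + y2 * (a - t%:A).

Lemma wickD p r : wick p -> wick r -> wick (p + r).
Proof.
move=> [g [y1 [y2 ->]]] [g' [y1' [y2' ->]]].
exists (g + g'), (y1 + y1'), (y2 + y2').
by rewrite rmorphD !mulrDl addrACA [X in X + _ = _]addrACA.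
Qed.

Lemma wickZ k p : wick p -> wick (k *: p).
Proof.
move=> [g [y1 [y2 ->]]]; exists (k *: g), (k *: y1), (k *: y2).
by rewrite horner_algZ !scalerDr !scalerAl.
Qed.

Lemma wick_bs p : wick p -> wick (bs * p).
Proof.
move=> [g [y1 [y2 ->]]]; exists ('X * g), (bs * y1), (bs * y2).
by rewrite rmorphM /= horner_algX !mulrDr !mulrA.
Qed.

Lemma wick_a p : wick p -> wick (a * p).
Proof.
have com (g : {poly R[i]}) : exists g', a * horner_alg bs g = horner_alg bs g' * a.
  elim/poly_ind: g => [|g c [g' gE]].
    by exists 0; rewrite rmorph0 mulr0 mul0r.
  exists (Q%:C *: (g' * 'X) + c%:P).
  rewrite !rmorphD !rmorphM /= horner_algZ rmorphM /= !horner_algX !horner_algC.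
  rewrite mulrDr mulrDl mulrA gE -mulrA qd_abs -scalerAr mulrA -!scalerAl.
  by rewrite -scalerAr mulr1 mul1r.
move=> [g [y1 [y2 ->]]]; have [g' gE] := com g.
exists (t *: g'), (a * y1), (horner_alg bs g' + a * y2).
rewrite horner_algZ; set L := a - t%:A.
have -> : a * (horner_alg bs g + y1 * b + y2 * L) =
    horner_alg bs g' * a + a * y1 * b + a * y2 * L by rewrite !mulrDr gE !mulrA.
have -> : horner_alg bs g' * a = t *: horner_alg bs g' + horner_alg bs g' * L.
  by rewrite mulrBr -scalerAr mulr1 addrC subrK.
by rewrite mulrDl addrA; congr (_ + _); rewrite addrAC.
Qed.

Lemma wick_b p : wick p -> wick (b * p).
Proof.
have opZ k p' : wick p' -> wick ((1 - k *: a) * p').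
  move=> wp; rewrite mulrBl mul1r -scalerAl -scaleNr.
  by apply: wickD => //; apply: wickZ; exact: wick_a.
move=> [g [y1 [y2 ->]]].
suff [g' [y1' [y2' gE]]] : wick (b * horner_alg bs g).
  exists g', (y1' + b * y1), (y2' + b * y2); move: (a - t%:A) gE => L gE.
  rewrite !mulrDr gE !mulrDl !mulrA -!addrA; congr (_ + (_ + _)).
  by rewrite addrCA.
elim/poly_ind: g => [|g c _].
  by rewrite rmorph0 mulr0; exists 0, 0, 0; rewrite rmorph0 !mul0r !addr0.
rewrite rmorphD [g * _]mulrC rmorphM /= horner_algX horner_algC mulrDr mulrA.
apply: wickD.
  rewrite (qd_bbs QD) -mulrA; do 2!apply: (opZ _ _ _).
  by exists g, 0, 0; rewrite !mul0r !addr0.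
rewrite -scalerAr mulr1; apply: wickZ.
by exists 0, 1, 0; rewrite rmorph0 mul1r mul0r add0r addr0.
Qed.

Lemma wick_poly p : poly_in a b p -> exists (c : R[i]) y0 y1 y2,
  p = c%:A + bs * y0 + y1 * b + y2 * (a - t%:A).
Proof.
move=> pp; have {pp} [g [y1 [y2 ->]]] : wick p.
  elim: pp => [|*|*|*|*|*]; [|exact: wickD|exact: wickZ|exact: wick_a|exact: wick_b|exact: wick_bs].
  by exists 1, 0, 0; rewrite rmorph1 !mul0r !addr0.
elim/poly_ind: g => [|g c _].
  by exists 0, 0, y1, y2; rewrite rmorph0 scale0r mulr0 addr0.
exists c, (horner_alg bs g), y1, y2.
by rewrite rmorphD [g * _]mulrC rmorphM /= horner_algX horner_algC [_ + c%:A]addrC.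
Qed.

(** For u with a u = t u and b u = 0, both u^* p u and the vacuum expectation
value of p are read off from the same constant term. *)
Lemma vacuum_bound u p : a * u = t *: u -> b * u = 0 -> poly_in a b p ->
  cnorm (star u * p * u) <= vnorm (pi s p (e 0%N)) * cnorm u ^+ 2.
Proof.
move=> au bu /wick_poly[c [y0 [y1 [y2 pE]]]]; have [piS pa pb0 pbS] := piR s0.
have ubs : star u * bs = 0 by rewrite -starM bu star0.
have Lu : (a - t%:A) * u = 0 by rewrite mulrBl au -scalerAl mul1r subrr.
have Le : pi s (a - t%:A) (e 0%N) = 0.
  by rewrite (repB piS) (pa 0%N) (repZ piS) (rep1 piS) expr0 mul1r subrr.
move: (a - t%:A) Lu Le pE => L Lu Le pE.
have -> : star u * p * u = c *: (star u * u).
  have pu : p * u = c *: u + bs * (y0 * u).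
    by rewrite pE !mulrDl -!mulrA bu Lu !mulr0 !addr0 -scalerAl mul1r.
  by rewrite -mulrA pu mulrDr mulrA ubs mul0r addr0 scalerAr.
have -> : c = inner (pi s p (e 0%N)) (e 0%N).
  rewrite pE !(repD piS) !(repM piS) pb0 Le !(rep0v piS) !addr0 (repZ piS) (rep1 piS).
  rewrite innerDl innerZl (onb_inner eB) mulr1 (rep_adj piS) starK pb0 inner0r.
  by rewrite addr0.
rewrite cnormZ cnorm_cstar -/(modulus _) ler_wpM2r ?exprn_ge0 ?cnorm_ge0 //.
by apply: le_trans (cauchy_schwarz _ _) _; rewrite (onb_vnorm eB) mulr1.
Qed.

(** The bound is used for polynomials p close to u u^*, which pi s annihilates. *)
Lemma vacuum_eq0 u : a * u = t *: u -> b * u = 0 -> (forall v, pi s u v = 0) -> u = 0.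
Proof.
move=> au bu piu; have [piS _ _ _] := piR s0.
have pius v : pi s (u * star u) v = 0 by rewrite (repM piS) piu.
have n0 : 0 <= cnorm u ^+ 2 by rewrite exprn_ge0 ?cnorm_ge0.
suff : cnorm u ^+ 4 <= 0.
  move=> le; apply/cnorm_eq0/eqP.
  have : cnorm u ^+ 4 == 0 by rewrite eq_le le exprn_ge0 ?cnorm_ge0.
  by rewrite expf_eq0.
have -> : cnorm u ^+ 4 = cnorm (star u * (u * star u) * u).
  rewrite mulrA -mulrA -[X in X * _]starK starM starK cnorm_cstar cnorm_cstar.
  by rewrite -exprM.
apply: (@ler_addeps _ _ _ (cnorm u ^+ 2 *+ 2)); first by rewrite mulrn_wge0.
move=> d d0; have [p [pp hp]] := qd_dense QD (u * star u) d0.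
have -> : star u * (u * star u) * u = star u * (u * star u - p) * u + star u * p * u.
  by rewrite -mulrDl -mulrDr subrK.
apply: le_trans (cnormD _ _) _; rewrite add0r mulr2n mulrDl; apply: lerD.
  apply: le_trans (cnormM _ _) _; rewrite expr2 mulrAC ler_wpM2r ?cnorm_ge0 //.
  apply: le_trans (cnormM _ _) _; rewrite cnorm_star ler_wpM2l ?cnorm_ge0 //.
  exact: ltW.
apply: le_trans (vacuum_bound au bu pp) _; rewrite mulrC ler_wpM2l //.
rewrite -[p](subKr (u * star u)) (repB piS) pius sub0r (cnN (vnorm_is_complete H)).
apply: le_trans (rep_contractive piS _ _) _; rewrite (onb_vnorm eB) mulr1.
exact: ltW.
Qed.

End Vacuum.
End QDiscTheory.

(** * The common kernel of the representations *)

Section SelfAdjointPowers.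
Variables (R : realType) (S : cstarAlgType R).

(** Iterates |h^n x|^2 <= |x| |h^2n x|, which is the C*-identity. *)
Lemma sa_power (h x : S) k : star h = h ->
  cnorm (h * x) ^+ (2 ^ k) * cnorm x <= cnorm (h ^+ (2 ^ k) * x) * cnorm x ^+ (2 ^ k).
Proof.
move=> hs; have [x0|xn0] := eqVneq (cnorm x) 0; first by rewrite x0 mulr0 mulr_ge0 ?cnorm_ge0.
have xp : 0 < cnorm x by rewrite lt_neqAle eq_sym xn0 cnorm_ge0.
elim: k => [|k IH]; first by rewrite expn0 !expr1.
have sq : cnorm (h ^+ (2 ^ k) * x) ^+ 2 <= cnorm x * cnorm (h ^+ (2 ^ k.+1) * x).
  rewrite -cnorm_cstar starM starX hs -mulrA [h ^+ _ * (h ^+ _ * x)]mulrA -exprD.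
  rewrite addnn -muln2 mulnC -expnS -[X in _ <= X * _]cnorm_star; exact: cnormM.
have n0 y : 0 <= cnorm (y : S) by exact: cnorm_ge0.
rewrite -(ler_pM2r xp) expnS mulnC exprM -mulrA -expr2 -exprMn.
apply: le_trans (_ : (cnorm (h ^+ (2 ^ k) * x) * cnorm x ^+ (2 ^ k)) ^+ 2 <= _).
  by rewrite ler_pXn2r ?nnegrE ?mulr_ge0 ?exprn_ge0.
rewrite exprMn -[cnorm x ^+ _ ^+ 2]exprM; apply: le_trans (ler_wpM2r _ sq) _.
  by rewrite exprn_ge0.
by rewrite expnS [(2 * _)%N]mulnC le_eqVlt; apply/orP; left; apply/eqP; ring.
Qed.

Lemma sa_growth (h x : S) (C r : R) : star h = h -> 0 <= r ->
  (forall n, cnorm (h ^+ n * x) <= C * r ^+ n) -> cnorm (h * x) <= r * cnorm x.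
Proof.
move=> hs r0 hC; have [x0|xn0] := eqVneq (cnorm x) 0.
  by rewrite (cnorm_eq0 _ x0) mulr0 cnorm0 mulr0.
have xp : 0 < cnorm x by rewrite lt_neqAle eq_sym xn0 cnorm_ge0.
have C0 : 0 <= C.
  by have := hC 0%N; rewrite !expr0 mul1r mulr1; apply: le_trans; exact: cnorm_ge0.
apply: (@le_of_doubling_powers _ _ _ (C / cnorm x)).
- exact: cnorm_ge0.
- by rewrite mulr_ge0 ?cnorm_ge0.
- by rewrite divr_ge0 ?cnorm_ge0.
move=> k; rewrite -(ler_pM2r xp); apply: le_trans (sa_power x k hs) _.
apply: le_trans (ler_wpM2r (exprn_ge0 _ (cnorm_ge0 x)) (hC _)) _.
rewrite exprMn (_ : C / cnorm x * _ * _ * cnorm x =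
    (C * r ^+ (2 ^ k) * cnorm x ^+ (2 ^ k)) * (2 ^ k)%:R); last by field; exact: xn0.
rewrite ler_peMr ?ler1n ?expn_gt0 // mulr_ge0 ?exprn_ge0 ?cnorm_ge0 //.
by rewrite mulr_ge0 ?exprn_ge0.
Qed.

End SelfAdjointPowers.

Definition qd_null (R : realType) (S : cstarAlgType R) (H : hilbertType R)
    (mu : bool -> R) (pi : bool -> S -> H -> H) (w : S) : Prop :=
  forall s, mu s != 0 -> forall v, pi s w v = 0.

Section NullIdeal.
Variables (R : realType) (S : cstarAlgType R) (Q : R) (mu : bool -> R) (a b : S).
Hypothesis QD : qdisc_algebra Q mu a b.
Variables (H : hilbertType R) (e : nat -> H) (pi : bool -> S -> H -> H).
Hypothesis eB : orthonormal_basis e.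
Hypothesis piR : forall s, mu s != 0 -> qdisc_rep Q mu a b e s (pi s).

Let cS := @cnorm_is_complete R S.
Let Q0 := qd_gt0 QD.
Let sa := qd_sa QD.

Local Notation bs := (star b).
Local Notation null := (qd_null mu pi).

Lemma null_mull x w : null w -> null (x * w).
Proof.
move=> nw s s0 v; have [piS _ _ _] := piR s0.
by rewrite (repM piS) nw // (rep0v piS).
Qed.

Lemma null_linear k x y : null x -> null y -> null (k *: x + y).
Proof.
move=> nx ny s s0 v; have [piS _ _ _] := piR s0.
by rewrite (repD piS) (repZ piS) nx // ny // scaler0 addr0.
Qed.

Lemma null_star w : null w -> null (star w).
Proof.
move=> nw s s0 v; have [piS _ _ _] := piR s0; apply: inner_self_eq0.
by rewrite (rep_adj piS) starK nw // inner0r.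
Qed.

Lemma null_limit (u : nat -> S) l (C t : R) : 0 <= t -> t < 1 -> 0 <= C ->
  (forall n, null (u n)) -> (forall n, cnorm (u n - l) <= C * t ^+ n) -> null l.
Proof.
move=> t0 t1 C0 nu ul s s0 v; have [piS _ _ _] := piR s0.
have cH := vnorm_is_complete H; apply: (cn_eq0 cH); apply/le_anti.
rewrite vnorm_ge0 andbT; apply: (@geom_le0 _ _ (C * vnorm v) t) => //.
  by rewrite mulr_ge0 ?vnorm_ge0.
move=> n; have -> : pi s l v = - pi s (u n - l) v by rewrite (repB piS) nu // sub0r opprK.
rewrite (cnN cH) mulrAC; apply: le_trans (rep_contractive piS _ _) _.
by rewrite ler_wpM2r ?vnorm_ge0.
Qed.

(** Such a vector is killed by the factor 1 - mu s a of star b b, hence by b. *)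
Lemma null_eigenvector s w : mu s != 0 ->
  a * w = ((mu s)^-1)%:C *: w -> null w -> w = 0.
Proof.
move=> s0 aw nw.
have aw0 : (1 - (mu s)%:C *: a) * w = 0.
  by rewrite mulrBl mul1r -scalerAl aw scalerA -rmorphM divff // scale1r subrr.
apply: (vacuum_eq0 QD eB piR s0 aw) => [|v]; last exact: nw.
apply/cnorm_eq0/eqP; rewrite -sqrf_eq0 -cnorm_cstar starM -mulrA [bs * _]mulrA.
by rewrite (qd_bsbE QD (~~ s)) negbK -mulrA aw0 !mulr0 cnorm0.
Qed.

(** If r |mu s| < 1, the elements (mu s a)^n x converge to an eigenvector, which
vanishes in the null ideal, and the rate of convergence is the claim. If
r |mu s| > 1, the recursion for a^n x gives the bound at once. *)
Lemma null_remove_factor s x (C r : R) : null x -> 0 < r -> r * `|mu s| != 1 ->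
  (forall n, cnorm ((1 - (mu s)%:C *: a) * (a ^+ n * x)) <= C * r ^+ n) ->
  exists C', forall n, cnorm (a ^+ n * x) <= C' * r ^+ n.
Proof.
move=> nx r0 r1 hC; have [m0|mn0] := eqVneq (mu s) 0.
  by exists C => n; have := hC n; rewrite m0 scale0r subr0 mul1r.
have mp : 0 < `|mu s| by rewrite normr_gt0.
have C0 : 0 <= C.
  by have := hC 0%N; rewrite !expr0 mulr1; apply: le_trans; exact: cnorm_ge0.
have stepE n : (1 - (mu s)%:C *: a) * (a ^+ n * x) = a ^+ n * x - (mu s)%:C *: (a ^+ n.+1 * x).
  by rewrite mulrBl mul1r -scalerAl mulrA -exprS.
case: (ltgtP (r * `|mu s|) 1) r1 => // [lt1|gt1] _.
  pose u n := (mu s ^+ n)%:C *: (a ^+ n * x).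
  have rm0 : 0 <= r * `|mu s| by rewrite mulr_ge0 // ltW.
  have [n|l ul] := @cn_geometric R S _ cS C _ u rm0 lt1 C0.
    rewrite -(cnN cS) opprB /u exprS mulrC rmorphM -scalerA -scalerBr -stepE cnormZ.
    rewrite -/(modulus _) modulusC normrX exprMn [leRHS]mulrA [leRHS]mulrC.
    by rewrite ler_wpM2l ?exprn_ge0.
  set K := C / _ in ul; have K0 : 0 <= K by rewrite divr_ge0 // subr_ge0 ltW.
  have nu n : null (u n).
    rewrite -[u n]addr0; apply: null_linear; first exact: null_mull.
    by move=> s' s'0 v; have [piS _ _ _] := piR s'0; rewrite (rep0 piS).
  have l0 : l = 0.
    apply: (null_eigenvector mn0); last exact: (null_limit rm0 lt1 K0 nu ul).
    apply/eqP; rewrite -subr_eq0; apply/eqP.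
    have cc : 0 <= (cnorm a + `|mu s|^-1) * K.
      by rewrite mulr_ge0 // addr_ge0 ?cnorm_ge0 ?invr_ge0.
    apply: (cnorm_eq0); apply/le_anti; rewrite cnorm_ge0 andbT.
    apply: (@geom_le0 _ _ ((cnorm a + `|mu s|^-1) * K) _ rm0 lt1) => // n.
    have -> : a * l - ((mu s)^-1)%:C *: l =
        ((mu s)^-1)%:C *: (u n.+1 - l) - a * (u n - l).
      have au : a * u n = ((mu s)^-1)%:C *: u n.+1.
        rewrite /u scalerA -rmorphM /= [mu s ^+ n.+1]exprS mulKf // -scalerAr mulrA.
        by rewrite -exprS.
      by rewrite scalerBr mulrBr au subBB subrr sub0r opprB.
    apply: le_trans (cnB cS _ _) _; rewrite addrC mulrDl mulrDl; apply: lerD.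
      apply: le_trans (cnormM _ _) _; rewrite -mulrA ler_wpM2l ?cnorm_ge0 //.
    rewrite cnormZ -/(modulus _) modulusC normfV -mulrA ler_wpM2l ?invr_ge0 //.
    apply: le_trans (ul _) _; rewrite ler_wpM2l // exprS ler_piMl ?exprn_ge0 //.
    exact: ltW.
  exists K => n; have := ul n; rewrite l0 subr0 cnormZ -/(modulus _) modulusC normrX.
  by rewrite exprMn mulrA mulrC ler_pM2r // exprn_gt0.
pose d := r * `|mu s| - 1; have dp : 0 < d by rewrite subr_gt0.
pose K := cnorm x + C / d.
exists K; elim=> [|n IH].
  by rewrite !expr0 mul1r mulr1 lerDl divr_ge0 // ltW.
have le1 : `|mu s| * cnorm (a ^+ n.+1 * x) <= K * r ^+ n + C * r ^+ n.
  have -> : `|mu s| * cnorm (a ^+ n.+1 * x) = cnorm ((mu s)%:C *: (a ^+ n.+1 * x)).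
    by rewrite cnormZ -/(modulus _) modulusC.
  rewrite -[X in cnorm X](subKr (a ^+ n * x)) -stepE.
  by apply: le_trans (cnB cS _ _) _; apply: lerD.
rewrite -(ler_pM2l mp); apply: le_trans le1 _; rewrite -mulrDl exprS.
rewrite (_ : `|mu s| * (K * (r * r ^+ n)) = (K + K * d) * r ^+ n); last first.
  by rewrite /d; ring.
rewrite ler_wpM2r ?exprn_ge0 ?(ltW r0) // lerD2l /K mulrDl mulfVK ?lt0r_neq0 //.
by rewrite lerDr mulr_ge0 ?cnorm_ge0 // ltW.
Qed.

(** The commutation b a^n = Q^n a^n b turns a bound m for a on the null ideal
into a bound (Q m)^n for star b b a^n; the two factors of star b b are removed. *)
Lemma null_shrink (m : R) : 0 < m ->
  (forall w, null w -> cnorm (a * w) <= m * cnorm w) ->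
  forall w, null w -> cnorm (a * w) <= ((1 + Q) / 2 * m) * cnorm w.
Proof.
move=> m0 hm w nw.
have aX n x : null x -> cnorm (a ^+ n * x) <= m ^+ n * cnorm x.
  move=> nx; elim: n => [|n IH]; first by rewrite !expr0 !mul1r.
  rewrite exprS -mulrA; apply: le_trans (hm _ _) _; first exact: null_mull.
  by rewrite exprS -mulrA ler_pM2l.
have lohi : Q * m < (1 + Q) / 2 * m by rewrite ltr_pM2r //; have := qd_lt1 QD; lra.
(* The rate r must miss the two eigenvalues that are to be removed. *)
have [r [lo hi r1 r2]] := between_avoiding `|mu false| `|mu true| lohi.
have r0 : 0 < r by apply: lt_trans lo; rewrite mulr_gt0.
suff [C hC] : exists C, forall n, cnorm (a ^+ n * w) <= C * r ^+ n.
  apply: le_trans (sa_growth sa (ltW r0) hC) _.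
  by rewrite ler_wpM2r ?cnorm_ge0.
have comm n k : (1 - k *: a) * a ^+ n = a ^+ n * (1 - k *: a).
  by rewrite mulrBl mulrBr mul1r mulr1 -scalerAl -scalerAr -exprS -exprSr.
pose x := (1 - (mu true)%:C *: a) * w.
have [C' hC'] : exists C, forall n, cnorm (a ^+ n * x) <= C * r ^+ n.
  apply: (@null_remove_factor false _ (cnorm bs * cnorm (b * w))) => //.
    exact: null_mull.
  move=> n; rewrite /x [a ^+ n * _]mulrA -comm !mulrA.
  rewrite -(qd_bsb QD) -!mulrA [b * (_ * _)]mulrA (qd_baX QD) -scalerAl -scalerAr -mulrA cnormZ.
  rewrite -/(modulus _) modulusC ger0_norm ?exprn_ge0 ?(ltW Q0) //.
  have -> : cnorm bs * (cnorm (b * w) * r ^+ n) = r ^+ n * (cnorm bs * cnorm (b * w)) by ring.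
  apply: le_trans (_ : Q ^+ n * (cnorm bs * (m ^+ n * cnorm (b * w))) <= _).
    rewrite ler_wpM2l ?exprn_ge0 ?(ltW Q0) //; apply: le_trans (cnormM _ _) _.
    by rewrite ler_wpM2l ?cnorm_ge0 // aX //; exact: null_mull.
  rewrite [cnorm bs * (m ^+ n * _)]mulrCA [leLHS]mulrA -exprMn ler_wpM2r ?mulr_ge0 ?cnorm_ge0 //.
  by rewrite lerXn2r ?nnegrE ?mulr_ge0 ?(ltW Q0) ?(ltW m0) ?(ltW r0) ?(ltW lo).
apply: (@null_remove_factor true _ C') => // n.
by rewrite mulrA comm -mulrA.
Qed.

Lemma null_annihilated w : null w -> a * w = 0.
Proof.
move=> nw; pose t := (1 + Q) / 2.
have [t0 t1] : 0 < t /\ t < 1.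
  by have := qd_lt1 QD; have := qd_gt0 QD; rewrite /t; split; lra.
have m0 : 0 < cnorm a + 1 by rewrite ltr_wpDl ?cnorm_ge0.
have bound n : forall x, null x -> cnorm (a * x) <= t ^+ n * (cnorm a + 1) * cnorm x.
  elim: n => [|n IH] x nx.
    rewrite expr0 mul1r; apply: le_trans (cnormM _ _) _.
    by rewrite ler_wpM2r ?cnorm_ge0 // lerDl.
  rewrite exprS -[t * _ * _]mulrA; apply: null_shrink => //.
  by rewrite mulr_gt0 // exprn_gt0.
apply: cnorm_eq0; apply/le_anti; rewrite cnorm_ge0 andbT.
apply: (@geom_le0 _ _ ((cnorm a + 1) * cnorm w) t) => //; first exact: ltW.
  by rewrite mulr_ge0 ?cnorm_ge0 // ltW.
by move=> n; rewrite mulrC mulrA; exact: bound.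
Qed.

End NullIdeal.

(** * The kernel of a *)

Lemma horner_algE (C : comNzRingType) (A : algType C) (x : A) g :
  horner_alg x g = \sum_(j < size g) g`_j *: x ^+ j.
Proof.
rewrite -[in LHS](coefK g) poly_def rmorph_sum /=; apply: eq_bigr => j _.
by rewrite horner_algZ rmorphXn /= horner_algX.
Qed.

Section KernelVectors.
Variables (R : realType) (S : cstarAlgType R) (Q : R) (mu : bool -> R) (a b : S).
Hypothesis QD : qdisc_algebra Q mu a b.
Variables (H : hilbertType R) (e : nat -> H) (pi : bool -> S -> H -> H).
Hypothesis eB : orthonormal_basis e.
Hypothesis piR : forall s, mu s != 0 -> qdisc_rep Q mu a b e s (pi s).

Let cS := @cnorm_is_complete R S.
Let cH := vnorm_is_complete H.
Let Q0 := qd_gt0 QD.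
Let Q1 := qd_lt1 QD.

Local Notation bs := (star b).

Lemma qd_ab : a * b = (Q^-1)%:C *: (b * a).
Proof. by rewrite (qd_ba QD) scalerA -rmorphM mulVf ?lt0r_neq0 // scale1r. Qed.

Lemma poly_in_normal_a p : poly_in a b p -> exists p', a * p = p' * a.
Proof.
elim=> [|x y _ [x' hx] _ [y' hy]|k x _ [x' hx]|x _ [x' hx]|x _ [x' hx]|x _ [x' hx]].
- by exists 1; rewrite mulr1 mul1r.
- by exists (x' + y'); rewrite mulrDr mulrDl hx hy.
- by exists (k *: x'); rewrite -scalerAr hx scalerAl.
- by exists (a * x'); rewrite -[RHS]mulrA hx.
- by exists ((Q^-1)%:C *: (b * x')); rewrite mulrA qd_ab -scalerAl -mulrA hx mulrA scalerAl.
- by exists (Q%:C *: (bs * x')); rewrite mulrA (qd_abs QD) -scalerAl -mulrA hx mulrA scalerAl.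
Qed.

(** Modulo the ideal generated by a, where b is unitary, p is the Laurent
polynomial b^-d g(b). *)
Definition laurent (d : nat) (p : S) (g : {poly R[i]}) (y : S) : Prop :=
  (size g <= (2 * d).+1)%N /\ b ^+ d * p = horner_alg b g + y * a.

Lemma laurentS d p g y : laurent d p g y -> exists g' y', laurent d.+1 p g' y'.
Proof.
move=> [gs gE]; exists ('X * g), (b * y); split.
  by apply: leq_trans (size_polyMleq _ _) _; rewrite size_polyX; lia.
by rewrite exprS -mulrA gE mulrDr rmorphM /= horner_algX mulrA.
Qed.

Lemma laurent_le d d' p g y : (d <= d')%N -> laurent d p g y ->
  exists g' y', laurent d' p g' y'.
Proof.
move=> /subnK <- L; elim: (d' - d)%N => [|k [g' [y' L']]]; first by exists g, y.
by rewrite addSn; apply: laurentS L'.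
Qed.

Lemma laurent_exists p : poly_in a b p -> exists d g y, laurent d p g y.
Proof.
elim=> {p} [|p r _ [d [g [y L]]] _ [d' [g' [y' L']]]|k p _ [d [g [y [gs gE]]]]|
          p pp _|p _ [d [g [y [gs gE]]]]|p pp [d [g [y [gs gE]]]]].
- exists 0%N, 1, 0; split; first by rewrite size_poly1.
  by rewrite expr0 rmorph1 mul0r addr0 mulr1.
- have [g1 [y1 [gs1 gE1]]] := laurent_le (leq_maxl d d') L.
  have [g2 [y2 [gs2 gE2]]] := laurent_le (leq_maxr d d') L'.
  exists (maxn d d'), (g1 + g2), (y1 + y2); split.
    by apply: leq_trans (size_polyD _ _) _; rewrite geq_max gs1.
  by rewrite mulrDr gE1 gE2 rmorphD /= mulrDl addrACA.
- exists d, (k *: g), (k *: y); split; first exact: leq_trans (size_scale_leq _ _) gs.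
  by rewrite -scalerAr gE horner_algZ scalerDr scalerAl.
- have [p' ap] := poly_in_normal_a pp.
  exists 0%N, 0, p'; split; first by rewrite size_poly0.
  by rewrite expr0 mul1r rmorph0 add0r.
- exists d.+1, ('X^2 * g), (b ^+ 2 * y); split.
    by apply: leq_trans (size_polyMleq _ _) _; rewrite size_polyXn; lia.
  rewrite [X in X = _]mulrA -exprSr -addn2 addnC exprD -mulrA gE mulrDr rmorphM /=.
  by rewrite rmorphXn /= horner_algX mulrA.
- have [p' ap] := poly_in_normal_a pp.
  have [z bbs] : exists z, b * bs = 1 + z * a.
    rewrite (qd_bbs QD) one_subM; move: (_%:C + _) (_%:C * _) => k l.
    exists (l *: a - k%:A); rewrite mulrBl -scalerAl -expr2 -scalerAl mul1r.
    by rewrite -addrA [- _ + _]addrC.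
  exists d.+1, g, (y + b ^+ d * z * p'); split; first by apply: leq_trans gs _; lia.
  rewrite exprSr mulrA -[_ * b * bs]mulrA bbs mulrDr mulr1 mulrDl gE -addrA mulrDl.
  by congr (_ + (_ + _)); rewrite -!mulrA ap.
Qed.

Lemma laurentM d d' p p' g g' y y' : poly_in a b p' ->
  laurent d p g y -> laurent d' p' g' y' ->
  exists g1 y1, laurent (d + d') (p * p') g1 y1.
Proof.
move=> pp [gs gE] [gs' gE']; have [r ap] := poly_in_normal_a pp.
exists (g * g'), (horner_alg b g * y' + b ^+ d' * y * r); split.
  by apply: leq_trans (size_polyMleq _ _) _; lia.
have com : b ^+ d' * horner_alg b g = horner_alg b g * b ^+ d'.
  have -> : b ^+ d' = horner_alg b 'X^d' by rewrite rmorphXn /= horner_algX.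
  by rewrite -!rmorphM mulrC.
have -> : b ^+ (d + d') * (p * p') =
    horner_alg b g * (b ^+ d' * p') + b ^+ d' * y * (a * p').
  by rewrite addnC exprD -mulrA [b ^+ d * (p * p')]mulrA gE mulrDl mulrDr !mulrA com.
by rewrite gE' ap mulrDr rmorphM /= mulrDl -addrA !mulrA.
Qed.

Lemma laurentX d p g y n : poly_in a b p -> laurent d p g y ->
  exists g' y', laurent (n * d) (p ^+ n) g' y'.
Proof.
move=> pp L; elim: n => [|n [g' [y' L']]].
  exists 1, 0; rewrite /laurent size_poly1; split=> //.
  by rewrite mul0n !expr0 rmorph1 mul0r addr0 mulr1.
by rewrite exprS mulSn; apply: laurentM L L'; exact: poly_inX.
Qed.

Section Coefficients.
Variable s : bool.
Hypothesis s0 : mu s != 0.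
Let nu := mu (~~ s) / mu s.
Let wt := qd_weight Q nu.

Lemma qd_nu_le0 : nu <= 0.
Proof.
have -> : nu = (mu false * mu true) * (mu s) ^- 2.
  by rewrite /nu; case: (s) s0 => h /=; field; exact: h.
by rewrite mulr_le0_ge0 ?(qd_mu QD) // invr_ge0 exprn_even_ge0.
Qed.

Lemma qd_rep_bs n : pi s bs (e n) = (wt n.+1)%:C *: e n.+1.
Proof.
have [piS _ pb0 pbS] := piR s0.
exact: (onb_adjoint_shift (w := fun n => wt n.+1) eB piS pb0 pbS).
Qed.

Definition qd_weights i n : R := \prod_(j < i) wt (n + j).+1.

Lemma qd_rep_bsX i n : pi s (bs ^+ i) (e n) = (qd_weights i n)%:C *: e (n + i)%N.
Proof.
have [piS _ _ _] := piR s0.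
elim: i => [|i IH]; first by rewrite expr0 (rep1 piS) /qd_weights big_ord0 scale1r addn0.
rewrite exprS (repM piS) IH (repZv piS) qd_rep_bs scalerA -rmorphM addnS.
by rewrite /qd_weights big_ord_recr.
Qed.

Lemma qd_weights_ge0 i n : 0 <= qd_weights i n.
Proof. by rewrite prodr_ge0 // => j _; exact: sqrtr_ge0. Qed.

Lemma qd_weight_cvg : wt n @[n --> \oo] --> (1 : R).
Proof.
have Qn : Q ^+ n @[n --> \oo] --> (0 : R).
  by apply: cvg_expr; rewrite ger0_norm // ltW.
have c1 : 1 - Q ^+ n @[n --> \oo] --> (1 : R).
  by rewrite -[X in _ --> X]subr0; apply: cvgB => //; exact: cvg_cst.
have c2 : 1 - nu * Q ^+ n @[n --> \oo] --> (1 : R).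
  rewrite -[X in _ --> X]subr0 -[X in _ --> _ - X](mulr0 nu).
  by apply: cvgB; [exact: cvg_cst|apply: cvgM => //; exact: cvg_cst].
have c3 : (1 - Q ^+ n) * (1 - nu * Q ^+ n) @[n --> \oo] --> (1 : R).
  by rewrite -[X in _ --> X]mulr1; exact: cvgM.
rewrite -[X in _ --> X]sqrtr1; apply: continuous_cvg => //.
exact: sqrt_continuous.
Qed.

Lemma qd_weights_cvg i : qd_weights i n @[n --> \oo] --> (1 : R).
Proof.
elim: i => [|i IH].
  rewrite (_ : qd_weights 0 = fun=> 1); first exact: cvg_cst.
  by apply/funext => n; rewrite /qd_weights big_ord0.
rewrite (_ : qd_weights i.+1 = fun n => qd_weights i n * wt (n + i.+1)%N); last first.
  by apply/funext => n; rewrite /qd_weights big_ord_recr /= addnS.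
rewrite -[X in _ --> X]mulr1; apply: cvgM => //.
have := qd_weight_cvg; rewrite -(cvg_shiftn i.+1) /=; exact.
Qed.

(** Far out on the basis pi s b is nearly a shift, so that the matrix entries of
pi s p converge to the coefficients of its Laurent polynomial. *)
Lemma laurent_coef_le d p g y M i : laurent d p g y ->
  (forall v, vnorm (pi s p v) <= M * vnorm v) -> modulus g`_i <= M.
Proof.
move=> [gs gE] hM; have [piS pa _ _] := piR s0.
have [C C0 hC] := rep_bounded piS y.
pose K := C * `|mu s|^-1 * Q ^+ i.
have key n : modulus g`_i * qd_weights i n <= M * qd_weights d n + K * Q ^+ n.
  have E : inner (pi s (b ^+ d * p) (e (n + i)%N)) (e n) =
      inner (pi s (horner_alg b g) (e (n + i)%N)) (e n)
      + inner (pi s (y * a) (e (n + i)%N)) (e n).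
    by rewrite gE (repD piS) innerDl.
  have L : inner (pi s (horner_alg b g) (e (n + i)%N)) (e n) = g`_i * (qd_weights i n)%:C.
    rewrite horner_algE (rep_asum piS) inner_suml.
    have term j : inner (pi s (g`_j *: b ^+ j) (e (n + i)%N)) (e n) =
        g`_j * ((qd_weights j n)%:C * (i == j)%:R).
      rewrite (repZ piS) innerZl (rep_adj piS) starX qd_rep_bsX innerZr conj_realC.
      by rewrite (onb_inner eB) eqn_add2l.
    case: (ltnP i (size g)) => ig; last first.
      rewrite nth_default // mul0r big1 // => j _; rewrite term.
      by rewrite (gtn_eqF (leq_trans (ltn_ord j) ig)) !mulr0.
    rewrite (bigD1 (Ordinal ig)) //= term eqxx mulr1 big1 ?addr0 // => j ji.
    rewrite term (_ : (i == j) = false) ?mulr0 //; apply/eqP => ij.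
    by case/eqP: ji; apply: val_inj; rewrite /= ij.
  have A : modulus (inner (pi s (b ^+ d * p) (e (n + i)%N)) (e n)) <= M * qd_weights d n.
    rewrite (repM piS) (rep_adj piS) starX qd_rep_bsX innerZr conj_realC modulusM modulusC.
    rewrite ger0_norm ?qd_weights_ge0 // mulrC ler_wpM2r ?qd_weights_ge0 //.
    apply: le_trans (cauchy_schwarz _ _) _; rewrite (onb_vnorm eB) mulr1.
    by apply: le_trans (hM _) _; rewrite (onb_vnorm eB) mulr1.
  have B : modulus (inner (pi s (y * a) (e (n + i)%N)) (e n)) <= K * Q ^+ n.
    apply: le_trans (cauchy_schwarz _ _) _; rewrite (onb_vnorm eB) mulr1 (repM piS) pa.
    apply: le_trans (hC _) _; rewrite (cn_scale cH) (onb_vnorm eB) mulr1 modulusC.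
    rewrite normrM normfV ger0_norm ?exprn_ge0 ?(ltW Q0) // exprD /K.
    by rewrite le_eqVlt; apply/orP; left; apply/eqP; ring.
  have -> : modulus g`_i * qd_weights i n = modulus (g`_i * (qd_weights i n)%:C).
    by rewrite modulusM modulusC ger0_norm ?qd_weights_ge0.
  rewrite -L -[X in modulus X](addrK (inner (pi s (y * a) (e (n + i)%N)) (e n))) -E.
  by apply: le_trans (modulusD _ _) _; rewrite modulusN lerD.
have Qn : Q ^+ n @[n --> \oo] --> (0 : R).
  by apply: cvg_expr; rewrite ger0_norm // ltW.
have cl : modulus g`_i * qd_weights i n @[n --> \oo] --> modulus g`_i * 1.
  by apply: cvgM; [exact: cvg_cst|exact: qd_weights_cvg].
have cr : M * qd_weights d n + K * Q ^+ n @[n --> \oo] --> M * 1 + K * 0.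
  apply: cvgD; apply: cvgM => //; try exact: cvg_cst; exact: qd_weights_cvg.
rewrite -[leLHS]mulr1 -[leRHS]mulr1 -[leRHS]addr0 -[X in _ <= _ + X](mulr0 K).
by apply: ler_cvg_to cl cr _; exact: nearW.
Qed.

Lemma kernel_bX w i : a * w = 0 -> a * (b ^+ i * w) = 0 /\ cnorm (b ^+ i * w) = cnorm w.
Proof.
move=> aw; elim: i => [|i [aI nI]]; first by rewrite expr0 mul1r.
rewrite exprS -mulrA; split.
  by rewrite mulrA qd_ab -scalerAl -mulrA aI mulr0 scaler0.
rewrite -nI; apply/eqP; rewrite -(@eqrXn2 _ 2) ?cnorm_ge0 // -!cnorm_cstar.
rewrite starM -[_ * bs * _]mulrA [bs * (b * _)]mulrA (qd_bsb QD) one_subM.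
by rewrite mulrDl mulrBl mul1r -!scalerAl expr2 -mulrA aI mulr0 !scaler0 subr0 addr0.
Qed.

(** On the kernel of a the powers of b are isometric, so that p is bounded by the
sum of the moduli of its coefficients. *)
Lemma kernel_laurent_le w d p g y M : a * w = 0 -> poly_in a b p -> laurent d p g y ->
  (forall v, vnorm (pi s p v) <= M * vnorm v) ->
  cnorm (p * w) <= (2 * d).+1%:R * M * cnorm w.
Proof.
move=> aw pp L hM; have [r ap] := poly_in_normal_a pp.
have apw : a * (p * w) = 0 by rewrite mulrA ap -mulrA aw mulr0.
have [gs gE] := L; rewrite -(kernel_bX d apw).2.
rewrite mulrA gE mulrDl -[y * a * w]mulrA aw mulr0 addr0.
rewrite horner_algE mulr_suml; apply: le_trans (cn_sum cS _ _) _.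
apply: le_trans (_ : \sum_(j < size g) M * cnorm w <= _).
  apply: ler_sum => j _; rewrite -scalerAl cnormZ (kernel_bX j aw).2.
  by rewrite ler_wpM2r ?cnorm_ge0 //; exact: (laurent_coef_le _ L hM).
have M0 : 0 <= M.
  by have := hM (e 0%N); rewrite (onb_vnorm eB) mulr1; apply: le_trans; exact: vnorm_ge0.
rewrite sumr_const card_ord -[leLHS]mulr_natl mulrA ler_wpM2r ?cnorm_ge0 //.
by rewrite ler_wpM2r // ler_nat.
Qed.

End Coefficients.
End KernelVectors.

(** * Faithfulness and diagonal elements *)

Section Injectivity.
Variables (R : realType) (S : cstarAlgType R) (Q : R) (mu : bool -> R) (a b : S).
Hypothesis QD : qdisc_algebra Q mu a b.
Variables (H : hilbertType R) (e : nat -> H) (pi : bool -> S -> H -> H).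
Hypothesis eB : orthonormal_basis e.
Hypothesis piR : forall s, mu s != 0 -> qdisc_rep Q mu a b e s (pi s).

Let cS := @cnorm_is_complete R S.
Let cH := vnorm_is_complete H.
Let Q0 := qd_gt0 QD.
Let Q1 := qd_lt1 QD.

Local Notation bs := (star b).
Local Notation null := (qd_null mu pi).

(** The powers of h = p^* p have Laurent polynomials whose number of
coefficients grows linearly, each coefficient being bounded by the norm of
pi s h^n; this linear factor disappears on taking n-th roots. *)
Lemma kernel_bound s w p M : mu s != 0 -> a * w = 0 -> poly_in a b p ->
  (forall v, vnorm (pi s p v) <= M * vnorm v) -> cnorm (p * w) <= M * cnorm w.
Proof.
move=> s0 aw pp hM; have [piS _ _ _] := piR s0.
have M0 : 0 <= M.
  by have := hM (e 0%N); rewrite (onb_vnorm eB) mulr1; apply: le_trans; exact: vnorm_ge0.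
have hMs v : vnorm (pi s (star p) v) <= M * vnorm v.
  have [->|n0] := eqVneq (vnorm (pi s (star p) v)) 0; first by rewrite mulr_ge0 ?vnorm_ge0.
  have np : 0 < vnorm (pi s (star p) v) by rewrite lt_neqAle eq_sym n0 vnorm_ge0.
  rewrite -(ler_pM2l np) -expr2 -[leLHS]ger0_norm ?exprn_ge0 ?vnorm_ge0 //.
  rewrite -modulusC -inner_vnorm (rep_adj piS) starK.
  apply: le_trans (cauchy_schwarz _ _) _; rewrite mulrC [leRHS]mulrA.
  by rewrite ler_wpM2r ?vnorm_ge0 // mulrC.
pose h := star p * p.
have hs : star h = h by rewrite /h starM starK.
have ph : poly_in a b h by apply: poly_inM => //; exact: (poly_in_star (qd_sa QD) pp).
have hh n v : vnorm (pi s (h ^+ n) v) <= (M ^+ 2) ^+ n * vnorm v.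
  elim: n => [|n IH]; first by rewrite !expr0 (rep1 piS) mul1r.
  rewrite exprS (repM piS) /h (repM piS); apply: le_trans (hMs _) _.
  rewrite [_ ^+ n.+1]exprS expr2 -!mulrA ler_wpM2l //; apply: le_trans (hM _) _.
  by rewrite ler_wpM2l // -expr2.
have [d [g [y L]]] := laurent_exists QD ph.
have hw : cnorm (h * w) <= M ^+ 2 * cnorm w.
  have [w0|wn0] := eqVneq (cnorm w) 0.
    by rewrite (cnorm_eq0 _ w0) mulr0 cnorm0 mulr0.
  have wp : 0 < cnorm w by rewrite lt_neqAle eq_sym wn0 cnorm_ge0.
  apply: (@le_of_doubling_powers _ _ _ (2 * d).+1%:R) => [|||k].
  - exact: cnorm_ge0.
  - by rewrite mulr_ge0 ?exprn_ge0 ?cnorm_ge0.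
  - exact: ler0n.
  have [g' [y' L']] := laurentX QD (2 ^ k) ph L.
  rewrite -(ler_pM2r wp); apply: le_trans (sa_power w k hs) _.
  have := kernel_laurent_le QD eB piR s0 aw (poly_inX (2 ^ k) ph) L' (hh (2 ^ k)%N).
  move=> le; apply: le_trans (ler_wpM2r (exprn_ge0 _ (cnorm_ge0 w)) le) _.
  have Z0 : 0 <= (M ^+ 2) ^+ (2 ^ k) * cnorm w ^+ (2 ^ k) * cnorm w.
    by rewrite !mulr_ge0 ?exprn_ge0 ?cnorm_ge0.
  have N : (2 * (2 ^ k * d)).+1%:R <= (2 * d).+1%:R * (2 ^ k)%:R :> R.
    rewrite -natrM ler_nat mulSn mulnCA mulnC; have : (0 < 2 ^ k)%N by rewrite expn_gt0.
    by rewrite mulnA; lia.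
  have := ler_wpM2r Z0 N; rewrite [(M ^+ 2 * _) ^+ _]exprMn.
  move: ((M ^+ 2) ^+ _) (cnorm w ^+ _) => X Y.
  by rewrite !mulrA [_ * cnorm w * Y]mulrAC.
rewrite -(@ler_pXn2r _ 2) ?nnegrE ?mulr_ge0 ?cnorm_ge0 //.
rewrite -cnorm_cstar starM -mulrA [star p * (p * w)]mulrA.
apply: le_trans (cnormM _ _) _; rewrite cnorm_star exprMn expr2 [cnorm w ^+ 2]expr2.
by rewrite [leRHS]mulrCA ler_wpM2l ?cnorm_ge0 // -expr2.
Qed.

(** A null w satisfies a w = 0, and star w is null too; the bound for polynomials
close to star w then makes star w * w vanish. *)
Theorem qd_injective s w : mu s != 0 -> null w -> w = 0.
Proof.
move=> s0 nw; have [piS _ _ _] := piR s0.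
have aw := null_annihilated QD eB piR nw.
have nws := null_star piR nw.
have w0 := cnorm_ge0 w.
apply/cnorm_eq0/eqP; rewrite -sqrf_eq0 eq_le exprn_ge0 // andbT.
apply: (@ler_addeps _ _ _ (cnorm w *+ 2)); first by rewrite mulrn_wge0.
move=> d d0; rewrite add0r; have [p [pp hp]] := qd_dense QD (star w) d0.
rewrite -cnorm_cstar -[star w](subrK p) mulrDl.
apply: le_trans (cnormD _ _) _; rewrite mulr2n [leRHS]mulrDl; apply: lerD.
  by apply: le_trans (cnormM _ _) _; rewrite mulrC ler_wpM2l // ltW.
rewrite mulrC; apply: (kernel_bound s0 aw pp) => v.
rewrite -[p](subKr (star w)) (repB piS) nws // sub0r (cnN cH).
by apply: le_trans (rep_contractive piS _ _) _; rewrite ler_wpM2r ?vnorm_ge0 // ltW.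
Qed.

Definition acts_diagonally (x : S) (h : bool -> nat -> R) : Prop :=
  forall s, mu s != 0 -> forall k, pi s x (e k) = (h s k)%:C *: e k.

Lemma diagonal_star x h : acts_diagonally x h -> acts_diagonally (star x) h.
Proof.
move=> xh s s0 k; have [piS _ _ _] := piR s0.
apply/eqP; rewrite -subr_eq0; apply/eqP; apply: (onb_eq0 eB) => j.
rewrite innerBl innerZl (rep_adj piS) starK xh // innerZr conj_realC (onb_inner eB).
by case: eqVneq => [->|_]; rewrite ?subrr // !mulr0 subrr.
Qed.

Lemma diagonal_unique s x y h : mu s != 0 ->
  acts_diagonally x h -> acts_diagonally y h -> x = y.
Proof.
move=> s0 xh yh; apply/eqP; rewrite -subr_eq0; apply/eqP; apply: (qd_injective s0).
move=> s' s'0 v; have [piS _ _ _] := piR s'0.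
rewrite (repB piS) (onb_ext (y := y) eB piS piS) ?subrr // => i.
by rewrite xh // yh.
Qed.

Lemma diagonalM x y h k : acts_diagonally x h -> acts_diagonally y k ->
  acts_diagonally (x * y) (fun s n => h s n * k s n).
Proof.
move=> xh yk s s0 n; have [piS _ _ _] := piR s0.
by rewrite (repM piS) yk // (repZv piS) xh // scalerA -rmorphM mulrC.
Qed.

Lemma horner_alg_eigen s x g v : mu s != 0 -> pi s a v = x *: v ->
  pi s (horner_alg a g) v = g.[x] *: v.
Proof.
move=> s0 av; have [piS _ _ _] := piR s0.
elim/poly_ind: g => [|g c IH].
  by rewrite rmorph0 (rep0 piS) horner0 scale0r.
rewrite rmorphD rmorphM /= horner_algX horner_algC (repD piS) (repM piS) av.
rewrite (repZv piS) IH (repZ piS) (rep1 piS) scalerA -scalerDl.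
by rewrite hornerMXaddC [x * _]mulrC.
Qed.

Lemma horner_algCa g : horner_alg a g * a = a * horner_alg a g.
Proof. by rewrite -{2 3}[a]horner_algX -!rmorphM mulrC. Qed.

Section MatrixUnits.
Variable s : bool.
Hypothesis s0 : mu s != 0.
Let t := (mu s)^-1.
Let nu := mu (~~ s) / mu s.
Let nu0 : nu <= 0 := qd_nu_le0 QD s0.

Fixpoint bsb_poly (j : nat) : {poly R[i]} :=
  if j is j'.+1 then
    (1 - (mu s)%:C *: 'X) * ((1 - (mu (~~ s))%:C *: 'X)
      * (bsb_poly j' \Po ((Q^-1)%:C *: 'X)))
  else 1.

Lemma bsb_polyE j : horner_alg a (bsb_poly j) = bs ^+ j * b ^+ j.
Proof.
have shift g : bs * horner_alg a g = horner_alg a (g \Po ((Q^-1)%:C *: 'X)) * bs.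
  elim/poly_ind: g => [|g c IH].
    by rewrite comp_poly0 !rmorph0 mulr0 mul0r.
  rewrite comp_polyD comp_polyM comp_polyX comp_polyC !rmorphD !rmorphM /=.
  rewrite horner_algZ !horner_algX !horner_algC mulrDr mulrDl mulrA IH.
  congr (_ + _); last by rewrite -scalerAr mulr1 -scalerAl mul1r.
  rewrite -!mulrA; congr (_ * _); rewrite -scalerAl (qd_abs QD) scalerA -rmorphM.
  by rewrite mulVf ?lt0r_neq0 // scale1r.
elim: j => [|j IH]; first by rewrite !expr0 rmorph1 mulr1.
rewrite /= mulrA mulrC !rmorphM !rmorphB rmorph1 /= !horner_algZ horner_algX.
rewrite -(qd_bsbE QD) [LHS]mulrA -shift IH mulrA -exprS -mulrA -exprSr //.
Qed.

Lemma bsb_poly_neq0 j (u : R) : 1 < u -> (bsb_poly j).[(u * t)%:C] != 0.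
Proof.
elim: j u => [|j IH] u u1; first by rewrite hornerC oner_eq0.
rewrite /= !hornerM horner_comp !hornerE -!rmorphM -!rmorphB /=.
have E1 : 1 - mu s * (u * t) != 0.
  by rewrite mulrCA divff // mulr1 subr_eq0 lt_eqF.
have E2 : 1 - mu (~~ s) * (u * t) != 0.
  rewrite mulrCA -/nu gt_eqF //; have : u * nu <= 0.
    by rewrite mulr_ge0_le0 // ltW // (lt_trans _ u1).
  by move=> h; rewrite subr_gt0; apply: le_lt_trans h _.
have E3 : (bsb_poly j).[(Q^-1 * (u * t))%:C] != 0.
  rewrite mulrA; apply: IH; rewrite mulrC ltr_pdivlMr // mul1r.
  by apply: lt_trans u1.
by rewrite !mulf_neq0 ?fmorph_eq0.
Qed.

(** Moving a^n to the left of b^j multiplies it by Q^(j n). *)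
Lemma bsb_poly_bound j : exists2 C : R, 0 <= C & forall n,
  cnorm (horner_alg a (bsb_poly j) * a ^+ n) <= C * (Q ^+ j * cnorm a) ^+ n.
Proof.
exists (cnorm (bs ^+ j) * cnorm (1 : S) * cnorm (b ^+ j)).
  by rewrite !mulr_ge0 ?cnorm_ge0.
move=> n; have bXaX : b ^+ j * a ^+ n = ((Q ^+ j) ^+ n)%:C *: (a ^+ n * b ^+ j).
  elim: j => [|j IH]; first by rewrite !expr0 expr1n mul1r mulr1 scale1r.
  rewrite [b ^+ _]exprS -[LHS]mulrA IH -scalerAr [b * (a ^+ n * _)]mulrA (qd_baX QD).
  by rewrite -!scalerAl scalerA -mulrA -rmorphM /= [in RHS]exprSr exprMn.
rewrite bsb_polyE -[_ * a ^+ n]mulrA bXaX -scalerAr cnormZ -/(modulus _) modulusC.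
rewrite ger0_norm ?exprn_ge0 ?(ltW Q0) //.
have A := le_trans (cnormM (bs ^+ j) (a ^+ n * b ^+ j))
  (ler_wpM2l (cnorm_ge0 _) (cnormM (a ^+ n) (b ^+ j))).
have B : cnorm (a ^+ n) * cnorm (b ^+ j) <= cnorm (1 : S) * cnorm a ^+ n * cnorm (b ^+ j).
  by rewrite ler_wpM2r ?cnorm_ge0 ?cnormX.
have D := le_trans A (ler_wpM2l (cnorm_ge0 _) B).
apply: le_trans (ler_wpM2l _ D) _; first by rewrite !exprn_ge0 ?(ltW Q0).
by rewrite exprMn le_eqVlt; apply/orP; left; apply/eqP; ring.
Qed.

(** The eigenvalues of a under pi s decrease strictly in modulus, and those of the
other sign lie on the other side of 0. *)
Lemma qd_eigenvalue_neq s' k : mu s' != 0 -> (s' != s) || (k != 0%N) ->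
  1 - mu s * (Q ^+ k / mu s') != 0.
Proof.
move=> s'0; have Qk : 0 < Q ^+ k by rewrite exprn_gt0.
case: (eqVneq s' s) => [->|s's] /= k0.
  rewrite mulrCA divff // mulr1 subr_eq0 gt_eqF // exprn_ilt1 //; exact: ltW.
have -> : mu s * (Q ^+ k / mu s') = Q ^+ k * (mu s / mu s') by ring.
have le0 : mu s / mu s' <= 0.
  have -> : s = ~~ s' by case: (s) s's; case: (s').
  exact: (qd_nu_le0 QD s'0).
rewrite gt_eqF // subr_gt0; apply: le_lt_trans ltr01.
by rewrite mulr_ge0_le0 // ltW.
Qed.

(** The spectral projection of a at 1 / mu s, as the limit of (mu a)^n G(a)
where (1 - mu a) G(a) = star b^j b^j. The exponent j is chosen so large that the
eigenvalues of a left uncancelled by G, other than 1 / mu s, are smaller than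
1 / mu s in modulus. *)
Lemma vacuum_projection : exists P : S, acts_diagonally P
  (fun s' k => ((s' == s) && (k == 0%N))%:R).
Proof.
have ma : 0 < cnorm a * `|mu s| + 1 by rewrite ltr_wpDl // mulr_ge0 ?cnorm_ge0.
have [j hj] := exp_small (ltW Q0) Q1 (divr_gt0 ltr01 ma).
pose th := Q ^+ j.+1 * cnorm a * `|mu s|.
have th0 : 0 <= th by rewrite !mulr_ge0 ?exprn_ge0 ?cnorm_ge0 ?(ltW Q0).
have th1 : th < 1.
  have := hj j.+1 (leqnSn _); rewrite ltr_pdivlMr // => lt; apply: le_lt_trans lt.
  by rewrite /th -mulrA ler_wpM2l ?exprn_ge0 ?(ltW Q0) // lerDl.
pose G := (1 - (mu (~~ s))%:C *: 'X) * (bsb_poly j \Po ((Q^-1)%:C *: 'X)).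
pose u n := (mu s ^+ n)%:C *: (horner_alg a G * a ^+ n).
have [C C0 hC] := bsb_poly_bound j.+1.
have uE n : (1 - (mu s)%:C *: a) * u n =
    (mu s ^+ n)%:C *: (horner_alg a (bsb_poly j.+1) * a ^+ n).
  have -> : horner_alg a (bsb_poly j.+1) = (1 - (mu s)%:C *: a) * horner_alg a G.
    rewrite -[bsb_poly j.+1]/((1 - (mu s)%:C *: 'X) * G) [LHS]rmorphM; congr (_ * _).
    by rewrite rmorphB rmorph1 /= horner_algZ horner_algX.
  by rewrite /u -scalerAr mulrA.
have ub n : cnorm ((1 - (mu s)%:C *: a) * u n) <= C * th ^+ n.
  rewrite uE cnormZ -/(modulus _) modulusC normrX.
  apply: le_trans (ler_wpM2l _ (hC n)) _; first by rewrite exprn_ge0.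
  by rewrite [leLHS]mulrCA -exprMn /th [`|mu s| * _]mulrC.
have uC n : (1 - (mu s)%:C *: a) * u n = u n * (1 - (mu s)%:C *: a).
  have com : a * u n = u n * a.
    by rewrite /u -scalerAr -scalerAl mulrA -horner_algCa -!mulrA -exprS -exprSr.
  by move: (u n) com => x com; rewrite mulrBl mulrBr mul1r mulr1 -scalerAl -scalerAr com.
have uS n : (1 - (mu s)%:C *: a) * u n = u n - u n.+1.
  have au : (mu s)%:C *: (a * u n) = u n.+1.
    by rewrite /u -scalerAr scalerA -rmorphM -exprS mulrA -horner_algCa -mulrA -exprS.
  by rewrite -au; move: (u n) => x; rewrite mulrBl mul1r -scalerAl.
have [n|l ul] := @cn_geometric R S _ cS C th u th0 th1 C0.
  by rewrite (cnC cS) -uS.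
set K := C / _ in ul; have K0 : 0 <= K by rewrite divr_ge0 // subr_ge0 ltW.
have lr : l * (1 - (mu s)%:C *: a) = 0.
  apply: cnorm_eq0; apply/le_anti; rewrite cnorm_ge0 andbT.
  apply: (@geom_le0 _ _ (K * cnorm (1 - (mu s)%:C *: a) + C) th) => // [|n].
    by rewrite addr_ge0 // mulr_ge0 ?cnorm_ge0.
  rewrite -[X in X * _](subKr (u n)) mulrBl -uC.
  apply: le_trans (cnB cS _ _) _; rewrite addrC [leRHS]mulrDl; apply: lerD => //.
  apply: le_trans (cnormM _ _) _; rewrite [leRHS]mulrAC ler_wpM2r ?cnorm_ge0 //.
have Gt : G.[t%:C] != 0.
  rewrite /G hornerM horner_comp !hornerE -!rmorphM -!rmorphB /= mulf_neq0 //.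
    rewrite fmorph_eq0 gt_eqF // subr_gt0; exact: le_lt_trans nu0 _.
  by rewrite bsb_poly_neq0 // invf_gt1.
exists (G.[t%:C]^-1 *: l) => s' s'0 k; have [piS pa _ _] := piR s'0.
rewrite (repZ piS); case: (boolP ((s' == s) && (k == 0%N))) => [/andP[/eqP ss /eqP k0]|sk].
  rewrite ss k0 in s'0 piS pa *; rewrite scale1r.
  suff -> : pi s l (e 0%N) = G.[t%:C] *: e 0%N by rewrite scalerA mulVf // scale1r.
  apply/eqP; rewrite -subr_eq0; apply/eqP; apply: (cn_eq0 cH); apply/le_anti.
  rewrite vnorm_ge0 andbT; apply: (@geom_le0 _ _ K th) => // n.
  have -> : G.[t%:C] *: e 0%N = pi s (u n) (e 0%N).
    have a0 : pi s a (e 0%N) = t%:C *: e 0%N by rewrite pa expr0 div1r.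
    have aX : pi s (a ^+ n) (e 0%N) = (t ^+ n)%:C *: e 0%N.
      elim: n => [|n IH]; first by rewrite !expr0 (rep1 piS) scale1r.
      rewrite exprSr (repM piS) a0 (repZv piS) IH scalerA -rmorphM -exprS //.
    rewrite /u (repZ piS) (repM piS) aX (repZv piS) (horner_alg_eigen G s0 a0).
    by rewrite scalerA -rmorphM -exprMn divff // expr1n scale1r.
  rewrite -(repB piS) -[K * _]mulr1 -(onb_vnorm eB 0%N).
  apply: le_trans (rep_contractive piS _ _) _; rewrite ler_wpM2r ?vnorm_ge0 //.
  by rewrite (cnC cS).
rewrite scale0r; suff -> : pi s' l (e k) = 0 by rewrite scaler0.
have : pi s' (l * (1 - (mu s)%:C *: a)) (e k) = 0 by rewrite lr (rep0 piS).
rewrite (repM piS) (repB piS) (rep1 piS) (repZ piS) pa scalerA -rmorphM.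
rewrite -[X in X - _]scale1r -scalerBl (repZv piS) => /eqP; rewrite scaler_eq0.
rewrite -(rmorph1 (real_complex R)) -rmorphB fmorph_eq0.
by rewrite negb_and in sk; rewrite (negPf (qd_eigenvalue_neq s'0 sk)) => /eqP.
Qed.

End MatrixUnits.
End Injectivity.

Section Diagonals.
Variables (R : realType) (S : cstarAlgType R) (Q : R) (mu : bool -> R) (a b : S).
Hypothesis QD : qdisc_algebra Q mu a b.
Variables (H : hilbertType R) (e : nat -> H) (pi : bool -> S -> H -> H).
Hypothesis eB : orthonormal_basis e.
Hypothesis piR : forall s, mu s != 0 -> qdisc_rep Q mu a b e s (pi s).
Variable s0 : bool.
Hypothesis s00 : mu s0 != 0.

Let cS := @cnorm_is_complete R S.
Let cH := vnorm_is_complete H.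
Let Q0 := qd_gt0 QD.
Let Q1 := qd_lt1 QD.

Local Notation bs := (star b).
Local Notation diag := (acts_diagonally mu e pi).
Local Notation W := (qd_weights Q mu).

Lemma qd_rep_bX s k : mu s != 0 ->
  (forall n, pi s (b ^+ k) (e (n + k)%N) = (W s k n)%:C *: e n) /\
  (forall j, (j < k)%N -> pi s (b ^+ k) (e j) = 0).
Proof.
move=> sn0; have [piS _ pb0 pbS] := piR sn0.
elim: k => [|k [IH1 IH2]]; split=> //.
- by move=> n; rewrite addn0 expr0 (rep1 piS) /qd_weights big_ord0 scale1r.
- move=> n; rewrite exprSr (repM piS) addnS pbS (repZv piS) IH1 scalerA -rmorphM /= mulrC.
  by rewrite /qd_weights big_ord_recr.
- move=> [|j] jk; rewrite exprSr (repM piS); first by rewrite pb0 (rep0v piS).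
  by rewrite pbS (repZv piS) IH2 // scaler0.
Qed.

Lemma qd_weights_gt0 s k n : mu s != 0 -> 0 < W s k n.
Proof.
move=> sn0; apply: prodr_gt0 => j _; rewrite sqrtr_gt0 mulr_gt0 //.
  by rewrite subr_gt0 exprn_ilt1 // ltW.
rewrite subr_gt0; apply: le_lt_trans ltr01.
by rewrite mulr_le0_ge0 ?exprn_ge0 ?(ltW Q0) // (qd_nu_le0 QD sn0).
Qed.

(** Obtained from the vacuum projection P as a multiple of star b^k P b^k. Being a
self-adjoint idempotent it has norm at most 1. *)
Lemma basis_projection s k : exists E : S, cnorm E <= 1 /\
  diag E (fun s' j => ((s' == s) && (j == k))%:R).
Proof.
suff [E hE] : exists E : S, diag E (fun s' j => ((s' == s) && (j == k))%:R).
  exists E; split=> //.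
  have Es : star E = E.
    exact: (diagonal_unique QD eB piR s00 (diagonal_star eB piR hE) hE).
  have EE : star E * E = E.
    rewrite Es; apply: (diagonal_unique QD eB piR s00 (diagonalM piR hE hE)) => s' s'0 j.
    by rewrite hE // -natrM mulnb andbb.
  have := cnorm_cstar E; rewrite EE => nE.
  case: (ltP 1 (cnorm E)) => // lt; have : cnorm E < cnorm E ^+ 2.
    by rewrite expr2 ltr_pMr // (lt_trans ltr01).
  by rewrite -nE ltxx.
have [sz|sn0] := eqVneq (mu s) 0.
  exists 0 => s' s'0 j; have [piS _ _ _] := piR s'0; rewrite (rep0 piS).
  have /negPf -> : s' != s by apply: contraNneq s'0 => ->; rewrite sz.
  by rewrite scale0r.
have [P hP] := vacuum_projection QD eB piR sn0.
have Wp := qd_weights_gt0 k 0 sn0.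
exists ((W s k 0 ^- 2)%:C *: (bs ^+ k * P * b ^+ k)) => s' s'0 j.
have [piS _ _ _] := piR s'0; have [b1 b2] := qd_rep_bX k s'0.
rewrite (repZ piS) !(repM piS); case: (ltnP j k) => [jk|/subnK <-].
  by rewrite b2 // !(rep0v piS) scaler0 ltn_eqF // andbF scale0r.
have -> : (j - k + k == k)%N = (j - k == 0)%N by rewrite -[X in _ == X]add0n eqn_add2r.
rewrite b1 !(repZv piS) hP // (repZv piS) !scalerA.
case: eqP => [->|_] /=; last by rewrite rmorph0 !mulr0 !scale0r.
case: eqP => [->|_] /=; last by rewrite rmorph0 !mulr0 !scale0r.
rewrite (qd_rep_bsX eB piR sn0) scalerA mulr1 -!rmorphM /= add0n.
by congr (_%:C *: _); field; rewrite lt0r_neq0.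
Qed.

(** The series kappa + sum (h s k - kappa) E_(s,k), with E_(s,k) the basis
projections, converges geometrically. *)
Theorem diagonal_element (h : bool -> nat -> R) (kappa C th : R) :
  0 <= th -> th < 1 -> 0 <= C -> (forall s k, `|h s k - kappa| <= C * th ^+ k) ->
  exists d, diag d h.
Proof.
move=> th0 th1 C0 hC.
have /choice[E hE] : forall i : bool * nat, exists E : S, cnorm E <= 1 /\
    diag E (fun s' j => ((s' == i.1) && (j == i.2))%:R).
  by move=> [s k]; exact: basis_projection.
pose T n := \sum_(s : bool) (h s n - kappa)%:C *: E (s, n).
pose u n := kappa%:C *: 1 + \sum_(k < n) T k.
have C20 : 0 <= C * 2 by rewrite mulr_ge0.
have [n|d ud] := @cn_geometric R S _ cS (C * 2) th u th0 th1 C20.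
  rewrite /u big_ord_recr /= addrA [_ + T n]addrC addrK /T big_bool.
  have le1 s : cnorm ((h s n - kappa)%:C *: E (s, n)) <= C * th ^+ n.
    rewrite cnormZ -/(modulus _) modulusC -[leRHS]mulr1.
    by rewrite ler_pM ?cnorm_ge0 // (hE (s, n)).1.
  apply: le_trans (cnormD _ _) _; have := le1 true; have := le1 false; lra.
set K := C * 2 / _ in ud; have K0 : 0 <= K by rewrite divr_ge0 // subr_ge0 ltW.
exists d => s sn0 k; have [piS _ _ _] := piR sn0.
apply/eqP; rewrite -subr_eq0; apply/eqP; apply: (cn_eq0 cH); apply/le_anti.
rewrite vnorm_ge0 andbT; apply: (@geom_le0 _ _ K th) => // n.
have Te j : pi s (T j) (e k) = (if j == k then h s k - kappa else 0)%:C *: e k.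
  rewrite /T (rep_asum piS) (bigD1 s) //= big1 => [|s' s's].
    rewrite (repZ piS) (hE (s, j)).2 //= eqxx /= addr0 [k == j]eq_sym.
    by case: eqP => [->|_] /=; rewrite ?rmorph1 ?scale1r // !rmorph0 !scale0r scaler0.
  by rewrite (repZ piS) (hE (s', j)).2 //= [s == s']eq_sym (negPf s's) rmorph0 scale0r scaler0.
have ue : pi s (u (n + k.+1)%N) (e k) = (h s k)%:C *: e k.
  rewrite /u (repD piS) (repZ piS) (rep1 piS) (rep_asum piS).
  have kn : (k < n + k.+1)%N by rewrite ltn_addl.
  rewrite (bigD1 (Ordinal kn)) //= Te eqxx big1 => [|j jk].
    by rewrite addr0 -scalerDl -rmorphD /= addrC subrK.
  rewrite Te ifF ?scale0r //; apply/eqP => jE; case/eqP: jk; exact: val_inj.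
rewrite -ue -(repB piS); apply: le_trans (rep_contractive piS _ _) _.
rewrite (onb_vnorm eB) mulr1 (cnC cS); apply: le_trans (ud _) _.
by rewrite ler_wpM2l // exprD ler_piMr ?exprn_ge0 // exprn_ile1 // ltW.
Qed.

End Diagonals.

(** * The Podles spheres *)

Section PodlesParameters.
Variables (R : realType) (c : \bar R).
Hypothesis c0 : (0 < c)%E.

Definition podles_kappa : R := if c is c'%:E then c' else 1.

Definition podles_mu (s : bool) : R := (podles_lambda c s)^-1.

Lemma podles_kappa_gt0 : 0 < podles_kappa.
Proof. by rewrite /podles_kappa; case: (c) c0 => [c'||] //=; rewrite lte_fin. Qed.

Lemma podles_lambda_sum :
  podles_lambda c false + podles_lambda c true = if c is _%:E then 1 else 0.
Proof.
rewrite /podles_lambda; case: c => [c'||] /=; rewrite !expr0 !expr1 ?subrr //.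
by rewrite mul1r mulN1r; lra.
Qed.

Lemma podles_lambda_prod :
  podles_lambda c false * podles_lambda c true = - podles_kappa.
Proof.
rewrite /podles_lambda /podles_kappa; case: (c) c0 => [c'||] //= c'0.
- rewrite lte_fin in c'0; rewrite !expr0 !expr1 mul1r mulN1r mulrC -subr_sqr sqr_sqrtr; last lra.
  by rewrite expr2; lra.
- by rewrite expr0 expr1 mul1r.
Qed.

Lemma podles_lambda_gt0 : 0 < podles_lambda c false.
Proof.
rewrite /podles_lambda; case: (c) c0 => [c'||] //= c'0; rewrite expr0 ?mul1r.
by rewrite ltr_pwDl ?invr_gt0 ?sqrtr_ge0.
Qed.

Lemma podles_lambda_lt0 : podles_lambda c true < 0.
Proof.
by rewrite -(pmulr_rlt0 _ podles_lambda_gt0) podles_lambda_prod oppr_lt0 podles_kappa_gt0.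
Qed.

Lemma podles_lambda_neq0 s : podles_lambda c s != 0.
Proof.
by case: s; [exact: (ltr0_neq0 podles_lambda_lt0)|exact: (lt0r_neq0 podles_lambda_gt0)].
Qed.

Lemma podles_mu_neq0 s : podles_mu s != 0.
Proof. by rewrite invr_eq0 podles_lambda_neq0. Qed.

Lemma podles_mu_sum : podles_kappa * (podles_mu false + podles_mu true) =
  if c is _%:E then -1 else 0.
Proof.
have [l0 l1] := (podles_lambda_neq0 false, podles_lambda_neq0 true).
have -> : podles_kappa = - (podles_lambda c false * podles_lambda c true).
  by rewrite podles_lambda_prod opprK.
rewrite (_ : _ * _ = - (podles_lambda c false + podles_lambda c true)); last first.
  by rewrite /podles_mu; field; rewrite l0 l1.
by rewrite podles_lambda_sum; case: c => [?||]; rewrite ?oppr0.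
Qed.

Lemma podles_mu_prod : podles_kappa * (podles_mu false * podles_mu true) = -1.
Proof.
rewrite -invfM podles_lambda_prod invrN mulrN divff //.
exact/lt0r_neq0/podles_kappa_gt0.
Qed.

End PodlesParameters.

Section RelatorImages.
Variables (R : realType) (F T : starAlgType R) (f : F -> T).
Hypothesis fH : is_star_hom f.
Implicit Types (x y : F) (k l m : R[i]).

Let fE := (homB fH, homD fH, homN fH, homM fH, homZ fH, hom_star fH, hom1 fH, homX fH).

Lemma hom_sa_relator x : f (star x - x) = star (f x) - f x.
Proof. by rewrite !fE. Qed.

Lemma hom_commutation_relator k x y :
  f (y * x - k *: (x * y)) = f y * f x - k *: (f x * f y).
Proof. by rewrite !fE. Qed.

Lemma hom_bsb_relator k x y : f (star y * y - (x - x ^+ 2 + k *: 1)) =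
  star (f y) * f y - (f x - f x ^+ 2 + k *: 1).
Proof. by rewrite !fE. Qed.

Lemma hom_bsb_relator_oo x y : f (star y * y - (- x ^+ 2 + 1)) =
  star (f y) * f y - (- f x ^+ 2 + 1).
Proof. by rewrite !fE. Qed.

Lemma hom_bbs_relator k l m x y : f (y * star y - (k *: x - l *: x ^+ 2 + m *: 1)) =
  f y * star (f y) - (k *: f x - l *: f x ^+ 2 + m *: 1).
Proof. by rewrite !fE. Qed.

Lemma hom_bbs_relator_oo l x y : f (y * star y - (- (l *: x ^+ 2) + 1)) =
  f y * star (f y) - (- (l *: f x ^+ 2) + 1).
Proof. by rewrite !fE. Qed.

Lemma hom_disc_relator k l x : f (star x * x - k *: (x * star x) - l *: 1) =
  star (f x) * f x - k *: (f x * star (f x)) - l *: 1.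
Proof. by rewrite !fE. Qed.

End RelatorImages.

Section PodlesRelations.
Variables (R : realType) (q : R) (c : \bar R).
Hypothesis c0 : (0 < c)%E.
Local Notation k := (podles_kappa c).
Local Notation mu := (podles_mu c).
Local Notation Q := (q ^+ 2).

(** Writing the quadratic polynomials in A through their roots gives the relations
for finite and infinite c the same form. *)
Record podles_relations (T : starAlgType R) (A B : T) : Prop := PodlesRelations {
  pr_sa : star A = A;
  pr_ba : B * A = Q%:C *: (A * B);
  pr_bsb : star B * B =
    k%:C *: ((1 - (mu false)%:C *: A) * (1 - (mu true)%:C *: A));
  pr_bbs : B * star B =
    k%:C *: ((1 - (Q * mu false)%:C *: A) * (1 - (Q * mu true)%:C *: A)) }.

Lemma podles_quadratic (T : starAlgType R) (x : R) (A : T) :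
  k%:C *: ((1 - (x * mu false)%:C *: A) * (1 - (x * mu true)%:C *: A)) =
  if c is c'%:E then x%:C *: A - (x ^+ 2)%:C *: A ^+ 2 + c'%:C *: 1
  else - ((x ^+ 2)%:C *: A ^+ 2) + 1.
Proof.
have E1 : k * (x * mu false + x * mu true) = x * (if c is _%:E then -1 else 0).
  by rewrite -(podles_mu_sum c0) -mulrDr mulrCA.
have E2 : k * (x * mu false * (x * mu true)) = - x ^+ 2.
  by rewrite -mulrN1 -(podles_mu_prod c0); ring.
rewrite one_subM -rmorphD -rmorphM /= scalerDr scalerBr !scalerA -!rmorphM /= E1 E2.
rewrite rmorphN /= scaleNr /podles_kappa; case: c => [c'||] /=.
- by rewrite mulrN1 rmorphN /= scaleNr opprK -addrA addrC.
- by rewrite mulr0 rmorph0 scale0r subr0 scale1r addrC.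
- by rewrite mulr0 rmorph0 scale0r subr0 scale1r addrC.
Qed.

Lemma podles_relatorsP (T : starAlgType R) (f : free_star R bool -> T) :
  is_star_hom f ->
  (forall x, podles_relators q c x -> f x = 0) <->
  podles_relations (f (free_gen R false)) (f (free_gen R true)).
Proof.
move=> fH.
have sub0 (x y : T) : x - y = 0 -> x = y by move/eqP; rewrite subr_eq0 => /eqP.
have quad1 A : k%:C *: ((1 - (mu false)%:C *: A) * (1 - (mu true)%:C *: A)) =
    k%:C *: ((1 - (1 * mu false)%:C *: A) * (1 - (1 * mu true)%:C *: A)) :> T.
  by rewrite !mul1r.
have q22 : Q ^+ 2 = q ^+ 4 by rewrite -exprM.
split=> [h|[sA bA E1 E2]].
  split.
  - apply: sub0; rewrite -(hom_sa_relator fH); apply: h.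
    by rewrite /podles_relators; case: c => [c'||] /=; do 3!left.
  - apply: sub0; rewrite -(hom_commutation_relator fH); apply: h.
    by rewrite /podles_relators; case: c => [c'||] /=; left; left; right.
  - apply: sub0; rewrite quad1 podles_quadratic expr1n !scale1r.
    move: h; rewrite /podles_relators; case: c => [c'||] h.
    + by rewrite -(hom_bsb_relator fH); apply: h; left; right.
    + by rewrite -(hom_bsb_relator_oo fH); apply: h; left; right.
    + by rewrite -(hom_bsb_relator_oo fH); apply: h; left; right.
  - apply: sub0; rewrite podles_quadratic q22.
    move: h; rewrite /podles_relators; case: c => [c'||] h.
    + by rewrite -(hom_bbs_relator fH); apply: h; right.
    + by rewrite -(hom_bbs_relator_oo fH); apply: h; right.
    + by rewrite -(hom_bbs_relator_oo fH); apply: h; right.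
rewrite quad1 podles_quadratic expr1n !scale1r in E1.
rewrite podles_quadratic q22 in E2.
have K1 := hom_sa_relator fH (free_gen R false); rewrite sA subrr in K1.
have K2 := etrans (hom_commutation_relator fH Q%:C (free_gen R false) (free_gen R true))
  (etrans (congr1 (fun y => y - _) bA) (subrr _)).
move: E1 E2; rewrite /podles_relators; case: c => [c'||] E1 E2 x /= [[[->|->]|->]|->] //.
- by rewrite (hom_bsb_relator fH) E1 subrr.
- by rewrite (hom_bbs_relator fH) E2 subrr.
- by rewrite (hom_bsb_relator_oo fH) E1 subrr.
- by rewrite (hom_bbs_relator_oo fH) E2 subrr.
- by rewrite (hom_bsb_relator_oo fH) E1 subrr.
- by rewrite (hom_bbs_relator_oo fH) E2 subrr.
Qed.

End PodlesRelations.

Lemma closure_dense_free (R : realType) (I : choiceType) (J : set (free_star R I))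
    (J1 : ~ star_ideal J 1) (S : cstarAlgType R) (iota : star_quot J1 -> S) :
  is_cstar_closure iota -> forall (x : S) (d : R), 0 < d ->
  exists p, cnorm (x - (iota \o star_quot_pi J1) p) < d.
Proof.
move=> iC x d d0; have [p hp] := closure_dense iC x d0.
by have [p' pE] := star_quot_pi_surj p; exists p'; rewrite /= -pE.
Qed.

Section PodlesNormalisation.
Variables (R : realType) (q : R) (c : \bar R).
Hypotheses (q_neq0 : 0 < `|q|) (q_lt1 : `|q| < 1) (c0 : (0 < c)%E).
Local Notation k := (podles_kappa c).
Local Notation mu := (podles_mu c).
Local Notation Q := (q ^+ 2).

Lemma sqr_q_gt0 : 0 < Q.
Proof. by rewrite -real_normK ?num_real // exprn_gt0. Qed.

Lemma sqr_q_lt1 : Q < 1.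
Proof. by rewrite -real_normK ?num_real // exprn_ilt1. Qed.

Lemma sqrt_kappa_gt0 : 0 < Num.sqrt k.
Proof. by rewrite sqrtr_gt0 podles_kappa_gt0. Qed.

(** B is rescaled so that star b b takes the value 1 where A vanishes. *)
Definition podles_b (T : starAlgType R) (B : T) : T := (Num.sqrt k)^-1%:C *: B.

Lemma podles_bK (T : starAlgType R) (B : T) : (Num.sqrt k)%:C *: podles_b B = B.
Proof. by rewrite scalerA -rmorphM divff ?scale1r // lt0r_neq0 ?sqrt_kappa_gt0. Qed.

Lemma podles_qdisc_algebra (S : cstarAlgType R) (A B : S) :
  podles_relations q c A B ->
  (forall (x : S) (d : R), 0 < d -> exists p, poly_in A B p /\ cnorm (x - p) < d) ->
  qdisc_algebra Q mu A (podles_b B).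
Proof.
move=> [sA bA E1 E2] dns.
have kk : (Num.sqrt k)^-1 * (Num.sqrt k)^-1 * k = 1.
  have k0 := ltW (podles_kappa_gt0 c0).
  rewrite -{3}(sqr_sqrtr k0); field; exact/lt0r_neq0/sqrt_kappa_gt0.
split=> //.
- exact: sqr_q_gt0.
- exact: sqr_q_lt1.
- rewrite -(pmulr_rle0 _ (podles_kappa_gt0 c0)) podles_mu_prod //; exact: lerN10.
- by rewrite -scalerAl bA -scalerAr !scalerA mulrC.
- by rewrite starZr -scalerAl -scalerAr E1 !scalerA -!rmorphM /= kk scale1r.
- by rewrite starZr -scalerAl -scalerAr E2 !scalerA -!rmorphM /= kk scale1r.
move=> x d /(dns x)[p [pp hp]]; exists p; split=> //.
elim: pp => [|y z _ hy _ hz|l y _ hy|y _ hy|y _ hy|y _ hy].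
- exact: poly_in1.
- exact: poly_inD.
- exact: poly_inZ.
- exact: poly_ina.
- by rewrite -[B]podles_bK -scalerAl; apply: poly_inZ; rewrite podles_bK; exact: poly_inb.
- rewrite -[B]podles_bK starZr -scalerAl; apply: poly_inZ; rewrite podles_bK.
  exact: poly_inbs.
Qed.

Lemma free_image_poly_in (S : starAlgType R) (f : free_star R bool -> S) (A B : S) p :
  is_star_hom f -> f (free_gen R false) = A -> f (free_gen R true) = B ->
  star A = A -> poly_in A B (f p).
Proof.
move=> fH fA fB sA; elim/free_star_ind: p => [|y z hy hz|l y hy|[] y hy|[] y hy].
- by rewrite (hom1 fH); exact: poly_in1.
- by rewrite (homD fH); exact: poly_inD.
- by rewrite (homZ fH); exact: poly_inZ.
- by rewrite (homM fH) fB; exact: poly_inb.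
- by rewrite (homM fH) fA; exact: poly_ina.
- by rewrite (homM fH) (hom_star fH) fB; exact: poly_inbs.
- by rewrite (homM fH) (hom_star fH) fA sA; exact: poly_ina.
Qed.

Lemma podles_weightE s n :
  podles_weight q c s n =
  k * ((1 - Q ^+ n) * (1 - mu (~~ s) / mu s * Q ^+ n)).
Proof.
have [l0 l1] := (podles_lambda_neq0 c0 false, podles_lambda_neq0 c0 true).
have kE : k = - (podles_lambda c false * podles_lambda c true).
  by rewrite podles_lambda_prod // opprK.
rewrite /podles_mu invrK.
have -> : k * ((1 - Q ^+ n) * (1 - (podles_lambda c (~~ s))^-1 * podles_lambda c s * Q ^+ n)) =
    k + podles_lambda c s * Q ^+ n * (podles_lambda c false + podles_lambda c true)
    - (podles_lambda c s * Q ^+ n) ^+ 2.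
  by rewrite kE; case: (s); move: (Q ^+ n) => Z; field; rewrite ?l0 ?l1.
rewrite (podles_lambda_sum c) /podles_weight /podles_kappa exprM.
have sq (s' : bool) : ((-1) ^+ s' * Q ^+ n) ^+ 2 = q ^+ (4 * n) :> R.
  by rewrite exprMn -!exprM -signr_odd oddM andbF mul1r; congr (_ ^+ _); lia.
case: (c) => [c'||] /=; rewrite ?mulr0 ?addr0 ?sq //.
by rewrite mulr1 addrAC; congr (_ - _); rewrite addrC.
Qed.

End PodlesNormalisation.

Section PodlesInstance.
Variables (R : realType) (q : R) (c : \bar R).
Hypotheses (q_neq0 : 0 < `|q|) (q_lt1 : `|q| < 1) (c0 : (0 < c)%E).
Variables (S : cstarAlgType R) (iota : podles q c0 -> S).
Hypothesis iC : is_cstar_closure iota.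
Local Notation mu := (podles_mu c).
Local Notation Q := (q ^+ 2).
Local Notation A := (iota (podlesA q c0)).
Local Notation B := (iota (podlesB q c0)).

Let f := iota \o star_quot_pi (@podles_proper _ q _ c0).

Let fH : is_star_hom f :=
  hom_comp (closure_hom iC) (star_quot_pi_is_star_hom (@podles_proper _ q _ c0)).

Lemma podles_closure_relations : podles_relations q c A B.
Proof.
apply/(podles_relatorsP q c0 fH) => x Sx.
by rewrite /f /= star_quot_pi_eq0 // (hom0 (closure_hom iC)).
Qed.

Lemma podles_closure_qdisc : qdisc_algebra Q mu A (podles_b c B).
Proof.
have rel := podles_closure_relations.
apply: podles_qdisc_algebra => // x d /(closure_dense_free iC x)[p hp].
exists (f p); split=> //; exact: (free_image_poly_in p fH erefl erefl (pr_sa rel)).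
Qed.

Lemma podles_hom (T : cstarAlgType R) (A' B' : T) :
  normed_by_reps T -> podles_relations q c A' B' ->
  exists F : S -> T, [/\ is_star_hom F, F A = A' & F B = B'].
Proof.
move=> Tn rel; pose t (i : bool) := if i then B' else A'.
have eH := free_eval_hom t.
have ev0 : podles_relations q c (free_eval t (free_gen R false))
    (free_eval t (free_gen R true)).
  apply: (eq_ind_r (fun x => podles_relations q c x _) _ (free_eval_gen t false)).
  exact: (eq_ind_r (podles_relations q c A') rel (free_eval_gen t true)).
have ker := (podles_relatorsP q c0 eH).2 ev0.
have [g [gH gE]] := presented_hom (@podles_proper _ q _ c0) ker.
have [F [FH FE]] := closure_hom_extension iC Tn gH.
by exists F; split=> //; rewrite FE gE free_eval_gen.
Qed.

Lemma podles_qdisc_rep (H : hilbertType R) (e : nat -> H) s pi :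
  is_podles_rep iota e s pi -> qdisc_rep Q mu A (podles_b c B) e s pi.
Proof.
move=> [piS pA pB0 pBS]; split=> // [n||n].
- by rewrite pA /podles_mu invrK mulrC exprM.
- by rewrite (repZ piS) pB0 scaler0.
rewrite (repZ piS) pBS scalerA -rmorphM /= podles_weightE //.
rewrite sqrtrM ?(ltW (podles_kappa_gt0 c0)) // mulKf //.
exact: (lt0r_neq0 (sqrt_kappa_gt0 c0)).
Qed.

End PodlesInstance.

(** * The quantum disc *)

Section DiscInstance.
Variables (R : realType) (s : R).
Hypotheses (s_gt0 : 0 < s) (s_lt1 : s < 1).
Variables (D : cstarAlgType R) (iota : qdisc s -> D).
Hypothesis iC : is_cstar_closure iota.

Local Notation X := (iota (star_quot_pi (@disc_proper _ s) (free_gen R tt))).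

Definition disc_mu (s : bool) : R := if s then 0 else 1.

Definition disc_relation (T : starAlgType R) (x : T) : Prop :=
  star x * x = s%:C *: (x * star x) + (1 - s)%:C *: 1.

Lemma disc_relatorsP (T : starAlgType R) (f : free_star R unit -> T) :
  is_star_hom f ->
  (forall x, disc_relators s x -> f x = 0) <-> disc_relation (f (free_gen R tt)).
Proof.
move=> fH; rewrite /disc_relation.
split=> [h|h x ->].
  have := h _ erefl; rewrite (hom_disc_relator fH) => /eqP.
  by rewrite -addrA -opprD subr_eq0 => /eqP.
by rewrite (hom_disc_relator fH) h -addrA -opprD subrr.
Qed.

Let f := iota \o star_quot_pi (@disc_proper _ s).

Let fH : is_star_hom f :=
  hom_comp (closure_hom iC) (star_quot_pi_is_star_hom (@disc_proper _ s)).

Lemma disc_closure_relation : disc_relation X.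
Proof.
apply/(disc_relatorsP fH) => x Sx.
by rewrite /f /= star_quot_pi_eq0 // (hom0 (closure_hom iC)).
Qed.

Lemma disc_qdisc_algebra : qdisc_algebra s disc_mu (1 - X * star X) (star X).
Proof.
have rel := disc_closure_relation; rewrite /disc_relation in rel.
have dns (x : D) (d : R) : 0 < d ->
    exists p, poly_in (1 - X * star X) (star X) p /\ cnorm (x - p) < d.
  move=> /(closure_dense_free iC x)[p hp]; exists (f p); split=> // {hp}.
  rewrite -[X]/(f (free_gen R tt)).
  elim/free_star_ind: p => [|y z hy hz|l y hy|[] y hy|[] y hy].
  - exact: (eq_ind_r (poly_in _ _) (poly_in1 _ _) (hom1 fH)).
  - by rewrite (homD fH); exact: poly_inD.
  - by rewrite (homZ fH); exact: poly_inZ.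
  - by rewrite (homM fH) -[X in poly_in _ _ (X * _)]starK; exact: poly_inbs.
  - by rewrite (homM fH) (hom_star fH); exact: poly_inb.
move: X rel dns => x rel dns.
have one_sub : 1 - star x * x = s%:C *: (1 - x * star x).
  rewrite rel scalerBr rmorphB /= scalerBl scale1r opprD opprB addrCA.
  by rewrite [1 + _]addrC subrK addrC.
split=> //.
- by rewrite /disc_mu mulr0.
- by rewrite starB star1 starM starK.
- by rewrite mulrBr mulr1 mulrA -{1}[star x]mul1r -mulrBl one_sub scalerAl.
- by rewrite starK /disc_mu scale0r subr0 mulr1 scale1r subKr.
- by rewrite starK /disc_mu mulr0 mulr1 scale0r subr0 mulr1 -one_sub subKr.
Qed.

Lemma disc_hom (T : cstarAlgType R) (x : T) :
  normed_by_reps T -> disc_relation x ->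
  exists F : D -> T, is_star_hom F /\ F X = x.
Proof.
move=> Tn rel; pose t (i : unit) := x.
have eH := free_eval_hom t.
have [|g [gH gE]] := @presented_hom _ _ _ t _ (@disc_proper _ s).
  by apply/(disc_relatorsP eH); rewrite free_eval_gen.
have [F [FH FE]] := closure_hom_extension iC Tn gH.
by exists F; split=> //; rewrite FE gE free_eval_gen.
Qed.

Lemma disc_qdisc_rep (H : hilbertType R) (e : nat -> H) rho t :
  is_star_rep rho ->
  (rho (star X) (e 0%N) = 0) ->
  (forall n, rho (star X) (e n.+1) = (Num.sqrt (1 - s ^+ n.+1))%:C *: e n) ->
  orthonormal_basis e -> disc_mu t != 0 ->
  qdisc_rep s disc_mu (1 - X * star X) (star X) e t rho.
Proof.
move=> rR x0 xS eB; case: t; rewrite /disc_mu ?eqxx // => _.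
have w n : (1 - s ^+ n) = (1 - s ^+ n) * (1 - 0 / 1 * s ^+ n).
  by rewrite !mul0r subr0 mulr1.
have xs n : rho X (e n) = (Num.sqrt (1 - s ^+ n.+1))%:C *: e n.+1.
  by rewrite -[X]starK; exact: (onb_adjoint_shift eB rR x0 xS).
split=> // [[|n]|n].
- by rewrite (repB rR) (rep1 rR) (repM rR) x0 (rep0v rR) subr0 expr0 divr1 scale1r.
- rewrite (repB rR) (rep1 rR) (repM rR) xS (repZv rR) xs scalerA -rmorphM -expr2 divr1.
  rewrite sqr_sqrtr; last by rewrite subr_ge0 exprn_ile1 // ltW.
  by rewrite -{1}[e _]scale1r -scalerBl -(rmorph1 (real_complex R)) -rmorphB subKr.
- by rewrite xS /qd_weight -w.
Qed.

End DiscInstance.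

(** * Homomorphisms between the algebras *)

Section RepresentationsAgree.
Variables (R : realType) (S : cstarAlgType R) (H : hilbertType R).
Variables (rho1 rho2 : S -> H -> H).
Hypotheses (R1 : is_star_rep rho1) (R2 : is_star_rep rho2).

Lemma reps_agree_star x : (forall v, rho1 x v = rho2 x v) ->
  forall v, rho1 (star x) v = rho2 (star x) v.
Proof.
move=> h v; apply/eqP; rewrite -subr_eq0; apply/eqP; apply: inner_self_eq0.
by rewrite innerBl (rep_adj R1) (rep_adj R2) starK h subrr.
Qed.

Lemma reps_agree (Q : R) (mu : bool -> R) (a b : S) : qdisc_algebra Q mu a b ->
  (forall v, rho1 a v = rho2 a v) -> (forall v, rho1 b v = rho2 b v) ->
  forall x v, rho1 x v = rho2 x v.
Proof.
move=> QD ha hb x v; apply/eqP; rewrite -subr_eq0; apply/eqP.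
have cH := vnorm_is_complete H; have hbs := reps_agree_star hb.
apply: (dense_eq0 (NS := @cnorm R S) (F := fun x => rho1 x v - rho2 x v) (K := vnorm v * 2)
  (cn_ge0 cH) (cn_eq0 cH)) => [|y z|y|y d d0].
- by rewrite mulr_ge0 ?vnorm_ge0.
- by rewrite (repB R1) (repB R2) subBB.
- apply: le_trans (cnB cH _ _) _.
  have := rep_contractive R1 y v; have := rep_contractive R2 y v; lra.
have [p [pp hp]] := qd_dense QD y d0; exists p; split=> //.
suff h w : rho1 p w = rho2 p w by rewrite h subrr.
elim: pp w => [|z t _ hz _ ht|k z _ hz|z _ hz|z _ hz|z _ hz] w.
- by rewrite (rep1 R1) (rep1 R2).
- by rewrite (repD R1) (repD R2) hz ht.
- by rewrite (repZ R1) (repZ R2) hz.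
- by rewrite (repM R1) (repM R2) hz ha.
- by rewrite (repM R1) (repM R2) hz hb.
- by rewrite (repM R1) (repM R2) hz hbs.
Qed.

End RepresentationsAgree.

Lemma podles_nu_le0 (R : realType) (c : \bar R) s : (0 < c)%E ->
  podles_mu c (~~ s) / podles_mu c s <= 0.
Proof.
move=> c0; have l0 := podles_lambda_gt0 c0; have l1 := podles_lambda_lt0 c0.
rewrite /podles_mu; case: s => /=; rewrite invrK.
  by rewrite mulr_ge0_le0 ?invr_ge0 // ltW.
by rewrite mulr_le0_ge0 ?invr_le0 // ltW.
Qed.

Section PodlesModels.
Variables (R : realType) (q : R) (c : \bar R).
Hypotheses (q_neq0 : 0 < `|q|) (q_lt1 : `|q| < 1) (c0 : (0 < c)%E).
Local Notation Q := (q ^+ 2).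
Variables (H : hilbertType R) (e : nat -> H).
Hypothesis eB : orthonormal_basis e.

Let Q0 : 0 < Q := sqr_q_gt0 q_neq0.
Let Q1 : Q < 1 := sqr_q_lt1 q_lt1.

Lemma podles_weight_ge0 s n : 0 <= podles_weight q c s n.
Proof.
rewrite podles_weightE //; apply: mulr_ge0; first exact/ltW/podles_kappa_gt0.
apply: mulr_ge0; first by rewrite subr_ge0 exprn_ile1 // ltW.
rewrite subr_ge0; apply: le_trans ler01.
apply: mulr_le0_ge0; last by rewrite exprn_ge0 // ltW.
exact: podles_nu_le0.
Qed.

Variables (S : cstarAlgType R) (Q' : R) (mu : bool -> R) (a b : S).
Hypothesis QD : qdisc_algebra Q' mu a b.
Variable pi : bool -> S -> H -> H.
Hypothesis piR : forall s, mu s != 0 -> qdisc_rep Q' mu a b e s (pi s).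
Variable s0 : bool.
Hypothesis s00 : mu s0 != 0.

Local Notation diag := (acts_diagonally mu e pi).

(** Candidates A and B for the generators of the sphere with parameter c, tested
under each pi s against the representation of sign sgn s. The map sgn is the
identity for the change of parameter, negb for the flip, and constant for the
disc. *)
Definition podles_model (sgn : bool -> bool) (A B : S) : Prop :=
  forall s, mu s != 0 ->
  [/\ forall k, pi s A (e k) = (podles_lambda c (sgn s) * q ^+ (2 * k))%:C *: e k,
      pi s B (e 0%N) = 0 &
      forall k, pi s B (e k.+1) =
        (Num.sqrt (podles_weight q c (sgn s) k.+1))%:C *: e k].

Section Relations.
Variables (sgn : bool -> bool) (A B : S).
Hypothesis model : podles_model sgn A B.

Let l s k := podles_lambda c (sgn s) * Q ^+ k.

Let diagA : diag A l.
Proof. by move=> s sn0 k; have [-> _ _] := model sn0; rewrite /l exprM. Qed.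

Lemma model_Bs s k : mu s != 0 ->
  pi s (star B) (e k) = (Num.sqrt (podles_weight q c (sgn s) k.+1))%:C *: e k.+1.
Proof.
move=> sn0; have [piS _ _ _] := piR sn0; have [_ B0 BS] := model sn0.
exact: (onb_adjoint_shift eB piS B0 BS).
Qed.

Lemma diag_quadratic x y z : diag (z%:C *: ((1 - x%:C *: A) * (1 - y%:C *: A)))
  (fun s k => z * ((1 - x * l s k) * (1 - y * l s k))).
Proof.
move=> s sn0 k; have [piS _ _ _] := piR sn0.
have lin w : pi s (1 - w%:C *: A) (e k) = (1 - w * l s k)%:C *: e k.
  rewrite (repB piS) (rep1 piS) (repZ piS) diagA // scalerA -rmorphM rmorphB rmorph1.
  by rewrite scalerBl scale1r.
rewrite (repZ piS) (repM piS) lin (repZv piS) lin !scalerA -!rmorphM /=.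
by congr (_%:C *: _); ring.
Qed.

Lemma weight_quadratic s k : podles_kappa c *
    ((1 - podles_mu c false * l s k) * (1 - podles_mu c true * l s k)) =
  podles_weight q c (sgn s) k.
Proof.
have l0 := podles_lambda_neq0 c0.
rewrite podles_weightE // /l /podles_mu; congr (_ * _).
by case: (sgn s) => /=; field; rewrite ?l0.
Qed.

(** By faithfulness both sides of a relation need only be compared on the basis. *)
Lemma model_relations : podles_relations q c A B.
Proof.
have null_ext x y : (forall s, mu s != 0 -> forall k, pi s x (e k) = pi s y (e k)) -> x = y.
  move=> h; apply/eqP; rewrite -subr_eq0; apply/eqP.
  apply: (qd_injective QD eB piR s00) => s sn0 v; have [piS _ _ _] := piR sn0.
  by rewrite (repB piS) (onb_ext (y := y) eB piS piS) ?subrr // => i; exact: h.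
split.
- exact: (diagonal_unique QD eB piR s00 (diagonal_star eB piR diagA) diagA).
- apply: null_ext => s sn0 k; have [piS _ _ _] := piR sn0; have [_ B0 BS] := model sn0.
  rewrite (repZ piS) !(repM piS) diagA // (repZv piS); case: k => [|k].
    by rewrite B0 (rep0v piS) !scaler0.
  rewrite BS (repZv piS) diagA // !scalerA -!rmorphM /= /l exprS.
  by congr (_%:C *: _); ring.
- apply: null_ext => s sn0 k; have [piS _ _ _] := piR sn0; have [_ B0 BS] := model sn0.
  rewrite diag_quadratic // weight_quadratic (repM piS); case: k => [|k].
    by rewrite B0 (rep0v piS) podles_weightE // expr0 subrr mul0r mulr0 rmorph0 scale0r.
  rewrite BS (repZv piS) model_Bs // scalerA -rmorphM -expr2 sqr_sqrtr //.
  exact: podles_weight_ge0.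
- apply: null_ext => s sn0 k; have [piS _ _ _] := piR sn0; have [_ B0 BS] := model sn0.
  rewrite diag_quadratic // (repM piS) model_Bs // (repZv piS) BS scalerA -rmorphM -expr2.
  rewrite sqr_sqrtr ?podles_weight_ge0 //; congr (_%:C *: _).
  by rewrite -weight_quadratic /l exprS; ring.
Qed.

(** Both pi s o F and p1 (sgn s) represent the sphere, and they agree on its
generators. *)
Lemma podles_transfer (S1 : cstarAlgType R) (iota : podles q c0 -> S1)
    (p1 : bool -> S1 -> H -> H) :
  is_cstar_closure iota -> (forall s, is_podles_rep iota e s (p1 s)) ->
  normed_by_reps S ->
  exists F : S1 -> S, is_star_hom F /\
    forall s, mu s != 0 -> forall x v, pi s (F x) v = p1 (sgn s) x v.
Proof.
move=> iC p1R Sn; have [F [FH FA FB]] := podles_hom iC Sn model_relations.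
exists F; split=> // s sn0 x v; have [piS _ _ _] := piR sn0.
have [mA mB0 mBS] := model sn0; have [pS pA pB0 pBS] := p1R (sgn s).
have FS := rep_hom FH piS.
have QD1 := podles_closure_qdisc q_neq0 q_lt1 iC.
apply: (reps_agree FS pS QD1) => {}v; apply: (onb_ext eB FS pS) => k /=.
  by rewrite FA mA pA.
rewrite (homZ FH) (repZ piS) (repZ pS) FB; case: k => [|k]; first by rewrite mB0 pB0.
by rewrite mBS pBS.
Qed.

End Relations.
End PodlesModels.

Section PodlesExchange.
Variables (R : realType) (q : R) (c1 c2 : \bar R).
Hypotheses (q_neq0 : 0 < `|q|) (q_lt1 : `|q| < 1).
Hypotheses (c1_gt0 : (0 < c1)%E) (c2_gt0 : (0 < c2)%E).
Local Notation Q := (q ^+ 2).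
Variables (H : hilbertType R) (e : nat -> H).
Hypothesis eB : orthonormal_basis e.
Variables (S : cstarAlgType R) (a b : S).
Hypothesis QD : qdisc_algebra Q (podles_mu c2) a b.
Variable pi : bool -> S -> H -> H.
Hypothesis piR : forall s, podles_mu c2 s != 0 -> qdisc_rep Q (podles_mu c2) a b e s (pi s).

Let Q0 : 0 < Q := sqr_q_gt0 q_neq0.
Let Q1 : Q < 1 := sqr_q_lt1 q_lt1.

Let nu (c : \bar R) s := podles_mu c (~~ s) / podles_mu c s.

(** For both signs the ratio of the weights of the two spheres tends to the same
limit geometrically, so that B can be b times a diagonal element. *)
Lemma podles_model_exists : exists A B, podles_model q c1 e (podles_mu c2) pi id A B.
Proof.
pose rat s k := Num.sqrt ((1 - nu c1 s * Q ^+ k) / (1 - nu c2 s * Q ^+ k)).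
pose sk := Num.sqrt (podles_kappa c1).
have m0 := podles_mu_neq0 c2_gt0 false.
have Qk k : 0 <= Q ^+ k by rewrite exprn_ge0 // ltW.
have den c s k : (0 < c)%E -> 1 <= 1 - nu c s * Q ^+ k.
  move=> c0; rewrite lerDl oppr_ge0 mulr_le0_ge0 //; exact: podles_nu_le0.
have ratb s k : `|rat s k - 1| <= `|nu c2 s - nu c1 s| * Q ^+ k.
  have d1 := den c1 s k c1_gt0; have d2 := den c2 s k c2_gt0.
  have d2p : 0 < 1 - nu c2 s * Q ^+ k by apply: lt_le_trans d2.
  have rp : 0 <= rat s k by exact: sqrtr_ge0.
  have sq : rat s k ^+ 2 - 1 = (nu c2 s - nu c1 s) * Q ^+ k / (1 - nu c2 s * Q ^+ k).
    rewrite sqr_sqrtr; first by field; exact: lt0r_neq0.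
    by rewrite divr_ge0 // ltW // (lt_le_trans ltr01).
  apply: le_trans (_ : `|rat s k ^+ 2 - 1| <= _).
    rewrite subr_sqr_1 normrM ler_peMr // ger0_norm ?addr_ge0 //; lra.
  rewrite sq !normrM normfV (ger0_norm (Qk k)) (gtr0_norm d2p).
  by rewrite ler_pdivrMr // ler_peMr // mulr_ge0.
have [s k|A hA] := @diagonal_element _ _ _ _ _ _ QD _ _ _ eB piR _ m0
  (fun s k => podles_lambda c1 s * Q ^+ k) 0
  (`|podles_lambda c1 false| + `|podles_lambda c1 true|) Q (ltW Q0) Q1
  (addr_ge0 (normr_ge0 _) (normr_ge0 _)).
  rewrite subr0 normrM (ger0_norm (Qk k)) ler_wpM2r //.
  by case: s; rewrite ?lerDl ?lerDr.
pose C := sk * (`|nu c2 false - nu c1 false| + `|nu c2 true - nu c1 true|).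
have sk0 : 0 <= sk by exact: sqrtr_ge0.
have C0 : 0 <= C by rewrite mulr_ge0 // addr_ge0.
have [s k|d hd] := @diagonal_element _ _ _ _ _ _ QD _ _ _ eB piR _ m0
  (fun s k => sk * rat s k) sk C Q (ltW Q0) Q1 C0.
  rewrite -[X in _ - X]mulr1 -mulrBr normrM (ger0_norm sk0) /C -mulrA.
  rewrite ler_wpM2l //; apply: le_trans (ratb s k) _; rewrite ler_wpM2r //.
  by case: s; rewrite ?lerDl ?lerDr.
exists A, (b * d) => s sn0; have [piS _ pb0 pbS] := piR sn0; split=> [k||k].
- by rewrite hA // exprM.
- by rewrite (repM piS) hd // (repZv piS) pb0 scaler0.
rewrite (repM piS) hd // (repZv piS) pbS scalerA -rmorphM /=; congr (_%:C *: _).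
have d1 := den c1 s k.+1 c1_gt0; have d2 := den c2 s k.+1 c2_gt0.
have d2p : 0 < 1 - nu c2 s * Q ^+ k.+1 by apply: lt_le_trans d2.
have d1p : 0 < 1 - nu c1 s * Q ^+ k.+1 by apply: lt_le_trans d1.
have k0 := podles_kappa_gt0 c1_gt0.
rewrite /sk /rat /qd_weight -/(nu c2 s) -sqrtrM; last exact: ltW.
rewrite -sqrtrM; last by rewrite mulr_ge0 ?divr_ge0 // ltW.
rewrite podles_weightE // -/(nu c1 s); congr Num.sqrt.
by move: (nu c1 s) (nu c2 s) d2p => n1 n2 d2p; field; exact: lt0r_neq0.
Qed.

End PodlesExchange.

(** * The invariants *)

Lemma inverseK (R : realType) (S : cstarAlgType R) (T : Type) (f : S -> T) :
  injective f -> cancel f (inverse f).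
Proof. by move=> fI x; apply: pinvKV => [y z _ _|]; [exact: fI|rewrite inE]. Qed.

Section Faithful.
Variables (R : realType) (q : R) (c : \bar R).
Hypotheses (q_neq0 : 0 < `|q|) (q_lt1 : `|q| < 1) (c0 : (0 < c)%E).
Variables (S : cstarAlgType R) (iota : podles q c0 -> S).
Hypothesis iC : is_cstar_closure iota.
Variables (H : hilbertType R) (e : nat -> H) (p : bool -> S -> H -> H).
Hypotheses (eB : orthonormal_basis e) (pR : forall s, is_podles_rep iota e s (p s)).

Lemma podles_faithful x y : (forall s v, p s x v = p s y v) -> x = y.
Proof.
move=> h; apply/eqP; rewrite -subr_eq0; apply/eqP.
have QD := podles_closure_qdisc q_neq0 q_lt1 iC.
have piR s (_ : podles_mu c s != 0) := podles_qdisc_rep q_neq0 q_lt1 (pR s).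
apply: (qd_injective QD eB piR (podles_mu_neq0 c0 false)) => s _ v.
by have [pS _ _ _] := pR s; rewrite (repB pS) h subrr.
Qed.

Lemma podles_rep_sum_inj : injective (rep_sum (p false) (p true)).
Proof.
move=> x y [xy0 xy1]; apply: podles_faithful => s v.
by case: s; [rewrite xy1|rewrite xy0].
Qed.

End Faithful.

Section DiscAndSphere.
Variables (R : realType) (q : R).
Hypotheses (q_neq0 : 0 < `|q|) (q_lt1 : `|q| < 1).
Variables (S : cstarAlgType R) (iota : podles q (ltry (0 : R)) -> S).
Hypothesis iC : is_cstar_closure iota.
Variables (D : cstarAlgType R) (iD : qdisc (q ^+ 4) -> D).
Hypothesis DC : is_cstar_closure iD.
Variables (H : hilbertType R) (e : nat -> H) (p : bool -> S -> H -> H).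
Hypotheses (eB : orthonormal_basis e) (pR : forall s, is_podles_rep iota e s (p s)).

Local Notation A := (iota (podlesA q (ltry (0 : R)))).
Local Notation B := (iota (podlesB q (ltry (0 : R)))).
Local Notation X := (iD (star_quot_pi (@disc_proper _ (q ^+ 4)) (free_gen R tt))).

Let s_gt0 : 0 < q ^+ 4.
Proof. by rewrite (exprM q 2 2) exprn_gt0 // sqr_q_gt0. Qed.

Let s_lt1 : q ^+ 4 < 1.
Proof. by rewrite (exprM q 2 2) exprn_ilt1 ?sqr_q_lt1 // ltW // sqr_q_gt0. Qed.

Lemma star_B_disc_relation : disc_relation (q ^+ 4) (star B).
Proof.
have [_ _ E1 E2] := podles_closure_relations iC.
rewrite /disc_relation starK E1 E2 podles_quadratic //.
have := podles_quadratic (ltry (0 : R)) 1 A; rewrite !mul1r => ->.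
rewrite expr1n scale1r -exprM scalerDr scalerN rmorphB /= rmorph1 scalerBl scale1r.
by rewrite -addrA [_ *: 1 + _]addrC subrK.
Qed.

(** The maps are x |-> B^* and B |-> x^*, A |-> |A|. The second exists because the
disc algebra contains the diagonal operator with eigenvalues q^(2k). The matrix
elements of B^* are the same under pi_+ and pi_-. *)
Lemma disc_sphere_homs : exists (phi : D -> S) (psi : S -> D),
  [/\ is_star_hom phi, is_star_hom psi,
      forall z v, p false (phi z) v = p true (phi z) v,
      forall x v, p false (phi (psi x)) v = p false x v &
      forall z, psi (phi z) = z].
Proof.
have [phi [phiH phiX]] := disc_hom DC (closure_normed_by_reps iC) star_B_disc_relation.
have pS s : is_star_rep (p s) by case: (pR s).
have rD s := rep_hom phiH (pS s).
have w n : podles_weight q +oo false n = 1 - (q ^+ 4) ^+ n.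
  by rewrite /podles_weight exprM.
have w' n : podles_weight q +oo true n = 1 - (q ^+ 4) ^+ n.
  by rewrite /podles_weight exprM.
have DB s v : (p s \o phi) (star X) v = p s B v.
  by rewrite /= (hom_star phiH) phiX starK.
have QDD := disc_qdisc_algebra s_gt0 s_lt1 DC.
have piD t : disc_mu R t != 0 -> qdisc_rep (q ^+ 4) (disc_mu R) (1 - X * star X)
    (star X) e t (p false \o phi).
  apply: (disc_qdisc_rep s_gt0 s_lt1) => // [|n].
    by rewrite DB; case: (pR false).
  by rewrite DB; have [_ _ _ ->] := pR false; rewrite w.
have pp z v : p false (phi z) v = p true (phi z) v.
  have hB u : (p false \o phi) (star X) u = (p true \o phi) (star X) u.
    rewrite !DB; apply: (onb_ext eB (pS false) (pS true)) => -[|k].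
      by have [_ _ -> _] := pR false; have [_ _ -> _] := pR true.
    by have [_ _ _ ->] := pR false; have [_ _ _ ->] := pR true; rewrite w w'.
  have hX u : (p false \o phi) X u = (p true \o phi) X u.
    by rewrite -[X]starK; exact: (reps_agree_star (rD false) (rD true) hB).
  apply: (reps_agree (rD false) (rD true) QDD) => // u.
  rewrite (repB (rD false)) (repB (rD true)) (rep1 (rD false)) (rep1 (rD true)).
  by rewrite (repM (rD false)) (repM (rD true)) hB hX.
have m0 : disc_mu R false != 0 by rewrite /disc_mu oner_eq0.
have Q0 := sqr_q_gt0 q_neq0; have Q1 := sqr_q_lt1 q_lt1.
have [s k|A' hA'] := @diagonal_element _ _ _ _ _ _ QDD _ _ _ eB piD _ m0
  (fun _ k => (q ^+ 2) ^+ k) 0 1 (q ^+ 2) (ltW Q0) Q1 ler01.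
  by rewrite subr0 mul1r ger0_norm // exprn_ge0 // ltW.
have model : podles_model q +oo e (disc_mu R) (fun=> p false \o phi) (fun=> false)
    A' (star X).
  move=> s s0; split=> [k||k].
  - by rewrite (hA' s s0) /podles_lambda expr0 mul1r exprM.
  - by rewrite DB; case: (pR false).
  - by rewrite DB; case: (pR false).
have [psi [psiH psiE]] := podles_transfer q_neq0 q_lt1 eB QDD piD m0 model iC pR
  (closure_normed_by_reps DC).
have ppsi x v : p false (phi (psi x)) v = p false x v by exact: (psiE false m0).
exists phi, psi; split=> // z; apply/eqP; rewrite -subr_eq0; apply/eqP.
apply: (qd_injective QDD eB piD m0) => s s0 v.
by rewrite (repB (rD false)) /= ppsi subrr.
Qed.

End DiscAndSphere.

Theorem corollary3p5 (R : realType) (q : R) (q_neq0 : 0 < `|q|) (q_lt1 : `|q| < 1)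
  (c : \bar R) (c_gt0 : (0 < c)%E)
  (* C(S^2_{q oo}), C(S^2_{qc}) and C(D_{q^4}) *)
  (Sinf : cstarAlgType R) (iinf : podles q (ltry (0 : R)) -> Sinf)
  (Sinf_closure : is_cstar_closure iinf)
  (Sc : cstarAlgType R) (ic : podles q c_gt0 -> Sc)
  (Sc_closure : is_cstar_closure ic)
  (D : cstarAlgType R) (iD : qdisc (q ^+ 4) -> D)
  (D_closure : is_cstar_closure iD)
  (* the representations pi_+, pi_-, pi^c_+ and pi^c_- *)
  (H : hilbertType R) (e : nat -> H) (e_basis : orthonormal_basis e)
  (pp pm : Sinf -> H -> H)
  (pp_rep : is_podles_rep iinf e false pp) (pm_rep : is_podles_rep iinf e true pm)
  (ppc pmc : Sc -> H -> H)
  (ppc_rep : is_podles_rep ic e false ppc) (pmc_rep : is_podles_rep ic e true pmc) :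
  isomorphic_onto D [set a : Sc | rbar1c pp pm ppc pmc a = a].
Proof.
pose pi s := if s then pm else pp; pose pic s := if s then pmc else ppc.
have piR s : is_podles_rep iinf e s (pi s) by case: s.
have picR s : is_podles_rep ic e s (pic s) by case: s.
have [oo0 nI nC] := And3 (ltry (0 : R)) (closure_normed_by_reps Sinf_closure)
  (closure_normed_by_reps Sc_closure).
have QI := podles_closure_qdisc q_neq0 q_lt1 Sinf_closure.
have QC := podles_closure_qdisc q_neq0 q_lt1 Sc_closure.
have qI s (_ : podles_mu (+oo : \bar R) s != 0) := podles_qdisc_rep q_neq0 q_lt1 (piR s).
have qC s (_ : podles_mu c s != 0) := podles_qdisc_rep q_neq0 q_lt1 (picR s).
have [mI mC] := (podles_mu_neq0 oo0, podles_mu_neq0 c_gt0).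
have fI := podles_faithful q_neq0 q_lt1 Sinf_closure e_basis piR.
have fC := podles_faithful q_neq0 q_lt1 Sc_closure e_basis picR.
(* The spheres for c and infinity are exchanged by theta and theta'. *)
have [A1 [B1 M1]] := podles_model_exists q_neq0 q_lt1 c_gt0 oo0 e_basis QI qI.
have [theta [thetaH thetaE]] := podles_transfer q_neq0 q_lt1 e_basis QI qI (mI false)
  M1 Sc_closure picR nI.
have [A2 [B2 M2]] := podles_model_exists q_neq0 q_lt1 oo0 c_gt0 e_basis QC qC.
have [theta' [thetaH' thetaE']] := podles_transfer q_neq0 q_lt1 e_basis QC qC (mC false)
  M2 Sinf_closure piR nC.
(* The flip r is A |-> -A, B |-> B. *)
have M3 : podles_model q +oo e (podles_mu +oo) pi negb
    (- iinf (podlesA q (ltry 0))) (iinf (podlesB q (ltry 0))).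
  move=> s _; have [pS pA pB0 pBS] := piR s; split=> [k||k].
  - by rewrite (repN pS) pA -scaleNr -rmorphN -mulNr; case: (s); rewrite /= ?expr0 ?expr1 ?opprK.
  - exact: pB0.
  - by rewrite pBS; congr (_%:C *: _); case: (s).
have [r [rH rE]] := podles_transfer q_neq0 q_lt1 e_basis QI qI (mI false)
  M3 Sinf_closure piR nI.
have [phi [psi [phiH psiH phiE psiE psiK]]] :=
  disc_sphere_homs q_neq0 q_lt1 Sinf_closure D_closure e_basis piR.
have thetaK x : theta' (theta x) = x.
  by apply: fC => s v; rewrite (thetaE' s (mC s)) (thetaE s (mI s)).
have thetaK' x : theta (theta' x) = x.
  by apply: fI => s v; rewrite (thetaE s (mI s)) (thetaE' s (mC s)).
have sumI := podles_rep_sum_inj q_neq0 q_lt1 Sinf_closure e_basis piR.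
have chiE : chi pp pm ppc pmc = theta.
  apply/funext => x; rewrite -[RHS](inverseK sumI) /chi /= /rep_sum.
  congr (inverse _ (_, _)); apply/funext => v; apply/esym.
    exact: (thetaE false (mI false)).
  exact: (thetaE true (mI true)).
have rbarE : rbar1 pp pm = r.
  apply/funext => x; rewrite -[RHS](inverseK sumI) /rbar1 /= /rep_sum /flip /=.
  congr (inverse _ (_, _)); apply/funext => v; apply/esym.
    exact: (rE false (mI false)).
  exact: (rE true (mI true)).
have phiE' z v : pp (phi z) v = pm (phi z) v := phiE z v.
have psiE' x v : pp (phi (psi x)) v = pp x v := psiE x v.
have rE0 x v : pp (r x) v = pm x v := rE false (mI false) x v.
have rE1 x v : pm (r x) v = pp x v := rE true (mI true) x v.
have rbarcE a : rbar1c pp pm ppc pmc a = theta' (r (theta a)).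
  rewrite /rbar1c /= chiE rbarE -[X in inverse _ X]thetaK'.
  exact: (inverseK (can_inj thetaK)).
exists (theta' \o phi); split; first exact: hom_comp.
  by move=> y z /(congr1 theta) /=; rewrite !thetaK' => /(congr1 psi); rewrite !psiK.
apply/seteqP; split=> [_ [z _ <-]|a /=].
  rewrite /= rbarcE thetaK'; congr theta'; apply: fI => s v.
  by case: s; rewrite /= ?rE0 ?rE1 phiE'.
rewrite rbarcE => fixed; exists (psi (theta a)) => //=; rewrite -[RHS]thetaK; congr theta'.
have eq_pm v : pm (theta a) v = pp (theta a) v.
  by rewrite -rE0 -[in RHS]fixed thetaK'.
by apply: fI => s v; case: s => /=; rewrite -?phiE' psiE' ?eq_pm.
Qed.
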